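(* Let $k\ge 3$ be an integer and let $(\tilde u,\tilde\rho)\in H^k(\mathbb S)\times H^{k-1}(\mathbb S)$ satisfy $\tilde u(0)=0$ and $\|\tilde u_x\|^2+\|\tilde\rho\|^2=4$. Let $T^*\in(0,\infty]$ be the maximal time of existence and let $$(u,\rho)\in C\big([0,T^* );H^k(\mathbb S)\times H^{k-1}(\mathbb S)\big)\cap C^1\big([0,T^* );H^{k-1}(\mathbb S)\times H^{k-2}(\mathbb S)\big),\qquad u(t,0)=0 \text{ for all } t\in[0,T^* ),$$ be the solution of the two-component Hunter-Saxton system $$u_{txx}+u\,u_{xxx}+2u_xu_{xx}=\rho\rho_x,\qquad \rho_t+(u\rho)_x=0,\qquad t>0,\ x\in\mathbb S,$$ with $u(0,x)=\tilde u(x)$, $\rho(0,x)=\tilde\rho(x)$. Let $\varphi(t,x)$, with $\varphi(t,0)=0$ for $t\in[0,T^* )$, solve the Lagrangian flow map equation $\varphi_t(t,x)=u(t,\varphi(t,x))$, $\varphi(0,x)=x$. Then: (1) For $t\in[0,T^* )$ and $x\in[0,1]$, $$\varphi(t,x)=\int_0^x\left\{\Big(\cos t+\frac{\tilde u_x(y)}{2}\sin t\Big)^2+\frac{\tilde\rho(y)^2}{4}\sin^2 t\right\}dy .$$ (2) The first time at which the diffeomorphism $\varphi(t,\cdot):\mathbb S\to\mathbb S$ flattens out (i.e. $\min_{x}\varphi_x(t,x)$, with $\varphi$ given by the formula in (1), reaches $0$) is $$T^*=\frac{\pi}{2}+\arctan\left\{\frac12\min_{\{x\in\mathbb S:\ \tilde\rho(x)=0\}}\tilde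 u_x(x)\right\},$$ with $T^*=+\infty$ if $\tilde\rho$ has no zeros. (3) For $t\in[0,T^* )$ the solution is given in terms of $\varphi$ by $$u(t,\cdot)=\varphi_t(t,\cdot)\circ\varphi(t,\cdot)^{-1},\qquad \rho(t,\cdot)=\left(\frac{\tilde\rho}{\varphi_x(t,\cdot)}\right)\circ\varphi(t,\cdot)^{-1}.$$
   Context: $\mathbb S=\mathbb R/\mathbb Z$ is the unit circle, identified with $[0,1]$ with endpoints glued; functions on $\mathbb S$ are $1$-periodic. $H^k(\mathbb S)$ is the $L^2$-based Sobolev space of order $k$, and $\|\cdot\|$ is the norm of $H^0(\mathbb S)=L^2(\mathbb S)$. Subscripts $t,x$ denote partial derivatives. Since the system determines $u$ only up to spatially constant terms (Galilean shifts), $u$ is considered with the normalization $u(t,0)=0$. With the energy normalization $\|\tilde u_x\|^2+\|\tilde\rho\|^2=4$, which is conserved in time, the once-integrated first equation reads $u_{tx}+u u_{xx}+\frac12u_x^2=\frac12\rho^2-2$. *)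

(* Defs.v *)
From mathcomp Require Import all_boot all_order all_algebra.
From mathcomp Require Import all_classical all_reals all_analysis.

Set Implicit Arguments.
Unset Strict Implicit.
Unset Printing Implicit Defensive.

Import Order.TTheory GRing.Theory Num.Theory.
Import numFieldNormedType.Exports.

Local Open Scope ring_scope.
Local Open Scope classical_set_scope.

(* Functions on the circle R/Z are functions f : R -> R with [periodic f 1];
   integrals over the circle are integrals over [0, 1]. *)

Section circle.
Context {R : realType}.
Implicit Types (f g h : R -> R) (j k : nat).

Local Notation mu := (@lebesgue_measure R).

Definition L2 f : Prop :=
  [/\ periodic f 1, measurable_fun [set: R] f &
      mu.-integrable `[0, 1] (fun x => (f x ^+ 2)%:E)].

Definition L2norm f : R := Num.sqrt (\int[mu]_(x in `[0, 1]) f x ^+ 2).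

Definition C1 f : Prop :=
  (forall x, derivable f x 1) /\ continuous (derive1 f).

Definition is_wderiv f g : Prop :=
  forall h, periodic h 1 -> C1 h ->
    \int[mu]_(x in `[0, 1]) (f x * derive1 h x) =
    - \int[mu]_(x in `[0, 1]) (g x * h x).

(* [sobolev k f]: the square-integrable function f represents a class in H^k *)
Fixpoint sobolev k f : Prop :=
  match k with
  | 0 => L2 f
  | k'.+1 => L2 f /\ exists g, is_wderiv f g /\ sobolev k' g
  end.

(* A square-integrable weak derivative of f, unique up to a null set;
   the zero function if there is none. *)
Definition wderiv f : R -> R :=
  xget (fun=> 0) [set g | L2 g /\ is_wderiv f g].

Definition wderivn j f : R -> R := iter j wderiv f.

(* For k > 0 every class in H^k has exactly one continuous representative, and
   that is the one which is evaluated at points. *)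
Definition Hspace k f : Prop :=
  sobolev k f /\ ((0 < k)%N -> continuous f).

Definition Hnorm k f : R :=
  Num.sqrt (\sum_(j < k.+1) L2norm (wderivn j f) ^+ 2).

(* the interval [0, T) *)
Definition lifespan (T : \bar R) : set R := [set t | 0 <= t /\ (t%:E < T)%E].

(* The derivative at 0 is one-sided. *)
Definition is_tderiv (T : \bar R) (f : R -> R) (t l : R) : Prop :=
  (fun s => (f s - f t) / (s - t)) @ within (lifespan T `\ t) (nbhs t) --> l.

Definition C0_in_H k (T : \bar R) (v : R -> R -> R) : Prop :=
  (forall t, lifespan T t -> Hspace k (v t)) /\
  (forall t, lifespan T t ->
    (fun s => Hnorm k (fun x => v s x - v t x)) @
      within (lifespan T) (nbhs t) --> (0 : R)).

(* [C1_in_H k T v vt]: v is in C^1([0, T); H^k) with time derivative vt *)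
Definition C1_in_H k (T : \bar R) (v vt : R -> R -> R) : Prop :=
  [/\ C0_in_H k T v, C0_in_H k T vt &
      forall t, lifespan T t ->
        (fun s => Hnorm k (fun x => (v s x - v t x) / (s - t) - vt t x)) @
          within (lifespan T `\ t) (nbhs t) --> (0 : R)].

(* The equations are identities in L^2, that is, almost everywhere in x: for
   k = 3 the terms u_txx and u_xxx are only square integrable. *)
Definition HS2_solution k (u0 rho0 : R -> R) (T : \bar R)
    (u rho : R -> R -> R) : Prop :=
  [/\ C0_in_H k T u, C0_in_H k.-1 T rho,
      forall t, lifespan T t -> u t 0 = 0,
      (forall x, u 0 x = u0 x) /\ (forall x, rho 0 x = rho0 x) &
      exists ut rhot : R -> R -> R,
        [/\ C1_in_H k.-1 T u ut, C1_in_H k.-2 T rho rhot &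
            forall t, 0 < t -> (t%:E < T)%E ->
              {ae mu, forall x : R,
                 wderivn 2 (ut t) x + u t x * wderivn 3 (u t) x
                   + 2 * wderivn 1 (u t) x * wderivn 2 (u t) x
                 = rho t x * wderivn 1 (rho t) x}
              /\
              {ae mu, forall x : R,
                 rhot t x + wderivn 1 (fun y => u t y * rho t y) x = 0}]].

Definition maximal_time k (u0 rho0 : R -> R) : \bar R :=
  ereal_sup [set T : \bar R | (0 < T)%E /\
    exists u rho : R -> R -> R, HS2_solution k u0 rho0 T u rho].

(* phi t is the lift to R of a map of the circle *)
Definition flow_map (T : \bar R) (u phi : R -> R -> R) : Prop :=
  [/\ forall x, phi 0 x = x,
      forall t, lifespan T t -> phi t 0 = 0 &
      forall t x, lifespan T t ->
        is_tderiv T (fun s => phi s x) t (u t (phi t x))].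

(* f and g are lifts of mutually inverse orientation-preserving C^1
   diffeomorphisms of the circle *)
Definition circle_diffeo_inverse f g : Prop :=
  [/\ forall x, f (x + 1) = f x + 1, forall x, g (x + 1) = g x + 1,
      C1 f /\ C1 g, cancel f g & cancel g f].

(* the integral of f from 0 to x, with the usual sign when x < 0 *)
Definition integral_from0 f (x : R) : R :=
  if 0 <= x then \int[mu]_(y in `[0, x]) f y else - \int[mu]_(y in `[x, 0]) f y.

Definition phi_formula (u0 rho0 : R -> R) (t x : R) : R :=
  integral_from0 (fun y =>
    (cos t + derive1 u0 y / 2 * sin t) ^+ 2 + rho0 y ^+ 2 / 4 * sin t ^+ 2) x.

Definition is_minimum (A : set R) (m : R) : Prop := A m /\ lbound A m.

Definition flattened f : Prop := is_minimum (range (derive1 f)) 0.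

(* [first_time P T]: T is the first t >= 0 at which P holds, with T = +oo
   when P never holds *)
Definition first_time (P : set R) (T : \bar R) : Prop :=
  (0 <= T)%E /\ (forall t, lifespan T t -> ~ P t) /\
  (forall t, T = t%:E -> P t).

End circle.

(* Main.v *)
(* Along the flow, f = u_x(t, phi) and g = rho(t, phi) solve
     f' = - f^2/2 + g^2/2 - 2,   g' = - f g,
   the constant -2 coming from the conserved energy: the first equation makes
   u_tx + u u_xx + u_x^2/2 - rho^2/2 constant in x, and integrating over the
   circle identifies the constant as minus half of the energy.  The integrand J
   of the formula for phi satisfies J_tt = c - 4 J, and f J - J_t together with
   (f^2 + g^2 + 4) J / 2 - c solves a linear homogeneous system with zero initial
   data.  Hence f = J_t / J, J > 0 and g J = rho0 as long as the solution exists;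
   comparing difference quotients gives phi_x = J, hence (1), (3) and the upper
   bound on T.  Conversely, as long as J > 0 the formulas of (3) define a solution
   with the required Sobolev regularity, so that T is the first time at which J
   vanishes somewhere; at a zero of rho0, J = (cos t + u0_x sin t / 2)^2. *)

Require Import Defs.
From mathcomp Require Import all_boot all_order all_algebra.
From mathcomp Require Import all_classical all_reals all_analysis.
From mathcomp Require Import measurable_realfun.
From mathcomp Require Import ring lra.

Set Implicit Arguments.
Unset Strict Implicit.
Unset Printing Implicit Defensive.

Import Order.TTheory GRing.Theory Num.Theory.
Import numFieldNormedType.Exports.

Local Open Scope ring_scope.
Local Open Scope classical_set_scope.

(** * Square-integrable functions on the circle *)

Section L2.
Context {R : realType}.
Implicit Types (f g h w : R -> R) (c M : R).

Local Notation mu := (@lebesgue_measure R).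
Local Notation integ f := (mu.-integrable `[0, 1] (EFin \o (f : R -> R))).

(** Regularity shapes the proof: the equations hold only almost everywhere in [x], time derivatives
    exist only in Sobolev norms, and [phi] is not assumed differentiable in [x]. So the first
    equation enters only as the weak derivative of the continuous function [HS2_density]; from there
    on the argument is pointwise along characteristics. The quotient [J_t / J] cannot be formed,
    because [J > 0] is part of the claim. Clearing the denominator gives [f * J - J_t], whose time
    derivative brings in [(f ^+ 2 + g ^+ 2 + 4) / 2 * J] minus a constant, and these two quantities
    close up. The second one also yields positivity: it makes [(f ^+ 2 + g ^+ 2 + 4) * J] constant
    in time and at least 4. In the converse direction the formulas of (3) must be continuous curves
    in [H^k], which asks for closure under products, reciprocals and composition with the inverse of
    a moving diffeomorphism. The two directions meet without a uniqueness theorem: a solution forces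
    [J > 0] on its lifespan, and [J > 0] on [[0, T')] puts [T'] into the set whose supremum is
    [maximal_time]. *)

Definition ip f g : R := \int[mu]_(x in `[0, 1]) (f x * g x).

Lemma L2_meas f : L2 f -> measurable_fun `[(0 : R), 1] f.
Proof. by case=> _ mf _; apply: measurable_funTS. Qed.

Lemma integ_dom f g : measurable_fun `[(0 : R), 1] f -> integ g ->
  (forall x, `|f x| <= g x) -> integ f.
Proof.
move=> mf ig fg; apply: (le_integrable _ _ _ ig) => //.
  exact/measurable_EFinP.
by move=> x _ /=; rewrite lee_fin (le_trans (fg x))// ler_norm.
Qed.

Lemma integ_cst (c : R) : integ (cst c).
Proof.
apply: continuous_compact_integrable; first exact: segment_compact.
by apply: continuous_subspaceT => x; exact: cst_continuous.
Qed.

Lemma integ_cont f : continuous f -> integ f.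
Proof.
move=> cf; apply: continuous_compact_integrable; first exact: segment_compact.
exact: continuous_subspaceT.
Qed.

Lemma integD f g : integ f -> integ g -> integ (fun x => f x + g x).
Proof. by move=> If Ig; apply: (integrableD _ If Ig). Qed.

Lemma integZ c f : integ f -> integ (fun x => c * f x).
Proof. by move=> If; apply: (integrableZl _ c If). Qed.

Lemma L2_sq f : L2 f -> integ (fun x => f x ^+ 2).
Proof. by case. Qed.

Lemma L2_integM f g : L2 f -> L2 g -> integ (fun x => f x * g x).
Proof.
move=> Lf Lg; apply: (@integ_dom _ (fun x => f x ^+ 2 + g x ^+ 2)).
- by apply: measurable_funM; exact: L2_meas.
- by apply: integD; exact: L2_sq.
- move=> x; rewrite normrM -(real_normK (num_real (f x))) -(real_normK (num_real (g x))).
  by have := sqr_ge0 (`|f x| - `|g x|); rewrite sqrrB; have := normr_ge0 (f x); have := normr_ge0 (g x); nra.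
Qed.

Lemma L2D f g : L2 f -> L2 g -> L2 (fun x => f x + g x).
Proof.
move=> Lf Lg; have [pf mf If] := Lf; have [pg mg Ig] := Lg; split.
- by move=> x; rewrite pf pg.
- exact: measurable_funD.
- have -> : (fun x => ((f x + g x) ^+ 2)%:E) =
      EFin \o (fun x => f x ^+ 2 + (2 * (f x * g x) + g x ^+ 2)).
    by apply/funext => x /=; congr EFin; ring.
  by do ?apply: integD => //; apply: integZ; exact: L2_integM.
Qed.

Lemma L2Z c f : L2 f -> L2 (fun x => c * f x).
Proof.
move=> [pf mf If]; split.
- by move=> x; rewrite pf.
- exact: measurable_funM.
- have -> : (fun x => ((c * f x) ^+ 2)%:E) = EFin \o (fun x => c ^+ 2 * f x ^+ 2).
    by apply/funext => x /=; congr EFin; ring.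
  exact: integZ.
Qed.

Lemma L2N f : L2 f -> L2 (fun x => - f x).
Proof. by move/(L2Z (-1)); under [X in L2 X]eq_fun do rewrite mulN1r. Qed.

Lemma L2B f g : L2 f -> L2 g -> L2 (fun x => f x - g x).
Proof. by move=> Lf /L2N; exact: L2D. Qed.

Lemma L2_bounded f M : periodic f 1 -> measurable_fun setT f ->
  (forall x, `|f x| <= M) -> L2 f.
Proof.
move=> pf mf fM; split => //; apply: (@integ_dom _ (cst (M ^+ 2))).
- by apply: measurable_funTS; exact: measurable_funX.
- exact: integ_cst.
- by move=> x; rewrite normrX lerXn2r// nnegrE ?(le_trans _ (fM x)).
Qed.

Lemma L2_cst (c : R) : L2 (fun=> c : R).
Proof. by apply: (@L2_bounded _ `|c|). Qed.

Lemma L2Mb f w M : L2 f -> periodic w 1 -> measurable_fun setT w ->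
  (forall x, `|w x| <= M) -> L2 (fun x => f x * w x).
Proof.
move=> [pf mf If] pw mw wM; split.
- by move=> x; rewrite pf pw.
- exact: measurable_funM.
- apply: (@integ_dom _ (fun x => M ^+ 2 * f x ^+ 2)).
  + by apply: measurable_funTS; apply: measurable_funX; exact: measurable_funM.
  + exact: integZ.
  + move=> x; rewrite exprMn normrM [`|f x ^+ 2|]ger0_norm ?sqr_ge0// mulrC.
    by rewrite ler_wpM2r ?sqr_ge0// normrX lerXn2r// nnegrE ?(le_trans _ (wM x)).
Qed.

Lemma ip_sq f : L2norm f = Num.sqrt (ip f f).
Proof. by []. Qed.

Lemma ipC f g : ip f g = ip g f.
Proof. by apply: eq_Rintegral => x _; rewrite mulrC. Qed.

Lemma ipDl f g h : L2 f -> L2 g -> L2 h ->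
  ip (fun x => f x + g x) h = ip f h + ip g h.
Proof.
move=> Lf Lg Lh; rewrite /ip -RintegralD//; [|exact: L2_integM..].
by apply: eq_Rintegral => x _; rewrite mulrDl.
Qed.

Lemma ipZl c f h : L2 f -> L2 h -> ip (fun x => c * f x) h = c * ip f h.
Proof.
move=> Lf Lh; rewrite /ip -RintegralZl//; last exact: L2_integM.
by apply: eq_Rintegral => x _; rewrite mulrA.
Qed.

Lemma ipBl f g h : L2 f -> L2 g -> L2 h ->
  ip (fun x => f x - g x) h = ip f h - ip g h.
Proof.
move=> Lf Lg Lh; rewrite /ip -RintegralB//; [|exact: L2_integM..].
by apply: eq_Rintegral => x _; rewrite mulrBl.
Qed.

Lemma ipDr f g h : L2 f -> L2 g -> L2 h ->
  ip h (fun x => f x + g x) = ip h f + ip h g.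
Proof. by move=> *; rewrite ipC ipDl// ![ip _ h]ipC. Qed.

Lemma ipBr f g h : L2 f -> L2 g -> L2 h ->
  ip h (fun x => f x - g x) = ip h f - ip h g.
Proof. by move=> *; rewrite ipC ipBl// ![ip _ h]ipC. Qed.

Lemma ipZr c f h : L2 f -> L2 h -> ip h (fun x => c * f x) = c * ip h f.
Proof. by move=> *; rewrite ipC ipZl// ipC. Qed.

Lemma ip_ge0 f : 0 <= ip f f.
Proof. by apply: Rintegral_ge0 => x _; rewrite -expr2 sqr_ge0. Qed.

Lemma L2norm_ge0 f : 0 <= L2norm f.
Proof. exact: sqrtr_ge0. Qed.

Lemma L2norm_sq f : L2norm f ^+ 2 = ip f f.
Proof. by rewrite ip_sq sqr_sqrtr// ip_ge0. Qed.

(** The quadratic polynomial [t |-> ip (f - t g) (f - t g)] is nonnegative; evaluating it at its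
    minimum [ip f g / ip g g] gives the inequality. *)
Lemma Cauchy_Schwarz f g : L2 f -> L2 g -> `|ip f g| <= L2norm f * L2norm g.
Proof.
move=> Lf Lg; suff : ip f g ^+ 2 <= ip f f * ip g g.
  rewrite -!L2norm_sq -exprMn -(real_normK (num_real (ip f g))) ler_pXn2r ?nnegrE ?mulr_ge0 ?L2norm_ge0//.
have pos t : 0 <= ip f f - 2 * t * ip f g + t ^+ 2 * ip g g.
  have Ltg : L2 (fun x => t * g x) by exact: L2Z.
  have := ip_ge0 (fun x => f x - t * g x).
  rewrite ipBl//; last exact: L2B.
  rewrite !ipBr// !ipZl ?ipZr// (ipC g f); nra.
have [gg0|gg0] := eqVneq (ip g g) 0; last first.
  have gp : 0 < ip g g by rewrite lt0r gg0 ip_ge0.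
  have := pos (ip f g / ip g g).
  rewrite -(ler_pM2r gp) mul0r.
  set a := ip f f; set b := ip f g; set c := ip g g in gp *.
  have -> : (a - 2 * (b / c) * b + (b / c) ^+ 2 * c) * c = a * c - b ^+ 2.
    by field; rewrite gt_eqF.
  by rewrite subr_ge0.
rewrite gg0 mulr0; rewrite {}gg0 in pos.
have ff := ip_ge0 f.
have [->|b0] := eqVneq (ip f g) 0; first by rewrite expr0n.
(* With [ip g g = 0] the polynomial is affine in [t], and this [t] would give it the value [-1]; so
   [ip f g] must vanish. *)
have := pos ((ip f f + 1) / (2 * ip f g)).
have -> : ip f f - 2 * ((ip f f + 1) / (2 * ip f g)) * ip f g +
  ((ip f f + 1) / (2 * ip f g)) ^+ 2 * 0 = - 1 by field.
by rewrite ler0N1.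
Qed.

Lemma L2norm_triangle f g : L2 f -> L2 g ->
  L2norm (fun x => f x + g x) <= L2norm f + L2norm g.
Proof.
move=> Lf Lg; rewrite -(@ler_pXn2r _ 2)// ?nnegrE ?addr_ge0 ?L2norm_ge0//.
rewrite L2norm_sq ipDl//; last exact: L2D.
rewrite !ipDr// (ipC g f) sqrrD !L2norm_sq.
have := le_trans (ler_norm _) (Cauchy_Schwarz Lf Lg); lra.
Qed.

Lemma L2normZ c f : L2 f -> L2norm (fun x => c * f x) = `|c| * L2norm f.
Proof.
move=> Lf; rewrite !ip_sq ipZl// ?ipZr//; last exact: L2Z.
by rewrite mulrA -expr2 sqrtrM ?sqr_ge0// sqrtr_sqr.
Qed.

Lemma L2normN f : L2norm (fun x => - f x) = L2norm f.
Proof. by congr Num.sqrt; apply: eq_Rintegral => x _; rewrite sqrrN. Qed.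

Lemma L2normBC f g : L2norm (fun x => f x - g x) = L2norm (fun x => g x - f x).
Proof. by rewrite -L2normN; congr L2norm; apply/funext => x; rewrite opprB. Qed.

Lemma L2norm_le f g : L2 f -> L2 g -> (forall x, `|f x| <= `|g x|) ->
  L2norm f <= L2norm g.
Proof.
move=> Lf Lg fg; apply: ler_wsqrtr; apply: le_Rintegral => //; [exact: L2_sq..|].
by move=> x _; rewrite -(real_normK (num_real (f x))) -(real_normK (num_real (g x))) lerXn2r.
Qed.

Lemma L2norm_cst c : L2norm (fun=> c : R) = `|c|.
Proof.
rewrite /L2norm Rintegral_cst//= lebesgue_measure_itv/= lte_fin ltr01 oppr0 adde0.
by rewrite mulr1 sqrtr_sqr.
Qed.

Lemma L2norm_sup f M : L2 f -> (forall x, `|f x| <= M) -> L2norm f <= M.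
Proof.
move=> Lf fM; have M0 : 0 <= M by rewrite (le_trans _ (fM 0)).
rewrite -[leRHS]ger0_norm// -L2norm_cst; apply: L2norm_le => //; first exact: L2_cst.
by move=> x; rewrite (ger0_norm M0).
Qed.

Lemma L2normMb f w M : L2 f -> periodic w 1 -> measurable_fun setT w ->
  (forall x, `|w x| <= M) -> L2norm (fun x => f x * w x) <= M * L2norm f.
Proof.
move=> Lf pw mw wM; have M0 : 0 <= M by rewrite (le_trans _ (wM 0)).
rewrite -[X in X * _]ger0_norm// -L2normZ//; apply: L2norm_le.
- exact: L2Mb wM.
- exact: L2Z.
- by move=> x; rewrite mulrC !normrM (ger0_norm M0) ler_wpM2r.
Qed.

Lemma L2norm_dist f g h : L2 f -> L2 g -> L2 h ->
  L2norm (fun x => f x - h x) <=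
  L2norm (fun x => f x - g x) + L2norm (fun x => g x - h x).
Proof.
move=> Lf Lg Lh.
have := L2norm_triangle (L2B Lf Lg) (L2B Lg Lh).
by congr (_ <= _); congr L2norm; apply/funext => x; rewrite addrA subrK.
Qed.

Definition eqae f g := ae_eq mu `[0, 1] f g.

Lemma eqae_ip f g h : eqae f g -> L2 f -> L2 g -> L2 h -> ip f h = ip g h.
Proof.
move=> fg Lf Lg Lh; rewrite /ip /Rintegral; congr fine; apply: ae_eq_integral => //.
- by apply/measurable_EFinP; apply: measurable_funM; exact: L2_meas.
- by apply/measurable_EFinP; apply: measurable_funM; exact: L2_meas.
- by apply: (@filterS _ _ (ae_filter_ringOfSetsType mu)) fg => x fgx xI /=; rewrite fgx.
Qed.

Lemma eqae_L2norm f g : eqae f g -> L2 f -> L2 g -> L2norm f = L2norm g.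
Proof.
by move=> fg Lf Lg; rewrite !ip_sq; congr Num.sqrt; rewrite (eqae_ip fg)// ipC (eqae_ip fg)// ipC.
Qed.

Lemma eqae_sym f g : eqae f g -> eqae g f.
Proof. exact: ae_eq_sym. Qed.

Lemma eqae_trans f g h : eqae f g -> eqae g h -> eqae f h.
Proof. exact: ae_eq_trans. Qed.

Lemma eqae_refl f : eqae f f.
Proof. exact: ae_eq_refl. Qed.

Lemma eqaeB f g : eqae (fun x => f x - g x) (fun=> 0) -> eqae f g.
Proof.
apply: (@filterS _ _ (ae_filter_ringOfSetsType mu)) => x fgx xI.
by apply/eqP; rewrite -subr_eq0; apply/eqP; exact: fgx.
Qed.

Lemma L2norm0_eqae f : L2 f -> L2norm f = 0 -> eqae f (fun=> 0).
Proof.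
move=> Lf /eqP; rewrite -sqrf_eq0 L2norm_sq => /eqP ff.
have i0 : (\int[mu]_(x in `[0%R, 1%R]) `|(f x * f x)%:E| = 0)%E.
  have -> : (\int[mu]_(x in `[0%R, 1%R]) `|(f x * f x)%:E| =
             \int[mu]_(x in `[0%R, 1%R]) (f x * f x)%:E)%E.
    by apply: eq_integral => x _; rewrite abse_EFin ger0_norm// -expr2 sqr_ge0.
  rewrite -[LHS]fineK ?[fine _]ff//.
  exact: (integrable_fin_num _ (L2_integM Lf Lf)).
have mf2 : measurable_fun `[(0 : R), 1] (fun x => (f x * f x)%:E).
  by apply/measurable_EFinP; apply: measurable_funM; exact: L2_meas.
move/(ae_eq_integral_abs mu _ mf2) : i0 => /(_ (measurable_itv _)).
apply: (@filterS _ _ (ae_filter_ringOfSetsType mu)) => x fx xI.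
by have /eqP := fx xI; rewrite eqe mulf_eq0 orbb => /eqP.
Qed.

Lemma per_int f (n : int) x : periodic f 1 -> f (x + n%:~R) = f x.
Proof.
move=> pf; case: n => n; rewrite -?pmulrn.
  by rewrite -[n%:R]mulr1 mulr_natl periodicn.
by rewrite NegzE mulrNz -[in RHS](subrK (n.+1%:~R) x) -pmulrn -[n.+1%:R]mulr1 mulr_natl periodicn.
Qed.

Lemma per_frac f x : periodic f 1 -> exists2 y, 0 <= y < 1 & f x = f y.
Proof.
move=> pf; exists (x - (Num.floor x)%:~R); last by rewrite -mulrNz per_int.
have := floorD1_gt x; rewrite intrD => h.
by apply/andP; split; [rewrite subr_ge0 floor_le|lra].
Qed.

(** The primitive of [f ^+ 2] from 0 vanishes on [[0, 1]], so the fundamental theorem gives [f = 0]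
    in the interior; the point 0 follows by continuity from the right, the rest by periodicity. This
    turns identities almost everywhere between continuous functions into identities at every
    point. *)
Lemma L2norm0_cont f : continuous f -> L2 f -> L2norm f = 0 -> forall x, f x = 0.
Proof.
move=> cf Lf f0.
have cf2 : continuous (fun x => f x ^+ 2) by move=> x; apply: cvgM; exact: cf.
pose F (x : R) := \int[mu]_(t in `[0, x]) f t ^+ 2.
have F0 x : x <= 1 -> F x = 0.
  move=> x1; apply/eqP; rewrite eq_le Rintegral_ge0 ?andbT; last by move=> ? _; exact: sqr_ge0.
  have /eqP := f0; rewrite /L2norm sqrtr_eq0; apply: le_trans.
  rewrite /F /Rintegral fine_le//.
  - apply: integrable_fin_num => //; apply: integrableS (L2_sq Lf) => //.
    exact: subset_itvl.
  - by apply: integrable_fin_num => //; exact: L2_sq.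
  - apply: ge0_subset_integral => //; last exact: subset_itvl.
      by apply/measurable_EFinP; apply: measurable_funX; exact: L2_meas.
    by move=> y _; rewrite lee_fin sqr_ge0.
have in01 x : 0 < x < 1 -> f x = 0.
  move=> /andP[x0 x1].
  have [_] := continuous_FTC1_closed x1 (integ_cont cf2) x0 (cf2 x).
  rewrite derive1E (@near_eq_derive _ _ _ _ (cst 0)) ?derive_cst ?oner_neq0//.
    by move/esym/eqP; rewrite sqrf_eq0 => /eqP.
  by near=> y; apply: F0; apply: ltW; near: y; exact: lt_nbhsl.
have pf : periodic f 1 by case: Lf.
have f00 : f 0 = 0.
  apply: contrapT => /eqP; rewrite -normr_gt0 => fp.
  have /cvgrPdist_lt/(_ _ fp) f0n := cf 0.
  near (0 : R)^'+ => y.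
  have : `|f 0 - f y| < `|f 0| by near: y; exact: cvg_within.
  by rewrite (in01 y) ?subr0 ?ltxx//; apply/andP; split; near: y;
    [exact: nbhs_right_gt|exact: nbhs_right_lt].
move=> x; have [y /andP[] ] := per_frac x pf.
by rewrite le_eqVlt => /predU1P[<- _ ->//|y0 y1 ->]; apply: in01; rewrite y0.
Unshelve. all: by end_near. Qed.

End L2.

(** * Derivatives of functions of one variable, with explicit values *)

Section calculus.
Context {R : realType}.
Implicit Types (f g h : R -> R) (x c l m : R).

Lemma isdP f x l : is_derive x 1 f l <-> derivable f x 1 /\ derive1 f x = l.
Proof.
split => [[df fl]|[df fl]]; first by split => //; rewrite derive1E.
by apply: DeriveDef df _; rewrite -derive1E.
Qed.

Lemma isd_derive1 f x l : is_derive x 1 f l -> derive1 f x = l.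
Proof. by move/isdP => []. Qed.

Lemma isd_derivable f x l : is_derive x 1 f l -> derivable f x 1.
Proof. by move/isdP => []. Qed.

Lemma isd_eq f g x l m : (f =1 g) -> l = m -> is_derive x 1 f l -> is_derive x 1 g m.
Proof. by move=> /funext -> ->. Qed.

Lemma isd_cst c x : is_derive x 1 (fun=> c) 0.
Proof. exact: is_derive_cst. Qed.

Lemma isd_id x : is_derive x 1 (fun y : R => y) 1.
Proof. exact: is_derive_id. Qed.

Lemma isdD f g x l m : is_derive x 1 f l -> is_derive x 1 g m ->
  is_derive x 1 (fun y => f y + g y) (l + m).
Proof. by move=> *; exact: is_deriveD. Qed.

Lemma isdB f g x l m : is_derive x 1 f l -> is_derive x 1 g m ->
  is_derive x 1 (fun y => f y - g y) (l - m).
Proof. by move=> *; exact: is_deriveB. Qed.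

Lemma isdM f g x l m : is_derive x 1 f l -> is_derive x 1 g m ->
  is_derive x 1 (fun y => f y * g y) (l * g x + f x * m).
Proof.
move=> df dg; have := is_deriveM df dg.
by apply: isd_eq => //; rewrite addrC [l * _]mulrC.
Qed.

Lemma isdZ c f x l : is_derive x 1 f l -> is_derive x 1 (fun y => c * f y) (c * l).
Proof. by move=> df; exact: is_deriveZ. Qed.

Lemma isd_sq f x l : is_derive x 1 f l ->
  is_derive x 1 (fun y => f y ^+ 2) (2 * f x * l).
Proof.
move=> df; have := isdM df df.
by apply: isd_eq => [y|]; [rewrite expr2|ring].
Qed.

Lemma isd_comp f g x l m : is_derive (g x) 1 f l -> is_derive x 1 g m ->
  is_derive x 1 (fun y => f (g y)) (l * m).
Proof. by move=> *; exact: is_derive1_comp. Qed.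

Lemma isd_shift f x c l : is_derive (x + c) 1 f l ->
  is_derive x 1 (fun y => f (y + c)) l.
Proof.
move=> df; have := isd_comp (g := fun y => y + c) df (isdD (isd_id x) (isd_cst c x)).
by apply: isd_eq => //; rewrite addr0 mulr1.
Qed.

Lemma isd_continuous f x l : is_derive x 1 f l -> {for x, continuous f}.
Proof. by move=> /isd_derivable/derivable1_diffP/differentiable_continuous. Qed.

Lemma C1_isd f x : C1 f -> is_derive x 1 f (derive1 f x).
Proof. by move=> [df _]; apply/isdP. Qed.

Lemma isd_C1 f g : (forall x, is_derive x 1 f (g x)) -> continuous g ->
  C1 f /\ derive1 f = g.
Proof.
move=> dg cg; have fg : derive1 f = g by apply/funext => x; exact: isd_derive1.
by split => //; split; [move=> x; exact: isd_derivable|rewrite fg].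
Qed.

Lemma C1_continuous f : C1 f -> continuous f.
Proof. by move=> [df _] x; apply/differentiable_continuous/derivable1_diffP. Qed.

Lemma lip_continuous f (K : R) : (forall x y, `|f x - f y| <= K * `|x - y|) -> continuous f.
Proof.
move=> fK x; have K0 : 0 < `|K| + 1 by rewrite ltr_wpDl.
apply/cvgrPdist_lt => e e0; apply/nbhs_ballP; exists (e / (`|K| + 1)).
  by rewrite /= divr_gt0.
move=> y; rewrite /ball/= => xy; apply: le_lt_trans (fK _ _) _.
apply: (@le_lt_trans _ _ ((`|K| + 1) * `|x - y|)).
  by rewrite ler_wpM2r// (le_trans (ler_norm _))// lerDl.
by rewrite -ltr_pdivlMl// mulrC.
Qed.

Lemma eq_isd0 f : (forall x, is_derive x 1 f 0) -> forall x y, f x = f y.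
Proof. by move=> df x y; exact: (@is_derive_0_is_cst _ f x y). Qed.

End calculus.

(** * Density of continuously differentiable functions *)

Section mollifier.
Context {R : realType}.
Implicit Types (f g h w : R -> R) (c M : R).

Local Notation mu := (@lebesgue_measure R).

Definition locint f := forall a b : R, mu.-integrable `[a, b] (EFin \o f).

Lemma locint_cont f : continuous f -> locint f.
Proof.
move=> cf a b; apply: continuous_compact_integrable; first exact: segment_compact.
exact: continuous_subspaceT.
Qed.

Lemma locint_bounded f M : measurable_fun setT f -> (forall x, `|f x| <= M) -> locint f.
Proof.
move=> mf fM a b; apply: measurable_bounded_integrable => //.
- apply: compact_finite_measure; exact: segment_compact.
- exact: measurable_funTS.
- exists M; split; first exact: num_real.
  by move=> N /ltW MN x _ /=; rewrite (le_trans (fM x)).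
Qed.

Lemma int_cat f (a b c : R) : locint f -> a <= b -> b <= c ->
  \int[mu]_(x in `[a, c]) f x = \int[mu]_(x in `[a, b]) f x + \int[mu]_(x in `[b, c]) f x.
Proof.
move=> lf ab bc; rewrite -[LHS](subrK (\int[mu]_(x in `[a, b]) f x)) addrC; congr (_ + _).
rewrite (@Rintegral_itvB _ f _ _ b (lf a c)) ?bnd_simp//.
rewrite Rintegral_itv_obnd_cbnd//; apply: integrableS (lf b c) => //.
exact: subset_itv_oc_cc.
Qed.

Lemma integral_from0B f (x y : R) : locint f -> x <= y ->
  integral_from0 f y - integral_from0 f x = \int[mu]_(t in `[x, y]) f t.
Proof.
move=> lf xy; rewrite /integral_from0.
have [x0|x0] := leP 0 x; have [y0|y0] := leP 0 y.
- by rewrite (int_cat lf x0 xy) addrAC subrr add0r.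
- by have := lt_le_trans y0 x0; rewrite ltNge xy.
- by rewrite (int_cat lf (ltW x0) y0) opprK addrC.
- by rewrite (int_cat lf xy (ltW y0)) opprK addrC addrK.
Qed.

Lemma integral_from00 f : integral_from0 f 0 = 0.
Proof. by rewrite /integral_from0 lexx set_itv1 Rintegral_set1. Qed.

Lemma integral_le f M (x y : R) : locint f -> x <= y ->
  (forall t, x <= t <= y -> `|f t| <= M) -> `|\int[mu]_(t in `[x, y]) f t| <= M * (y - x).
Proof.
move=> lf xy fM; apply: (le_trans (le_normr_Rintegral _ (lf x y))) => //.
have -> : M * (y - x) = \int[mu]_(t in `[x, y]) M.
  rewrite Rintegral_cst//= lebesgue_measure_itv/= lte_fin.
  by move: xy; rewrite le_eqVlt => /predU1P[->|->//]; rewrite ltxx subrr.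
apply: le_Rintegral => //.
- by apply: integrable_norm; exact: lf.
- exact: (@locint_cont (cst M) (fun x => @cst_continuous _ _ M x)).
Qed.

Lemma near_cat0 f (a x : R) : locint f -> a < x ->
  \forall y \near x, \int[mu]_(t in `[a, y]) f t = integral_from0 f y - integral_from0 f a.
Proof.
move=> lf ax; near=> y; rewrite integral_from0B//.
by apply: ltW; near: y; exact: lt_nbhsr.
Unshelve. all: by end_near. Qed.

(** The fundamental theorem speaks of the primitive based at some [a < x]; near [x] it differs from
    [integral_from0 f] by a constant. *)
Lemma is_derive_from0 f (a x l : R) : locint f -> a < x ->
  derivable (fun y => \int[mu]_(t in `[a, y]) f t) x 1 /\
    derive1 (fun y => \int[mu]_(t in `[a, y]) f t) x = l ->
  is_derive x 1 (integral_from0 f) l.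
Proof.
move=> lf ax [dF Fl].
have F' : is_derive x 1 (fun y => \int[mu]_(t in `[a, y]) f t) l.
  exact/isdP.
have := isdD F' (isd_cst (integral_from0 f a) x).
rewrite addr0; apply: near_eq_is_derive.
by apply: filterS (near_cat0 lf ax) => y ->; rewrite subrK.
Qed.

Lemma is_derive_from0_cont f (x : R) : continuous f -> is_derive x 1 (integral_from0 f) (f x).
Proof.
move=> cf; have lf := locint_cont cf.
have ax : x - 1 < x by rewrite ltrBlDr ltrDl.
apply: (is_derive_from0 lf ax).
have xu : x < x + 1 by rewrite ltrDl.
by apply: (continuous_FTC1_closed xu (lf _ _) ax); exact: cf.
Qed.

Lemma is_derive_from0_ae f : measurable_fun setT f -> locint f ->
  {ae mu, forall x : R, `[0%R, 1%R] x -> is_derive x 1 (integral_from0 f) (f x)}.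
Proof.
move=> mf lf.
have lf' : locally_integrable setT f.
  split => //; first exact: openT.
  move=> K _ cK; have /compact_bounded [M [_ KM]] := cK.
  pose N := `|M| + 1.
  have /integrableP[_] := lf (- N) N; apply: le_lt_trans.
  apply: ge0_subset_integral => //; first exact: compact_measurable.
    by apply/measurable_EFinP; apply: measurableT_comp => //; exact: measurable_funTS.
  move=> x Kx /=; rewrite in_itv/= -ler_norml; apply: KM => //.
  by rewrite (le_lt_trans (ler_norm _))// ltrDl.
(* The base point lies strictly to the left of [[0, 1]], so that the endpoint 0 is covered as
   well. *)
have := FTC1 (a := BLeft (-1)) (lf _) lf'.
apply: (@filterS _ _ (ae_filter_ringOfSetsType mu)) => x /= h /= x01.
have ax : (-1 : R) < x by move: x01; rewrite in_itv/= => /andP[? _]; lra.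
by apply: (is_derive_from0 lf ax); apply: h; rewrite lte_fin.
Qed.

(** The Steklov mean over [[x, x + d]], used in place of convolution with a smooth kernel: each
    application gains one degree of regularity and preserves periodicity and bounds. *)
Definition avg (d : R) f (x : R) : R :=
  d^-1 * (integral_from0 f (x + d) - integral_from0 f x).

(** The shifted measure agrees with Lebesgue measure on half-open intervals, and these determine
    it. *)
Lemma lebesgue_measure_shift (a : R) (A : set R) : measurable A ->
  pushforward mu (fun x : R => x + a : measurableTypeR R) A = mu A.
Proof.
have ms : measurable_fun setT (fun x : R => x + a : measurableTypeR R).
  exact: measurable_funD.
move=> mA; apply/esym/lebesgue_measure_unique => //= _ [[b c]] _ <-.
rewrite /pushforward.
have -> : (fun x : R => x + a) @^-1` `]b, c] = `]b - a, c - a].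
  by apply/seteqP; split => x /=; rewrite !in_itv/= ltrBlDr lerBrDr.
rewrite/= !lebesgue_measure_itv/= !lte_fin ltrD2r; case: ifP => // _.
by rewrite -!EFinD; congr EFin; ring.
Qed.

Lemma int_shift f (a b c : R) : measurable_fun setT f -> locint (fun x => f (x + c)) ->
  \int[mu]_(x in `[a + c, b + c]) f x = \int[mu]_(x in `[a, b]) f (x + c).
Proof.
move=> mf lf; rewrite /Rintegral; congr fine.
have pre : (fun x : R => x + c) @^-1` `[a + c, b + c] = `[a, b].
  by apply/seteqP; split => x /=; rewrite !in_itv/= !lerD2r.
have ms : measurable_fun setT (fun x : R => x + c : measurableTypeR R).
  exact: measurable_funD.
have := @integral_pushforward _ _ (measurableTypeR R) (measurableTypeR R) R (fun x : R => x + c) ms (@lebesgue_measure R) `[a + c, b + c] (EFin \o f).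
rewrite pre => <- //; last exact/measurable_EFinP.
by apply: eq_measure_integral => A mA _; exact/esym/lebesgue_measure_shift.
Qed.

Section bounded_periodic.
Variables (f : R -> R) (M : R).
Hypotheses (pf : periodic f 1) (mf : measurable_fun setT f).
Hypothesis fM : forall x, `|f x| <= M.

Let lf : locint f. Proof. exact: locint_bounded fM. Qed.

Let M0 : 0 <= M. Proof. exact: le_trans (fM 0). Qed.

Lemma avg_periodic d : 0 < d -> periodic (avg d f) 1.
Proof.
move=> d0 x; rewrite /avg; congr (_ * _).
rewrite !integral_from0B ?lerDl ?(ltW d0)// addrAC int_shift//.
  by apply: eq_Rintegral => y _.
by under eq_fun do rewrite pf.
Qed.

Lemma from0_lip x y : `|integral_from0 f x - integral_from0 f y| <= M * `|x - y|.
Proof.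
wlog yx : x y / y <= x => [h|].
  by have [/h //|/ltW/h] := leP y x; rewrite distrC [`|y - x|]distrC.
rewrite integral_from0B// [`|x - y|]ger0_norm ?subr_ge0//.
by apply: integral_le => // t _.
Qed.

Lemma from0_continuous : continuous (integral_from0 f).
Proof. exact: lip_continuous from0_lip. Qed.

Lemma avg_continuous d : continuous (avg d f).
Proof.
move=> x; apply: cvgM; first exact: cvg_cst.
apply: cvgB; last exact: from0_continuous.
apply: (@continuous_comp _ _ _ (fun x => x + d)); last exact: from0_continuous.
by apply: cvgD; [exact: cvg_id|exact: cvg_cst].
Qed.

Lemma avg_bounded d x : 0 < d -> `|avg d f x| <= M.
Proof.
move=> d0; rewrite /avg normrM normfV (gtr0_norm d0) ler_pdivrMl// mulrC.
by apply: (le_trans (from0_lip _ _)); rewrite addrAC subrr add0r (gtr0_norm d0).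
Qed.

Lemma avg_L2 d : 0 < d -> L2 (avg d f).
Proof.
move=> d0; apply: (@L2_bounded _ _ M); first exact: avg_periodic.
- by apply: continuous_measurable_fun; exact: avg_continuous.
- by move=> x; exact: avg_bounded.
Qed.

Lemma avg_C1 d : continuous f -> C1 (avg d f).
Proof.
move=> cf.
suff [] : C1 (avg d f) /\ derive1 (avg d f) = (fun x => d^-1 * (f (x + d) - f x)) by [].
apply: isd_C1 => x.
  apply/isdZ/isdB; last exact: is_derive_from0_cont.
  by apply: isd_shift; exact: is_derive_from0_cont.
apply: cvgM; first exact: cvg_cst.
apply: cvgB; last exact: cf.
apply: (@continuous_comp _ _ _ (fun x => x + d)); last exact: cf.
by apply: cvgD; [exact: cvg_id|exact: cvg_cst].
Qed.

Lemma avg_cvg (x : R) : is_derive x 1 (integral_from0 f) (f x) ->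
  (fun n => avg (n.+1%:R^-1) f x) @ \oo --> f x.
Proof.
move=> [dF FE].
have : (fun d : R => d^-1 *: ((integral_from0 f \o shift x) (d *: (1 : R)) - integral_from0 f x)) @ 0^' --> f x.
  by rewrite -FE; exact: dF.
move=> /cvg_dnbhs_at_right/cvg_at_rightP/(_ (fun n => n.+1%:R^-1)).
have H : (forall n, 0 < (n.+1%:R^-1 : R)) /\ (n.+1%:R^-1 : R) @[n --> \oo] --> 0.
  by split; [move=> n; rewrite invr_gt0|exact: cvg_harmonic].
move=> /(_ H) /=.
by under eq_fun do rewrite [_%:A]mulr1 [_ + x]addrC.
Qed.

(** Lebesgue differentiation gives convergence almost everywhere along [d = 1 / (n + 1)]; since [f]
    and its means are bounded by [M], the constant [(2 * M) ^+ 2] dominates the squared errors. *)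
Lemma avg_approx (e : R) : 0 < e -> exists2 d : R, 0 < d & L2norm (fun x => f x - avg d f x) < e.
Proof.
move=> e0.
have Lf : L2 f by exact: L2_bounded fM.
pose F (n : nat) (x : R) := ((f x - avg (n.+1%:R^-1) f x) ^+ 2)%:E.
have LF n : L2 (fun x => f x - avg (n.+1%:R^-1) f x).
  by apply: L2B => //; apply: avg_L2; rewrite invr_gt0.
have [] := @dominated_convergence _ _ R mu `[(0 : R), 1] (measurable_itv _) F (fun=> 0%E) (fun=> (((2 * M) ^+ 2)%:E)).
- by move=> n; have /integrableP[] := L2_sq (LF n).
- exact: measurable_cst.
- apply: (@filterS _ _ (ae_filter_ringOfSetsType mu)) (is_derive_from0_ae mf lf) => x /= h x01.
  apply: cvg_EFin; first exact: nearW.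
  rewrite [X in _ --> X](_ : _ = (f x - f x) ^+ 2); last by rewrite subrr expr0n.
  have c0 : (fun n => f x - avg (n.+1%:R^-1) f x) @ \oo --> f x - f x.
    by apply: cvgB; [exact: cvg_cst|apply: avg_cvg; exact: h].
  exact: (cvgM c0 c0).
- exact: integ_cst.
- apply/aeW => x n _; rewrite /F abse_EFin lee_fin ger0_norm ?sqr_ge0//.
  rewrite -(real_normK (num_real _)) lerXn2r ?nnegrE ?mulr_ge0//.
  apply: (le_trans (ler_normB _ _)); rewrite mulr_natl mulr2n lerD//.
  by apply: avg_bounded; rewrite invr_gt0.
move=> _ _; rewrite integral0 => /fine_cvgP[_] /cvgrPdist_lt/(_ (e ^+ 2)).
rewrite exprn_gt0// => /(_ isT) [n _ /(_ n)] /=; rewrite leqnn => /(_ isT).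
rewrite sub0r normrN => Hn; exists (n.+1%:R^-1); first by rewrite invr_gt0.
rewrite -(@ltr_pXn2r _ 2) ?nnegrE ?L2norm_ge0 ?(ltW e0)//.
apply: le_lt_trans Hn; apply: le_trans (ler_norm _).
by rewrite sqr_sqrtr// Rintegral_ge0// => ? _; exact: sqr_ge0.
Qed.

End bounded_periodic.

Lemma L2_cont f : continuous f -> periodic f 1 -> L2 f.
Proof.
move=> cf pf; split => //; first exact: continuous_measurable_fun.
by apply: integ_cont => x; apply: cvgM; exact: cf.
Qed.

Lemma per_bounded f : continuous f -> periodic f 1 -> exists M, forall x, `|f x| <= M.
Proof.
move=> cf pf; have cn : {within `[0, 1], continuous (fun x => `|f x|)}.
  by apply: continuous_subspaceT => x; apply: cvg_norm; exact: cf.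
have [c _ fc] := EVT_max ler01 cn; exists `|f c| => x.
have [y /andP[y0 y1] ->] := per_frac x pf.
by apply: fc; rewrite in_itv/= y0 ltW.
Qed.

(** Averaging twice: the first mean of a bounded function is continuous, the mean of a continuous
    function is [C1]. *)
Lemma bounded_approx f M (e : R) : periodic f 1 -> measurable_fun setT f ->
  (forall x, `|f x| <= M) -> 0 < e ->
  exists q, [/\ periodic q 1, C1 q & L2norm (fun x => f x - q x) < e].
Proof.
move=> pf mf fM e0; have e20 : 0 < e / 2 by rewrite divr_gt0.
have [d d0 dn] := avg_approx pf mf fM e20.
have cg := avg_continuous mf fM (d := d).
have pg := avg_periodic pf mf fM d0.
have gM := fun x => avg_bounded mf fM x d0.
have mg := continuous_measurable_fun cg.
have [d' d'0 dn'] := avg_approx pg mg gM e20.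
exists (avg d' (avg d f)); split.
- exact: (avg_periodic pg mg gM).
- exact: avg_C1.
- apply: (le_lt_trans (@L2norm_dist _ _ (avg d f) _ _ _ _)).
  + exact: L2_bounded fM.
  + exact: avg_L2 fM _ _.
  + exact: avg_L2 gM _ _.
  + by rewrite [ltRHS](splitr e); exact: (ltrD dn dn').
Qed.

(** Truncation to [[-n, n]] never increases the distance to [f] beyond [|f|], so [f ^+ 2] dominates
    the squared errors, which are eventually 0 at each point. *)
Lemma trunc_approx f (e : R) : L2 f -> 0 < e -> exists g M,
  [/\ periodic g 1, measurable_fun setT g, (forall x, `|g x| <= M) &
      L2norm (fun x => f x - g x) < e].
Proof.
move=> Lf e0; have [pf mf f2] := Lf.
pose g (n : nat) (x : R) := Num.max (- n%:R) (Num.min n%:R (f x)).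
have gn n x : `|g n x| <= n%:R.
  rewrite ler_norml le_max lexx/= ge_max ge_min lexx/= andbT.
  by rewrite (le_trans _ (ler0n _ n))// oppr_le0.
have pg n : periodic (g n) 1 by move=> x; rewrite /g pf.
have mg n : measurable_fun setT (g n).
  by apply: measurable_maxr => //; exact: measurable_minr.
have Lg n : L2 (g n) by exact: (L2_bounded (pg n) (mg n) (gn n)).
have fg n x : `|f x - g n x| <= `|f x|.
  rewrite /g; have n0 := ler0n R n; case: (lerP n%:R (f x)) => h1.
    case: (lerP (- n%:R) n%:R) => h2; last by lra.
    by rewrite !ger0_norm; lra.
  case: (lerP (- n%:R) (f x)) => h2; first by rewrite subrr normr0.
  by rewrite !ler0_norm; lra.
pose F (n : nat) (x : R) := ((f x - g n x) ^+ 2)%:E.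
have LF n := L2B Lf (Lg n).
have [] := @dominated_convergence _ _ R mu `[(0 : R), 1] (measurable_itv _) F (fun=> 0%E) (fun x => (f x ^+ 2)%:E).
- by move=> n; have /integrableP[] := L2_sq (LF n).
- exact: measurable_cst.
- apply/aeW => x _; apply: cvg_near_cst.
  near=> n; rewrite /F /g; have : `|f x| <= n%:R by near: n; exact: nbhs_infty_ger.
  by rewrite ler_norml => /andP[h1 h2]; rewrite (min_idPr h2) (max_idPr h1) subrr expr0n.
- exact: L2_sq.
- apply/aeW => x n _; rewrite /F abse_EFin lee_fin ger0_norm ?sqr_ge0//.
  by rewrite -(real_normK (num_real (f x - g n x))) -[leRHS](real_normK (num_real (f x))) lerXn2r.
move=> _ _; rewrite integral0 => /fine_cvgP[_] /cvgrPdist_lt/(_ (e ^+ 2)).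
rewrite exprn_gt0// => /(_ isT) [n _ /(_ n)] /=; rewrite leqnn => /(_ isT).
rewrite sub0r normrN => Hn; exists (g n), n%:R; split => //.
rewrite -(@ltr_pXn2r _ 2) ?nnegrE ?L2norm_ge0 ?(ltW e0)//.
apply: le_lt_trans Hn; apply: le_trans (ler_norm _).
by rewrite sqr_sqrtr// Rintegral_ge0// => ? _; exact: sqr_ge0.
Unshelve. all: by end_near. Qed.

Lemma C1_dense f (e : R) : L2 f -> 0 < e ->
  exists q, [/\ periodic q 1, C1 q & L2norm (fun x => f x - q x) < e].
Proof.
move=> Lf e0; have e20 : 0 < e / 2 by rewrite divr_gt0.
have [g [M [pg mg gM fg]]] := trunc_approx Lf e20.
have [q [pq cq gq]] := bounded_approx pg mg gM e20.
exists q; split => //; have := L2_cont (C1_continuous cq) pq => Lq.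
apply: (le_lt_trans (@L2norm_dist _ _ g _ _ _ _)) => //.
  exact: L2_bounded gM.
lra.
Qed.

End mollifier.

(** * Weak derivatives *)

Section weak_derivative.
Context {R : realType}.
Implicit Types (f g h w q : R -> R) (c M : R).

Local Notation mu := (@lebesgue_measure R).

Lemma periodic_derive1 f : C1 f -> periodic f 1 -> periodic (derive1 f) 1.
Proof.
move=> cf pf x; have := isd_shift (C1_isd (x + 1) cf).
by under [X in is_derive _ _ X]eq_fun do rewrite pf; move=> /isd_derive1.
Qed.

Lemma C1_L2 f : C1 f -> periodic f 1 -> L2 f.
Proof. by move=> cf pf; apply: L2_cont => //; exact: C1_continuous. Qed.

Lemma C1_L2_derive1 f : C1 f -> periodic f 1 -> L2 (derive1 f).
Proof. by move=> cf pf; apply: L2_cont; [case: cf|exact: periodic_derive1]. Qed.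

Lemma C1_LR f (a b : R) : C1 f -> derivable_oo_LRcontinuous f a b.
Proof.
move=> cf; have ct := C1_continuous cf; split.
- by move=> x _; case: cf.
- by apply: cvg_at_right_filter; exact: ct.
- by apply: cvg_at_left_filter; exact: ct.
Qed.

Lemma C1M f g : C1 f -> C1 g ->
  C1 (fun x => f x * g x) /\ derive1 (fun x => f x * g x) = (fun x => derive1 f x * g x + f x * derive1 g x).
Proof.
move=> cf cg; apply: isd_C1 => x; first by apply: isdM; exact: C1_isd.
have := C1_continuous cf; have := C1_continuous cg; case: cf => _ cf'; case: cg => _ cg' cg cf.
by apply: cvgD; apply: cvgM; [exact: cf'|exact: cg|exact: cf|exact: cg'].
Qed.

Lemma FTC_C1 f (a b : R) : C1 f -> a <= b ->
  \int[mu]_(x in `[a, b]) derive1 f x = f b - f a.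
Proof.
move=> cf; rewrite le_eqVlt => /predU1P[->|ab].
  by rewrite set_itv1 Rintegral_set1 subrr.
rewrite /Rintegral (@continuous_FTC2 _ _ f)//.
- by apply: continuous_subspaceT; case: cf.
- exact: C1_LR.
Qed.

Lemma C1_wderiv f : C1 f -> periodic f 1 -> is_wderiv f (derive1 f).
Proof.
move=> cf pf h ph ch; have [cfh dfh] := C1M cf ch.
have /esym := FTC_C1 cfh ler01; rewrite dfh => H.
have e1 : f 1 * h 1 - f 0 * h 0 = 0.
  by rewrite -{1 2}(add0r (1 : R)) pf ph subrr.
move: H; rewrite e1 RintegralD//.
- by move=> /eqP; rewrite addrC eq_sym addr_eq0 => /eqP.
- by apply: L2_integM; [exact: C1_L2_derive1|exact: C1_L2].
- by apply: L2_integM; [exact: C1_L2|exact: C1_L2_derive1].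
Qed.

Lemma is_wderiv_ip f g h : is_wderiv f g -> periodic h 1 -> C1 h ->
  ip f (derive1 h) = - ip g h.
Proof. by move=> fg ph ch; exact: fg. Qed.

(** For [q] close to [f], [ip f f = ip f (f - q)] is at most [L2norm f] times a small number. *)
Lemma C1_orthogonal f : L2 f -> (forall q, periodic q 1 -> C1 q -> ip f q = 0) ->
  eqae f (fun=> 0).
Proof.
move=> Lf fq; apply: L2norm0_eqae => //; apply/eqP; rewrite eq_le L2norm_ge0 andbT.
apply/ler_addgt0Pl => e e0; rewrite addr0.
have [q [pq cq qe]] := C1_dense Lf e0.
have Lq := C1_L2 cq pq.
have [->|n0] := eqVneq (L2norm f) 0; first exact: ltW.
have np : 0 < L2norm f by rewrite lt0r n0 L2norm_ge0.
rewrite -(ler_pM2l np) -expr2 L2norm_sq.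
have -> : ip f f = ip f (fun x => f x - q x) by rewrite ipBr// (fq q)// subr0.
apply: (le_trans (ler_norm _)); apply: (le_trans (Cauchy_Schwarz Lf (L2B Lf Lq))).
by rewrite ler_pM2l// ltW.
Qed.

Lemma is_wderiv_unique f g g' : L2 g -> L2 g' -> is_wderiv f g -> is_wderiv f g' ->
  eqae g g'.
Proof.
move=> Lg Lg' fg fg'; apply: eqaeB; apply: C1_orthogonal; first exact: L2B.
move=> q pq cq; have Lq := C1_L2 cq pq; rewrite ipBl//.
by have := is_wderiv_ip fg pq cq; rewrite (is_wderiv_ip fg' pq cq) => /oppr_inj ->; rewrite subrr.
Qed.

(** Both sides of the defining identity are continuous in the [L2] norm for a fixed test function.
    Product and chain rules are extended from [C1] functions through this closure. *)
Lemma is_wderiv_closed f g : L2 f -> L2 g ->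
  (forall e : R, 0 < e -> exists f' g', [/\ L2 f', L2 g', is_wderiv f' g',
     L2norm (fun x => f x - f' x) < e & L2norm (fun x => g x - g' x) < e]) ->
  is_wderiv f g.
Proof.
move=> Lf Lg H h ph ch; rewrite -[LHS]/(ip _ _) -[X in - X]/(ip g h).
have Lh := C1_L2 ch ph; have Lh' := C1_L2_derive1 ch ph.
apply/eqP; rewrite -subr_eq0 opprK -normr_le0; apply/ler_addgt0Pl => e e0; rewrite addr0.
pose K := L2norm (derive1 h) + L2norm h + 1.
have K0 : 0 < K by rewrite ltr_wpDl// addr_ge0// L2norm_ge0.
have [f' [g' [Lf' Lg' fg' fe ge]]] := H (e / K) (divr_gt0 e0 K0).
have -> : ip f (derive1 h) + ip g h =
    ip (fun x => f x - f' x) (derive1 h) + ip (fun x => g x - g' x) h.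
  by rewrite !ipBl// (is_wderiv_ip fg')//; ring.
apply: (le_trans (ler_normD _ _)).
have h1 := Cauchy_Schwarz (L2B Lf Lf') Lh'.
have h2 := Cauchy_Schwarz (L2B Lg Lg') Lh.
have n1 := L2norm_ge0 (derive1 h); have n2 := L2norm_ge0 h.
apply: (le_trans (lerD h1 h2)).
apply: (@le_trans _ _ (e / K * L2norm (derive1 h) + e / K * L2norm h)).
  by apply: lerD; apply: ler_wpM2r => //; exact: ltW.
rewrite -mulrDr -mulrA -[leRHS]mulr1 ler_pM2l// ler_pdivrMl// mulr1.
by rewrite /K lerDl.
Qed.

Lemma is_wderiv_eqae f f' g : L2 f -> L2 f' -> eqae f f' -> is_wderiv f g ->
  is_wderiv f' g.
Proof.
move=> Lf Lf' ff' fg h ph ch; rewrite -(fg h ph ch); apply: eqae_ip => //.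
- exact: eqae_sym.
- exact: C1_L2_derive1.
Qed.

Lemma is_wderiv_eqae_r f g g' : L2 g -> L2 g' -> eqae g g' -> is_wderiv f g ->
  is_wderiv f g'.
Proof.
move=> Lg Lg' gg' fg h ph ch; rewrite (fg h ph ch); congr (- _); apply: eqae_ip => //.
exact: C1_L2.
Qed.

Lemma is_wderivB f f' g g' : L2 f -> L2 f' -> L2 g -> L2 g' ->
  is_wderiv f g -> is_wderiv f' g' ->
  is_wderiv (fun x => f x - f' x) (fun x => g x - g' x).
Proof.
move=> Lf Lf' Lg Lg' fg fg' h ph ch.
have Lh := C1_L2 ch ph; have Lh' := C1_L2_derive1 ch ph.
rewrite -[LHS]/(ip _ _) -[X in - X]/(ip (fun x => g x - g' x) h).
by rewrite !ipBl// (is_wderiv_ip fg)// (is_wderiv_ip fg')//; ring.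
Qed.

Lemma is_wderivD f f' g g' : L2 f -> L2 f' -> L2 g -> L2 g' ->
  is_wderiv f g -> is_wderiv f' g' ->
  is_wderiv (fun x => f x + f' x) (fun x => g x + g' x).
Proof.
move=> Lf Lf' Lg Lg' fg fg' h ph ch.
have Lh := C1_L2 ch ph; have Lh' := C1_L2_derive1 ch ph.
rewrite -[LHS]/(ip _ _) -[X in - X]/(ip (fun x => g x + g' x) h).
by rewrite !ipDl// (is_wderiv_ip fg)// (is_wderiv_ip fg')//; ring.
Qed.

Lemma is_wderivZ c f g : L2 f -> L2 g -> is_wderiv f g ->
  is_wderiv (fun x => c * f x) (fun x => c * g x).
Proof.
move=> Lf Lg fg h ph ch.
have Lh := C1_L2 ch ph; have Lh' := C1_L2_derive1 ch ph.
rewrite -[LHS]/(ip _ _) -[X in - X]/(ip (fun x => c * g x) h).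
by rewrite !ipZl// (is_wderiv_ip fg)//; ring.
Qed.

Lemma C1_cst c : C1 (fun=> c) /\ derive1 (fun=> c) = (fun=> 0).
Proof. by apply: (isd_C1 (isd_cst c)) => x; exact: cvg_cst. Qed.

Lemma ip1 f : ip f (fun=> 1) = \int[mu]_(x in `[0, 1]) f x.
Proof. by apply: eq_Rintegral => x _; rewrite mulr1. Qed.

Lemma ip0l f : ip (fun=> 0) f = 0.
Proof. by rewrite /ip; under eq_Rintegral do rewrite mul0r; rewrite Rintegral_cst// mul0r. Qed.

Lemma is_wderiv_mean0 f g : is_wderiv f g -> ip g (fun=> 1) = 0.
Proof.
move=> fg; have [c1 d1] := C1_cst 1.
have := is_wderiv_ip fg (h := fun=> 1) (fun=> erefl) c1; rewrite d1 => /eqP.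
rewrite ipC ip0l.
by rewrite eq_sym oppr_eq0 => /eqP.
Qed.

Lemma from0_C1 q : continuous q -> C1 (integral_from0 q) /\ derive1 (integral_from0 q) = q.
Proof. by move=> cq; apply: isd_C1 => // x; exact: is_derive_from0_cont. Qed.

Lemma from0_periodic q : continuous q -> periodic q 1 -> ip q (fun=> 1) = 0 ->
  periodic (integral_from0 q) 1.
Proof.
move=> cq pq q0 x.
have D0 (y : R) : is_derive y 1 (fun y => integral_from0 q (y + 1) - integral_from0 q y) 0.
  rewrite -[X in is_derive _ _ _ X](subrr (q y)); apply: isdB; last exact: is_derive_from0_cont.
  by rewrite -pq; apply: isd_shift; exact: is_derive_from0_cont.
have := eq_isd0 D0 x 0 => /=; rewrite add0r.
rewrite (integral_from0B (locint_cont cq) ler01).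
by rewrite -ip1 q0 => /eqP; rewrite subr_eq0 => /eqP.
Qed.

(** The primitive starts at 0 and is periodic, so only [y] in [[0, 1]] matters; there it is bounded
    by the integral of [|q|], hence by [L2norm q] because the circle has length 1. *)
Lemma from0_sup q x : continuous q -> periodic q 1 -> ip q (fun=> 1) = 0 ->
  `|integral_from0 q x| <= L2norm q.
Proof.
move=> cq pq q0; have [y /andP[y0 y1] ->] := per_frac x (from0_periodic cq pq q0).
have lq := locint_cont cq.
have Lq := L2_cont cq pq.
rewrite /integral_from0 y0; apply: (le_trans (le_normr_Rintegral _ (lq 0 y))) => //.
have cn : continuous (fun x => `|q x|) by move=> z; apply: cvg_norm; exact: cq.
have Ln : L2 (fun x => `|q x|) by apply: L2_cont => // z; rewrite pq.
apply: (@le_trans _ _ (ip (fun x => `|q x|) (fun=> 1))).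
  rewrite ip1 (int_cat (locint_cont cn) y0 (ltW y1)) lerDl.
  by apply: Rintegral_ge0.
apply: (le_trans (ler_norm _)); apply: (le_trans (Cauchy_Schwarz Ln (L2_cst 1))).
rewrite L2norm_cst normr1 mulr1; apply: L2norm_le => // z.
by rewrite normr_id.
Qed.

(** The du Bois-Reymond argument: a [C1] function [q] minus its mean has a periodic primitive, which
    is an admissible test function. So [f] is orthogonal to every such difference, and [f] minus its
    mean to every [q]. *)
Lemma wderiv0_cst f : L2 f -> is_wderiv f (fun=> 0) -> exists c, eqae f (fun=> c).
Proof.
move=> Lf f0; exists (ip f (fun=> 1)); apply: eqaeB.
apply: C1_orthogonal; first by apply: L2B => //; exact: L2_cst.
move=> q pq cq; have Lq := C1_L2 cq pq.
have L1 := L2_cst (1 : R).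
pose m := ip q (fun=> 1); pose q' x := q x - m.
have cq' : continuous q'.
  by move=> x; apply: cvgB; [exact: C1_continuous|exact: cvg_cst].
have pq' : periodic q' 1 by move=> x; rewrite /q' pq.
have q'0 : ip q' (fun=> 1) = 0.
  rewrite /q' ipBl//; last exact: L2_cst.
  by rewrite -/m [X in _ - X]ip1 Rintegral_cst//= lebesgue_measure_itv/= lte_fin ltr01 oppr0 adde0 mulr1 subrr.
have [ch dh] := from0_C1 cq'.
have := is_wderiv_ip f0 (from0_periodic cq' pq' q'0) ch.
rewrite dh /q' ipBr//; last exact: L2_cst.
rewrite ip0l.
have -> : ip f (fun=> m) = m * ip f (fun=> 1).
  by rewrite -ipZr//; apply: eq_Rintegral => x _; rewrite mulr1.
rewrite oppr0 => H; rewrite ipBl//; last exact: L2_cst.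
have -> : ip (fun=> ip f (fun=> 1)) q = ip f (fun=> 1) * m.
  by rewrite /m [ip q _]ipC -ipZl//; apply: eq_Rintegral => x _; rewrite mulr1.
by rewrite mulrC.
Qed.

Lemma wderiv0_cst_cont f : continuous f -> periodic f 1 -> is_wderiv f (fun=> 0) ->
  forall x y, f x = f y.
Proof.
move=> cf pf f0; have Lf := L2_cont cf pf.
have [c fc] := wderiv0_cst Lf f0.
suff H x : f x = c by move=> x y; rewrite !H.
apply/eqP; rewrite -subr_eq0; apply/eqP.
apply: (@L2norm0_cont _ (fun x => f x - c)).
- by move=> z; apply: cvgB; [exact: cf|exact: cvg_cst].
- by apply: L2B => //; exact: L2_cst.
- rewrite (@eqae_L2norm _ _ (fun=> 0)) ?L2norm_cst ?normr0//.
  + by apply: (@filterS _ _ (ae_filter_ringOfSetsType mu)) fc => z /= h zI; rewrite h// subrr.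
  + by apply: L2B => //; exact: L2_cst.
  + exact: L2_cst.
Qed.

Lemma int01_cst c : \int[mu]_(x in `[0, 1]) c = c.
Proof.
by rewrite Rintegral_cst//= lebesgue_measure_itv/= lte_fin ltr01 oppr0 adde0 mulr1.
Qed.

(** Subtracting the mean of a [C1] approximation costs little, since [g] has mean 0 and the mean of
    [q] is bounded by the distance from [g] to [q]. *)
Lemma C1_dense_mean0 g (e : R) : L2 g -> ip g (fun=> 1) = 0 -> 0 < e ->
  exists q, [/\ periodic q 1, continuous q, ip q (fun=> 1) = 0 &
    L2norm (fun x => g x - q x) <= e].
Proof.
move=> Lg g0 e0; have e20 : 0 < e / 2 by rewrite divr_gt0.
have [q [pq cq qe]] := C1_dense Lg e20.
have Lq := C1_L2 cq pq; have L1 := L2_cst (1 : R).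
pose m := ip q (fun=> 1).
have mE : `|m| <= e / 2.
  rewrite -normrN -[- m]add0r -g0 -ipBl//.
  apply: (le_trans (Cauchy_Schwarz (L2B Lg Lq) L1)).
  by rewrite L2norm_cst normr1 mulr1 ltW.
exists (fun x => q x - m); split.
- by move=> x; rewrite pq.
- by move=> x; apply: cvgB; [exact: C1_continuous|exact: cvg_cst].
- by rewrite ipBl//; [rewrite -/m [X in _ - X]ip1 int01_cst subrr|exact: L2_cst].
- have -> : (fun x => g x - (q x - m)) = (fun x => (g x - q x) + m).
    by apply/funext => x; ring.
  apply: (le_trans (L2norm_triangle (L2B Lg Lq) (L2_cst m))).
  by rewrite L2norm_cst [leRHS](splitr e); apply: lerD => //; exact: ltW.
Qed.

Lemma three_eps (a b c d e z : R) : `|a - c| <= z -> `|b - d| <= z ->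
  `|c - d| < e / 3 -> z < e / 3 -> `|a - b| < e.
Proof.
move=> ac bd cd ze.
have -> : a - b = (a - c) + (c - d) - (b - d) by ring.
apply: (le_lt_trans (ler_normB _ _)).
have := ler_normD (a - c) (c - d); lra.
Qed.

Lemma ex_harmonic (e : R) : 0 < e -> exists n : nat, n.+1%:R^-1 < e.
Proof.
move=> e0; have /cvgrPdist_lt/(_ _ e0) [n _ /(_ n (leqnn n)) /=] := @cvg_harmonic R.
by rewrite sub0r normrN ger0_norm ?invr_ge0// => ne; exists n.
Qed.

(* Q is the uniform limit of the primitives of mean-zero continuous functions
   approximating g in L^2. *)
Lemma wderiv_primitive g : L2 g -> ip g (fun=> 1) = 0 ->
  exists Q : R -> R, [/\ periodic Q 1, continuous Q, is_wderiv Q g &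
    forall x, `|Q x| <= L2norm g] /\
    forall e : R, 0 < e -> exists q, [/\ periodic q 1, C1 q,
      (forall x, `|Q x - q x| <= e) & L2norm (fun x => g x - derive1 q x) <= e].
Proof.
move=> Lg g0.
have /choice [q Hq] : forall n : nat, exists q, [/\ periodic q 1, continuous q,
    ip q (fun=> 1) = 0 & L2norm (fun x => g x - q x) <= n.+1%:R^-1].
  by move=> n; apply: C1_dense_mean0.
pose P n := integral_from0 (q n).
have qL n : L2 (q n) by have [? ? _ _] := Hq n; exact: L2_cont.
(* Bounding primitives uniformly by [L2] norms of their densities makes [P] uniformly Cauchy. *)
have dP n m x : `|P n x - P m x| <= n.+1%:R^-1 + m.+1%:R^-1.
  have [pn cn n0 en] := Hq n; have [pm cm m0 em] := Hq m.
  pose d y := q n y - q m y.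
  have cd : continuous d by move=> z; apply: cvgB; [exact: cn|exact: cm].
  have pd : periodic d 1 by move=> z; rewrite /d pn pm.
  have d0 : ip d (fun=> 1) = 0.
    by rewrite /d ipBl ?n0 ?m0 ?subrr//; exact: L2_cst.
  have -> : P n x - P m x = integral_from0 d x.
    have D0 (y : R) : is_derive y 1 (fun y => P n y - P m y - integral_from0 d y) 0.
      rewrite -[X in is_derive _ _ _ X](subrr (d y)); apply: isdB; last exact: is_derive_from0_cont.
      by apply: isdB; exact: is_derive_from0_cont.
    have := eq_isd0 D0 x 0; rewrite /P !integral_from00 subrr subr0.
    by move/eqP; rewrite subr_eq0 => /eqP.
  apply: (le_trans (from0_sup x cd pd d0)).
  apply: (le_trans (L2norm_dist (qL n) Lg (qL m))).
  by rewrite L2normBC; exact: lerD.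
have cvP x : cvgn (fun n => P n x).
  apply/cauchy_cvgP/cauchy_ballP => e e0; rewrite !near_simpl.
  have e20 : 0 < e / 2 by rewrite divr_gt0.
  have [N0 N0e] := ex_harmonic e20.
  exists ([set n | (N0 <= n)%N], [set n | (N0 <= n)%N]) => /=.
    by split; exists N0.
  move=> [n m] /= [nN mN]; rewrite /ball/=; apply: (le_lt_trans (dP n m x)).
  rewrite [ltRHS](splitr e); apply: ltrD; apply: le_lt_trans N0e;
    by rewrite lef_pV2 ?posrE// ler_nat ltnS.
pose Q x := limn (fun n => P n x).
have cvQ x : (fun n => P n x) @ \oo --> Q x by exact: cvP.
have dQ n x : `|Q x - P n x| <= n.+1%:R^-1.
  have h1 : (fun m => `|P m x - P n x|) @ \oo --> `|Q x - P n x|.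
    by apply: cvg_norm; apply: cvgB; [exact: cvQ|exact: cvg_cst].
  have h2 : (fun m => m.+1%:R^-1 + n.+1%:R^-1 : R) @ \oo --> (0 + n.+1%:R^-1 : R).
    by apply: cvgD; [exact: cvg_harmonic|exact: cvg_cst].
  rewrite -[leRHS]add0r; apply: (ler_cvg_to h1 h2).
  by apply: nearW => m; exact: dP.
have pP n : periodic (P n) 1 by have [pn cn n0 en] := Hq n; exact: from0_periodic.
have pQ : periodic Q 1.
  by move=> x; rewrite /Q; have -> : P^~ (x + 1) = P^~ x by apply/funext => n; exact: pP.
have cP n : C1 (P n) by have [pn cn n0 en] := Hq n; case: (from0_C1 cn).
have dPq n : derive1 (P n) = q n by have [pn cn n0 en] := Hq n; case: (from0_C1 cn).
have cQ : continuous Q.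
  move=> x; apply/cvgrPdist_lt => e e0.
  have e30 : 0 < e / 3 by rewrite divr_gt0.
  have [n ne] := ex_harmonic e30.
  have cPn : continuous (P n) by exact: C1_continuous.
  have /cvgrPdist_lt/(_ _ e30) := cPn x.
  apply: filterS => y Hy.
  exact: (three_eps (dQ n x) (dQ n y) Hy ne).
have LQ := L2_cont cQ pQ.
have ap (e : R) : 0 < e -> exists n, n.+1%:R^-1 < e /\ [/\ (forall x, `|Q x - P n x| <= e) ,
    L2norm (fun x => Q x - P n x) <= n.+1%:R^-1 & L2norm (fun x => g x - q n x) <= n.+1%:R^-1].
  move=> e0.
  have [n ne] := ex_harmonic e0.
  exists n; split => //; split.
  - by move=> x; exact: le_trans (dQ n x) (ltW ne).
  - by apply: L2norm_sup => //; apply: L2B => //; exact: C1_L2.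
  - by have [] := Hq n.
exists Q; split; first split => //.
- apply: is_wderiv_closed => // e e0; have [n [ne [_ h1 h2]]] := ap e e0.
  exists (P n), (q n); split => //.
  + exact: C1_L2.
  + by rewrite -dPq; exact: C1_wderiv.
  + exact: le_lt_trans ne.
  + exact: le_lt_trans ne.
- move=> x; apply/ler_addgt0Pl => e e0.
  have e20 : 0 < e / 2 by rewrite divr_gt0.
  have [n [ne [h0 h1 h2]]] := ap _ e20.
  have [pn cn n0 en] := Hq n.
  have h3 : `|P n x| <= L2norm (q n) by exact: from0_sup.
  have h4 : L2norm (q n) <= L2norm (fun x => q n x - g x) + L2norm g.
    have := L2norm_triangle (L2B (qL n) Lg) Lg.
    by under [X in L2norm X <= _]eq_fun do rewrite subrK.
  rewrite L2normBC in h4.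
  have h5 := h0 x; have h6 := ler_normD (Q x - P n x) (P n x).
  move: h6; rewrite subrK.
  move: h2 h3 h4 h5 ne e0; set a := L2norm _; set b := L2norm _; set c := L2norm g.
  set z := _^-1; set u := `|_|; set v := `|_|; set w := `|_| => *; lra.
- move=> e e0; have [n [ne [h0 h1 h2]]] := ap _ e0.
  by exists (P n); split => //; rewrite dPq; exact: le_trans h2 (ltW ne).
Unshelve. all: by end_near. Qed.

Lemma cont_wderiv_primitive f g : continuous f -> L2 f -> L2 g -> is_wderiv f g ->
  exists c Q, [/\ forall x, f x = c + Q x, forall x, `|Q x| <= L2norm g &
    forall e : R, 0 < e -> exists q, [/\ periodic q 1, C1 q,
      (forall x, `|Q x - q x| <= e) & L2norm (fun x => g x - derive1 q x) <= e]].
Proof.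
move=> cf Lf Lg fg.
have [Q [[pQ cQ wQ bQ] aQ]] := wderiv_primitive Lg (is_wderiv_mean0 fg).
have LQ := L2_cont cQ pQ.
have pf : periodic f 1 by case: Lf.
have := wderiv0_cst_cont (f := fun x => f x - Q x).
move=> /(_ (fun x => cvgB (cf x) (cQ x))) H.
exists (f 0 - Q 0), Q; split => // x.
rewrite -(H _ _ x 0) ?subrK//; first by move=> z; rewrite pf pQ.
have := is_wderivB Lf LQ Lg Lg fg wQ.
by under [X in is_wderiv _ X]eq_fun do rewrite subrr.
Qed.

(** Uniform closeness of the values together with [L2] closeness of the derivatives is what survives
    multiplication and composition; the product and chain rules for weak derivatives rest on it. *)
Lemma H1_approx f g (e : R) : continuous f -> L2 f -> L2 g -> is_wderiv f g -> 0 < e ->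
  exists q, [/\ periodic q 1, C1 q, (forall x, `|f x - q x| <= e) &
    L2norm (fun x => g x - derive1 q x) <= e].
Proof.
move=> cf Lf Lg fg e0.
have [c [Q [fE _ /(_ _ e0) [q [pq cq Qq gq]]]]] := cont_wderiv_primitive cf Lf Lg fg.
have [cq' dq'] : C1 (fun x => c + q x) /\ derive1 (fun x => c + q x) = derive1 q.
  have D x := isdD (isd_cst c x) (C1_isd x cq).
  have ct : continuous (fun x => 0 + derive1 q x).
    by have [_ cq'] := cq; move=> x; apply: cvgD; [exact: cvg_cst|exact: cq'].
  have [? ->] := isd_C1 D ct; split => //.
  by apply/funext => x; rewrite add0r.
exists (fun x => c + q x); split.
- by move=> x; rewrite pq.
- exact: cq'.
- by move=> x; rewrite fE opprD addrACA subrr add0r.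
- by rewrite dq'.
Qed.

(** Sobolev embedding on the circle: write [f = c + Q] with [|Q| <= L2norm g]; then [c = f - Q] has
    norm at most [L2norm f + L2norm g]. *)
Lemma H1_sup f g x : continuous f -> L2 f -> L2 g -> is_wderiv f g ->
  `|f x| <= L2norm f + 2 * L2norm g.
Proof.
move=> cf Lf Lg fg; have pf : periodic f 1 by case: Lf.
have [c [Q [fE bQ _]]] := cont_wderiv_primitive cf Lf Lg fg.
have QE : Q = (fun x => f x - c) by apply/funext => y; rewrite fE addrC addKr.
have LQ : L2 Q by rewrite QE; apply: L2B => //; exact: L2_cst.
have h1 : `|c| <= L2norm f + L2norm g.
  rewrite -L2norm_cst.
  have -> : (fun=> c) = (fun x => f x - Q x) by apply/funext => y; rewrite fE addrK.
  apply: (le_trans (L2norm_triangle Lf (L2N LQ))); rewrite lerD2l L2normN.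
  exact: L2norm_sup.
have h2 := bQ x; rewrite fE; have := ler_normD c (Q x).
move: h1 h2; set a := L2norm f; set b := L2norm g; lra.
Qed.

Lemma wderiv_cont_repr f g : L2 f -> L2 g -> is_wderiv f g ->
  exists f', [/\ continuous f', L2 f' & eqae f f'].
Proof.
move=> Lf Lg fg.
have [Q [[pQ cQ wQ bQ] aQ]] := wderiv_primitive Lg (is_wderiv_mean0 fg).
have LQ := L2_cont cQ pQ.
have := is_wderivB Lf LQ Lg Lg fg wQ.
under [X in is_wderiv _ X]eq_fun do rewrite subrr.
move=> /(wderiv0_cst (L2B Lf LQ)) [c fc].
exists (fun x => Q x + c); split.
- by move=> x; apply: cvgD; [exact: cQ|exact: cvg_cst].
- by apply: L2D => //; exact: L2_cst.
- apply: (@filterS _ _ (ae_filter_ringOfSetsType mu)) fc => x /= h xI.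
  by rewrite -(h xI) addrC subrK.
Qed.

(** The primitive of [g] is periodic because a weak derivative has mean 0; subtracting it from [f]
    leaves weak derivative 0, hence a constant. *)
Lemma cont_wderiv_C1 f g : continuous f -> periodic f 1 -> continuous g ->
  periodic g 1 -> is_wderiv f g -> C1 f /\ derive1 f = g.
Proof.
move=> cf pf cg pg fg; have Lf := L2_cont cf pf; have Lg := L2_cont cg pg.
have g0 := is_wderiv_mean0 fg.
have [cG dG] := from0_C1 cg; have pG := from0_periodic cg pg g0.
have LG := C1_L2 cG pG; have wG := C1_wderiv cG pG; rewrite dG in wG.
have H := wderiv0_cst_cont (f := fun x => f x - integral_from0 g x).
have cG' : continuous (integral_from0 g) by exact: C1_continuous.
have fE x : f x = f 0 + integral_from0 g x.
  have := H (fun x => cvgB (cf x) (cG' x)) _ _ x 0.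
  rewrite integral_from00 subr0 => <-; rewrite ?subrK//.
    by move=> z; rewrite pf pG.
  have := is_wderivB Lf LG Lg Lg fg wG.
  by under [X in is_wderiv _ X]eq_fun do rewrite subrr.
have D x : is_derive (x : R) 1 f (g x).
  have := isdD (isd_cst (f 0) x) (is_derive_from0_cont x cg).
  by apply: isd_eq => [y|]; rewrite ?add0r// fE.
exact: isd_C1.
Qed.

End weak_derivative.

(** * Sobolev spaces *)

Section sobolev.
Context {R : realType}.
Implicit Types (f g h w q : R -> R) (c M : R) (m j : nat).

(** [wderiv] picks some weak derivative, so it is tied to a given one only up to a null set. *)
Lemma wderivP f g : L2 g -> is_wderiv f g ->
  [/\ L2 (wderiv f), is_wderiv f (wderiv f) & eqae (wderiv f) g].
Proof.
move=> Lg fg; have [Lw fw] : [set g | L2 g /\ is_wderiv f g] (wderiv f).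
  by apply: xgetPex; exists g.
by split => //; exact: is_wderiv_unique fw fg.
Qed.

(** An equality of functions, not merely almost everywhere: [xget] depends only on the set of
    candidates, and that set is the same for both functions. Iterated [wderiv] can therefore be
    computed through any representative. *)
Lemma eqae_wderiv f f' : L2 f -> L2 f' -> eqae f f' -> wderiv f = wderiv f'.
Proof.
move=> Lf Lf' ff'; rewrite /wderiv; congr xget; apply/seteqP; split => g [Lg fg].
  by split => //; exact: is_wderiv_eqae fg.
by split => //; apply: is_wderiv_eqae fg => //; exact: eqae_sym.
Qed.

Lemma wderivnS j f : wderivn j.+1 f = wderivn j (wderiv f).
Proof. by rewrite /wderivn iterSr. Qed.

Lemma eqae_wderivn j f f' : L2 f -> L2 f' -> eqae f f' -> (0 < j)%N ->
  wderivn j f = wderivn j f'.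
Proof. by case: j => // j Lf Lf' ff' _; rewrite !wderivnS (eqae_wderiv Lf Lf'). Qed.

Lemma eqae_L2norm_wderivn j f f' : L2 f -> L2 f' -> eqae f f' ->
  L2norm (wderivn j f) = L2norm (wderivn j f').
Proof.
by case: j => [|j] Lf Lf' ff'; [exact: eqae_L2norm|rewrite (eqae_wderivn Lf Lf')].
Qed.

Lemma Hnorm_ge0 m f : 0 <= Hnorm m f.
Proof. exact: sqrtr_ge0. Qed.

Lemma Hnorm_sq m f : Hnorm m f ^+ 2 = \sum_(j < m.+1) L2norm (wderivn j f) ^+ 2.
Proof. by rewrite sqr_sqrtr// sumr_ge0// => j _; exact: sqr_ge0. Qed.

Lemma Hnorm0 f : Hnorm 0 f = L2norm f.
Proof. by rewrite /Hnorm big_ord1 sqrtr_sqr ger0_norm// L2norm_ge0. Qed.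

(** Lets estimates of [Hnorm] run by induction on the order, with any weak derivative [g] in place
    of the chosen one. *)
Lemma HnormS m f g : L2 g -> is_wderiv f g ->
  Hnorm m.+1 f ^+ 2 = L2norm f ^+ 2 + Hnorm m g ^+ 2.
Proof.
move=> Lg fg; have [Lw _ wg] := wderivP Lg fg.
rewrite !Hnorm_sq big_ord_recl; congr (_ + _).
by apply: eq_bigr => j _; rewrite wderivnS (eqae_L2norm_wderivn _ Lw Lg wg).
Qed.

Lemma HnormS_ge m f g : L2 g -> is_wderiv f g -> Hnorm m g <= Hnorm m.+1 f.
Proof.
move=> Lg fg; rewrite -(@ler_pXn2r _ 2) ?nnegrE ?Hnorm_ge0//.
by rewrite (HnormS m Lg fg) lerDr sqr_ge0.
Qed.

Lemma HnormS_le m f g : L2 g -> is_wderiv f g -> Hnorm m.+1 f <= L2norm f + Hnorm m g.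
Proof.
move=> Lg fg; rewrite -(@ler_pXn2r _ 2) ?nnegrE ?addr_ge0 ?Hnorm_ge0 ?L2norm_ge0//.
rewrite (HnormS m Lg fg) sqrrD -addrA lerD2l lerDr mulrn_wge0// mulr_ge0//.
  exact: L2norm_ge0.
exact: Hnorm_ge0.
Qed.

Lemma Hnorm_mono m f : Hnorm m f <= Hnorm m.+1 f.
Proof.
rewrite -(@ler_pXn2r _ 2) ?nnegrE ?Hnorm_ge0// !Hnorm_sq [leRHS]big_ord_recr/=.
by rewrite lerDl sqr_ge0.
Qed.

Lemma L2norm_Hnorm m f : L2norm f <= Hnorm m f.
Proof.
elim: m => [|m IH]; first by rewrite Hnorm0.
exact: le_trans IH (Hnorm_mono _ _).
Qed.

Lemma sobolev_L2 m f : sobolev m f -> L2 f.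
Proof. by case: m => [|m] // []. Qed.

Lemma sobolev_eqae m f f' : L2 f' -> eqae f f' -> sobolev m f -> sobolev m f'.
Proof.
case: m => [|m] // Lf' ff' [Lf [g [fg sg]]]; split => //; exists g; split => //.
exact: is_wderiv_eqae fg.
Qed.

Lemma sobolevW m f : sobolev m.+1 f -> sobolev m f.
Proof.
elim: m f => [f []//|m IH f [Lf [g [fg sg]]]].
by split => //; exists g; split => //; exact: IH.
Qed.

Lemma HspaceW m f : Hspace m.+1 f -> Hspace m f.
Proof. by move=> [sf cf]; split; [exact: sobolevW|move=> _; exact: cf]. Qed.

Lemma Hspace_L2 m f : Hspace m f -> L2 f.
Proof. by case=> /sobolev_L2. Qed.

Lemma Hspace0 f : Hspace 0 f <-> L2 f.
Proof. by split; [exact: Hspace_L2|split]. Qed.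

Lemma Hspace_cont m f : Hspace m.+1 f -> continuous f.
Proof. by case=> _; exact. Qed.

Lemma Hspace_per m f : Hspace m f -> periodic f 1.
Proof. by move=> /Hspace_L2[]. Qed.

Lemma Hspace_intro m f g : L2 f -> continuous f -> is_wderiv f g -> Hspace m g ->
  Hspace m.+1 f.
Proof. by move=> Lf cf fg [sg _]; split => //; split => //; exists g. Qed.

Lemma sobolev_repr m g : sobolev m g -> exists g', Hspace m g' /\ eqae g g'.
Proof.
case: m => [|m]; first by move=> Lg; exists g; split => //; exact: eqae_refl.
move=> [Lg [w [gw sw]]]; have Lw := sobolev_L2 sw.
have [g' [cg' Lg' gg']] := wderiv_cont_repr Lg Lw gw.
exists g'; split => //; split => //; apply: (@sobolev_eqae m.+1 g) => //.
by split => //; exists w.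
Qed.

(** A weak derivative is fixed only up to a null set, so it may be replaced by the continuous
    representative that [Hspace] demands. *)
Lemma Hspace_wderiv m f : Hspace m.+1 f -> exists g, is_wderiv f g /\ Hspace m g.
Proof.
move=> [[Lf [g [fg sg]]] _]; have [g' [Hg' gg']] := sobolev_repr sg.
exists g'; split => //; apply: is_wderiv_eqae_r fg => //; first exact: sobolev_L2 sg.
exact: Hspace_L2 Hg'.
Qed.

Lemma Hspace_C1 m f : Hspace m.+2 f ->
  [/\ C1 f, is_wderiv f (derive1 f) & Hspace m.+1 (derive1 f)].
Proof.
move=> Hf; have [g [fg Hg]] := Hspace_wderiv Hf.
have [cf dfg] := cont_wderiv_C1 (Hspace_cont Hf) (Hspace_per Hf) (Hspace_cont Hg) (Hspace_per Hg) fg.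
by rewrite dfg.
Qed.

Lemma sobolevZ m c f : sobolev m f -> sobolev m (fun x => c * f x).
Proof.
elim: m f => [f Lf|m IH f [Lf [g [fg sg]]]]; first exact: L2Z.
split; first exact: L2Z.
exists (fun x => c * g x); split; last exact: IH.
by apply: is_wderivZ => //; exact: sobolev_L2 sg.
Qed.

Lemma sobolevD m f f' : sobolev m f -> sobolev m f' -> sobolev m (fun x => f x + f' x).
Proof.
elim: m f f' => [f f' Lf Lf'|m IH f f' [Lf [g [fg sg]]] [Lf' [g' [fg' sg']]]]; first exact: L2D.
split; first exact: L2D.
exists (fun x => g x + g' x); split; last exact: IH.
by apply: is_wderivD => //; [exact: sobolev_L2 sg|exact: sobolev_L2 sg'].
Qed.

Lemma HspaceZ m c f : Hspace m f -> Hspace m (fun x => c * f x).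
Proof.
move=> [sf cf]; split; first exact: sobolevZ.
by move=> m0 x; apply: cvgM; [exact: cvg_cst|exact: cf].
Qed.

Lemma HspaceD m f f' : Hspace m f -> Hspace m f' -> Hspace m (fun x => f x + f' x).
Proof.
move=> [sf cf] [sf' cf']; split; first exact: sobolevD.
by move=> m0 x; apply: cvgD; [exact: cf|exact: cf'].
Qed.

Lemma HspaceB m f f' : Hspace m f -> Hspace m f' -> Hspace m (fun x => f x - f' x).
Proof.
move=> Hf /(HspaceZ (-1)) Hf'; have := HspaceD Hf Hf'.
by under [X in Hspace _ X]eq_fun do rewrite mulN1r.
Qed.

Lemma Hspace_cst m c : Hspace m (fun=> c).
Proof.
elim: m c => [|m IH] c; first by apply/Hspace0; exact: L2_cst.
have [cc dc] := C1_cst c.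
apply: (Hspace_intro (g := fun=> 0)) => //.
- exact: L2_cst.
- by move=> x; exact: cvg_cst.
- by rewrite -dc; exact: C1_wderiv.
Qed.

(** The factor 3 is [1 + 2] from [H1_sup], both norms there being bounded by the full one. *)
Lemma Hspace_sup m f x : Hspace m.+1 f -> `|f x| <= 3 * Hnorm m.+1 f.
Proof.
move=> Hf; have [g [fg Hg]] := Hspace_wderiv Hf.
have Lf := Hspace_L2 Hf; have Lg := Hspace_L2 Hg.
apply: (le_trans (H1_sup x (Hspace_cont Hf) Lf Lg fg)).
have h1 := L2norm_Hnorm m.+1 f.
have h2 := le_trans (L2norm_Hnorm m g) (HnormS_ge m Lg fg).
lra.
Qed.

(** Minkowski's inequality for the plane vectors [(a, c)] and [(b, d)] of lengths [p] and [q]; it is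
    the induction step of the triangle inequality for [Hnorm]. *)
Lemma sqr_minkowski (a b c d p q s t : R) : s <= a + b -> t <= c + d ->
  p ^+ 2 = a ^+ 2 + c ^+ 2 -> q ^+ 2 = b ^+ 2 + d ^+ 2 -> 0 <= a -> 0 <= b ->
  0 <= c -> 0 <= d -> 0 <= p -> 0 <= q -> 0 <= s -> 0 <= t ->
  s ^+ 2 + t ^+ 2 <= a ^+ 2 + c ^+ 2 + p * q *+ 2 + (b ^+ 2 + d ^+ 2).
Proof.
move=> h1 h2 e1 e2 a0 b0 c0 d0 p0 q0 s0 t0.
have k1 : s ^+ 2 <= (a + b) ^+ 2 by rewrite ler_pXn2r// nnegrE addr_ge0.
have k2 : t ^+ 2 <= (c + d) ^+ 2 by rewrite ler_pXn2r// nnegrE addr_ge0.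
have k3 : a * b + c * d <= p * q.
  rewrite -(@ler_pXn2r _ 2) ?nnegrE ?addr_ge0 ?mulr_ge0// exprMn e1 e2.
  by have := sqr_ge0 (a * d - c * b); nra.
nra.
Qed.

Lemma HnormD m f g : Hspace m f -> Hspace m g ->
  Hnorm m (fun x => f x + g x) <= Hnorm m f + Hnorm m g.
Proof.
elim: m f g => [|m IH] f g Hf Hg.
  by rewrite !Hnorm0; apply: L2norm_triangle; exact/Hspace0.
have [f' [ff' Hf']] := Hspace_wderiv Hf; have [g' [gg' Hg']] := Hspace_wderiv Hg.
have Lf := Hspace_L2 Hf; have Lg := Hspace_L2 Hg.
have Lf' := Hspace_L2 Hf'; have Lg' := Hspace_L2 Hg'.
have h1 := L2norm_triangle Lf Lg; have h2 := IH _ _ Hf' Hg'.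
rewrite -(@ler_pXn2r _ 2) ?nnegrE ?addr_ge0 ?Hnorm_ge0//.
rewrite sqrrD (HnormS m (L2D Lf' Lg') (is_wderivD Lf Lg Lf' Lg' ff' gg')).
rewrite (HnormS m Lf' ff') (HnormS m Lg' gg').
have a0 := L2norm_ge0 f; have b0 := L2norm_ge0 g.
have c0 := Hnorm_ge0 m f'; have d0 := Hnorm_ge0 m g'.
have p0 := Hnorm_ge0 m.+1 f; have q0 := Hnorm_ge0 m.+1 g.
have s0 := L2norm_ge0 (fun x => f x + g x).
have t0 := Hnorm_ge0 m (fun x => f' x + g' x).
exact: (sqr_minkowski h1 h2 (HnormS m Lf' ff') (HnormS m Lg' gg') a0 b0 c0 d0 p0 q0 s0 t0).
Qed.

Lemma HnormZ m c f : Hspace m f -> Hnorm m (fun x => c * f x) = `|c| * Hnorm m f.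
Proof.
elim: m f => [|m IH] f Hf.
  by rewrite !Hnorm0 L2normZ//; exact/Hspace0.
have [f' [ff' Hf']] := Hspace_wderiv Hf.
have Lf := Hspace_L2 Hf; have Lf' := Hspace_L2 Hf'.
apply/eqP; rewrite -(@eqrXn2 _ 2) ?mulr_ge0 ?Hnorm_ge0//.
rewrite exprMn (HnormS m (L2Z c Lf') (is_wderivZ c Lf Lf' ff')) (HnormS m Lf' ff').
by rewrite L2normZ// IH// !exprMn mulrDr.
Qed.

End sobolev.

(** * Product rule for weak derivatives and duality in [L2] *)

Section wderiv_product.
Context {R : realType}.
Implicit Types (f g h w q : R -> R) (c M : R).

(** If [q] is [C1], then [q * h] is again a test function, and the identity for [f] against it is
    the product rule. *)
Lemma is_wderivM_C1 f g q : L2 f -> L2 g -> is_wderiv f g -> C1 q -> periodic q 1 ->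
  is_wderiv (fun x => f x * q x) (fun x => g x * q x + f x * derive1 q x).
Proof.
move=> Lf Lg fg cq pq h ph ch.
have [cqh dqh] := C1M cq ch.
have pqh : periodic (fun x => q x * h x) 1 by move=> x; rewrite pq ph.
have := is_wderiv_ip fg pqh cqh; rewrite dqh.
have Lh := C1_L2 ch ph; have Lh' := C1_L2_derive1 ch ph.
have Lq' := C1_L2_derive1 cq pq; have Lq := C1_L2 cq pq.
have cq' : continuous (derive1 q) by case: cq.
have ch' : continuous (derive1 h) by case: ch.
have cq0 : continuous q by exact: C1_continuous.
have ch0 : continuous h by exact: C1_continuous.
have L1 : L2 (fun x => derive1 q x * h x).
  apply: L2_cont; first by move=> x; apply: cvgM; [exact: cq'|exact: ch0].
  by move=> x; rewrite (periodic_derive1 cq pq) ph.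
have L2' : L2 (fun x => q x * derive1 h x).
  apply: L2_cont; first by move=> x; apply: cvgM; [exact: cq0|exact: ch'].
  by move=> x; rewrite (periodic_derive1 ch ph) pq.
have L3 : L2 (fun x => q x * h x) by exact: C1_L2.
rewrite ipDr// => /eqP; rewrite eq_sym -subr_eq eq_sym => /eqP H.
have -> : \int[lebesgue_measure]_(x in `[0, 1]) (f x * q x * derive1 h x) = ip f (fun x => q x * derive1 h x).
  by apply: eq_Rintegral => x _; rewrite mulrA.
have -> : \int[lebesgue_measure]_(x in `[0, 1]) ((g x * q x + f x * derive1 q x) * h x) =
   ip g (fun x => q x * h x) + ip f (fun x => derive1 q x * h x).
  rewrite /ip -RintegralD//; [|exact: L2_integM..].
  by apply: eq_Rintegral => x _; ring.
by rewrite H; ring.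
Qed.

Lemma is_wderivM f f' g g' : L2 f -> L2 f' -> L2 g -> L2 g' ->
  continuous f -> continuous g -> is_wderiv f f' -> is_wderiv g g' ->
  is_wderiv (fun x => f x * g x) (fun x => f' x * g x + f x * g' x).
Proof.
move=> Lf Lf' Lg Lg' cf cg ff' gg'.
have [pf mf _] := Lf; have [pg mg _] := Lg.
have [M fM] := per_bounded cf pf; have [K gK] := per_bounded cg pg.
have M0 : 0 <= M by exact: le_trans (fM 0).
have Lfg : L2 (fun x => f x * g x) by exact: L2Mb gK.
have L1 : L2 (fun x => f' x * g x) by exact: L2Mb gK.
have L2' : L2 (fun x => g' x * f x) by exact: L2Mb fM.
have Lfg' : L2 (fun x => f x * g' x) by under eq_fun do rewrite mulrC.
apply: is_wderiv_closed => //; first exact: L2D.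
move=> e e0.
pose D := L2norm f' + M + L2norm f + 1.
have D0 : 0 < D by rewrite ltr_wpDl// !addr_ge0// L2norm_ge0.
have d0 : 0 < e / D / 2 by rewrite !divr_gt0.
have [q [pq cq gq gq']] := H1_approx cg Lg Lg' gg' d0.
have cq0 : continuous q by exact: C1_continuous.
have mq := continuous_measurable_fun cq0.
have [Kq qK] := per_bounded cq0 pq.
have Lq := C1_L2 cq pq; have Lq' := C1_L2_derive1 cq pq.
have L3 : L2 (fun x => f x * q x) by exact: L2Mb qK.
have L4 : L2 (fun x => f' x * q x) by exact: L2Mb qK.
have L5 : L2 (fun x => derive1 q x * f x) by exact: L2Mb fM.
have L5' : L2 (fun x => f x * derive1 q x) by under eq_fun do rewrite mulrC.
have pd : periodic (fun x => g x - q x) 1 by move=> x; rewrite pg pq.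
have md : measurable_fun setT (fun x => g x - q x) by exact: measurable_funB.
have De : e / D / 2 * D = e / 2 by field; rewrite gt_eqF.
have e2 : e / 2 < e by rewrite ltr_pdivrMr// ltr_pMr// ltr1n.
have n1 := L2norm_ge0 f'; have n2 := L2norm_ge0 f.
exists (fun x => f x * q x), (fun x => f' x * q x + f x * derive1 q x); split => //.
- exact: L2D.
- exact: is_wderivM_C1.
- have -> : (fun x => f x * g x - f x * q x) = (fun x => f x * (g x - q x)).
    by apply/funext => x; ring.
  apply: (le_lt_trans (L2normMb Lf pd md gq)); apply: le_lt_trans e2.
  rewrite -De ler_wpM2l ?ltW// /D; lra.
- have -> : (fun x => f' x * g x + f x * g' x - (f' x * q x + f x * derive1 q x)) =
      (fun x => f' x * (g x - q x) + (g' x - derive1 q x) * f x).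
    by apply/funext => x; ring.
  apply: (le_lt_trans (L2norm_triangle _ _)).
  + exact: L2Mb gq.
  + by apply: L2Mb fM => //; exact: L2B.
  apply: le_lt_trans e2; rewrite -De.
  have h1 := L2normMb Lf' pd md gq.
  have h2 := L2normMb (L2B Lg' Lq') pf mf fM.
  apply: (le_trans (lerD h1 h2)).
  apply: (@le_trans _ _ (e / D / 2 * L2norm f' + M * (e / D / 2))).
    by rewrite lerD2l ler_wpM2l.
  rewrite [M * _]mulrC -mulrDr ler_wpM2l ?ltW// /D; lra.
Qed.

(** Tests [f] against a [C1] function [q] close to [f] itself. It recovers norm bounds for weak
    derivatives, which are accessible only through pairings. *)
Lemma L2_dual f (K : R) : L2 f -> 0 <= K ->
  (forall h, periodic h 1 -> C1 h -> `|ip f h| <= K * L2norm h) -> L2norm f <= K.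
Proof.
move=> Lf K0 H; have [->//|n0] := eqVneq (L2norm f) 0.
have np : 0 < L2norm f by rewrite lt0r n0 L2norm_ge0.
apply/ler_addgt0Pl => e e0.
(* Chosen so that the two errors, [K * d] from the norm of [q] and [L2norm f * d] from [f - q], add
   up to at most [e * L2norm f]. *)
pose d := Num.min 1 e * L2norm f / (K + L2norm f + 1).
have D0 : 0 < K + L2norm f + 1 by rewrite ltr_wpDl// addr_ge0// ltW.
have m0 : 0 < Num.min 1 e by rewrite lt_min ltr01.
have d0 : 0 < d by rewrite divr_gt0// mulr_gt0.
have [q [pq cq fq]] := C1_dense Lf d0.
have Lq := C1_L2 cq pq.
have h1 := H q pq cq.
have h2 := Cauchy_Schwarz Lf (L2B Lf Lq).
have h3 : L2norm q <= L2norm f + d.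
  have := L2norm_triangle (L2B Lq Lf) Lf.
  under [X in L2norm X <= _]eq_fun do rewrite subrK.
  by move=> /le_trans; apply; rewrite addrC lerD2l L2normBC ltW.
rewrite -(ler_pM2r np) -expr2 L2norm_sq.
have -> : ip f f = ip f q + ip f (fun x => f x - q x) by rewrite ipBr//; ring.
have -> : (e + K) * L2norm f = K * (L2norm f) + e * L2norm f by ring.
have dE : d * (K + L2norm f + 1) = Num.min 1 e * L2norm f by rewrite /d mulfVK// gt_eqF.
have me : Num.min 1 e * L2norm f <= e * L2norm f by rewrite ler_pM2r// ge_min lexx orbT.
have h4 : K * L2norm q <= K * (L2norm f + d) by exact: ler_wpM2l.
have h5 : L2norm f * L2norm (fun x => f x - q x) <= L2norm f * d.
  by rewrite ler_pM2l// ltW.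
have h6 := ler_norm (ip f q); have h7 := ler_norm (ip f (fun x => f x - q x)).
move: h1 h2 h4 h5 h6 h7 dE me d0 np.
set a := ip f q; set b := ip f _; set n := L2norm f; set x := L2norm q; set y := L2norm _.
set z := Num.min 1 e * n; move=> *; nra.
Qed.

End wderiv_product.

(** * Curves in Sobolev spaces *)

Section curves.
Context {R : realType}.
Variable T : \bar R.
Implicit Types (v w : R -> R -> R) (m : nat) (t s : R).

Local Notation near_t t := (within (lifespan T) (nbhs (t : R))).

Lemma nonneg_cvg0P (F : set_system R) (FF : Filter F) (f : R -> R) :
  (forall s, 0 <= f s) ->
  (f @ F --> (0 : R)) <-> (forall e : R, 0 < e -> \forall s \near F, f s <= e).
Proof.
move=> f0; split => [/cvgrPdist_le H e e0|H].
  by apply: filterS (H e e0) => s; rewrite sub0r normrN ger0_norm.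
apply/cvgrPdist_le => e e0; apply: filterS (H e e0) => s.
by rewrite sub0r normrN ger0_norm.
Qed.

Lemma near_withinI (A : set R) t (P : set R) :
  (\forall s \near within A (nbhs t), P s) -> \forall s \near within A (nbhs t), A s /\ P s.
Proof. by rewrite !near_withinE; apply: filterS => s /[swap] As /(_ As). Qed.

(** The membership [lifespan T s] is recorded along with the estimate, since nothing is known about
    [v s] at other times. *)
Lemma C0_in_HP m v : C0_in_H m T v <->
  (forall t, lifespan T t -> Hspace m (v t)) /\
  forall t, lifespan T t -> forall e : R, 0 < e ->
    \forall s \near near_t t, lifespan T s /\ Hnorm m (fun x => v s x - v t x) <= e.
Proof.
split=> -[H1 H2]; split => // t Tt.
  move=> e e0; apply: near_withinI; have /nonneg_cvg0P := H2 t Tt; apply => //.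
  by move=> s; exact: Hnorm_ge0.
apply/nonneg_cvg0P; first by move=> s; exact: Hnorm_ge0.
by move=> e e0; apply: filterS (H2 t Tt e e0) => s [].
Qed.

Lemma C0_in_HW m v : C0_in_H m.+1 T v -> C0_in_H m T v.
Proof.
move=> /C0_in_HP[H1 H2]; apply/C0_in_HP; split => t Tt; first exact: HspaceW (H1 t Tt).
move=> e e0; apply: filterS (H2 t Tt e e0) => s [Ts H]; split => //.
exact: le_trans (Hnorm_mono _ _) H.
Qed.

Lemma C0_in_H_le m n v : (n <= m)%N -> C0_in_H m T v -> C0_in_H n T v.
Proof.
move=> /subnK <-; elim: (m - n)%N => [|k IH]; first by rewrite add0n.
by rewrite addSn => /C0_in_HW.
Qed.

(** The way to climb one order: all later closure properties exhibit a weak derivative of a known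
    form and apply induction to it. *)
Lemma C0_in_H_intro m v w : C0_in_H 0 T v ->
  (forall t, lifespan T t -> continuous (v t)) ->
  (forall t, lifespan T t -> is_wderiv (v t) (w t)) ->
  C0_in_H m T w -> C0_in_H m.+1 T v.
Proof.
move=> /C0_in_HP[V1 V2] cv vw /C0_in_HP[W1 W2]; apply/C0_in_HP; split => t Tt.
  apply: (Hspace_intro (g := w t)); [exact/Hspace0/V1|exact: cv|exact: vw|exact: W1].
move=> e e0; have e20 : 0 < e / 2 by rewrite divr_gt0.
apply: filterS2 (V2 t Tt _ e20) (W2 t Tt _ e20) => s [Ts h1] [_ h2]; split => //.
have L s' : lifespan T s' -> L2 (v s') /\ L2 (w s').
  by move=> Ts'; split; [exact/Hspace0/V1|exact: Hspace_L2 (W1 _ Ts')].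
have [Lvs Lws] := L s Ts; have [Lvt Lwt] := L t Tt.
have := HnormS_le m (L2B Lws Lwt) (is_wderivB Lvs Lvt Lws Lwt (vw s Ts) (vw t Tt)).
move=> /le_trans; apply; rewrite [leRHS](splitr e); apply: lerD => //.
by rewrite -Hnorm0.
Qed.

Lemma C0_in_H_wderiv m v : C0_in_H m.+1 T v ->
  exists w, (forall t, lifespan T t -> is_wderiv (v t) (w t)) /\ C0_in_H m T w.
Proof.
move=> /C0_in_HP[H1 H2].
have /choice [w Hw] : forall t, exists g, lifespan T t -> is_wderiv (v t) g /\ Hspace m g.
  move=> t; have [Tt|nTt] := pselect (lifespan T t).
    by have [g [? ?]] := Hspace_wderiv (H1 t Tt); exists g.
  by exists (fun=> 0) => /nTt.
exists w; split; first by move=> t /Hw[].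
apply/C0_in_HP; split => t Tt; first by have [] := Hw t Tt.
move=> e e0; apply: filterS (H2 t Tt e e0) => s [Ts H]; split => //; apply: le_trans H.
have [ws Hs] := Hw s Ts; have [wt Ht] := Hw t Tt.
have Ls := Hspace_L2 Hs; have Lt := Hspace_L2 Ht.
apply: HnormS_ge; first exact: L2B.
by apply: is_wderivB => //; [exact: Hspace_L2 (H1 s Ts)|exact: Hspace_L2 (H1 t Tt)].
Qed.

Lemma C0_in_H_derive1 m v : C0_in_H m.+2 T v -> C0_in_H m.+1 T (fun t => derive1 (v t)).
Proof.
move=> /C0_in_HP[H1 H2]; apply/C0_in_HP; split => t Tt; first by have [] := Hspace_C1 (H1 t Tt).
move=> e e0; apply: filterS (H2 t Tt e e0) => s [Ts H]; split => //; apply: le_trans H.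
have [cs ws Hs] := Hspace_C1 (H1 s Ts); have [ct wt Ht] := Hspace_C1 (H1 t Tt).
have Ls := Hspace_L2 Hs; have Lt := Hspace_L2 Ht.
apply: HnormS_ge; first exact: L2B.
by apply: is_wderivB => //; [exact: Hspace_L2 (H1 s Ts)|exact: Hspace_L2 (H1 t Tt)].
Qed.

Lemma C0_in_HD m v w : C0_in_H m T v -> C0_in_H m T w ->
  C0_in_H m T (fun t x => v t x + w t x).
Proof.
move=> /C0_in_HP[V1 V2] /C0_in_HP[W1 W2]; apply/C0_in_HP; split => t Tt.
  by apply: HspaceD; [exact: V1|exact: W1].
move=> e e0; have e20 : 0 < e / 2 by rewrite divr_gt0.
apply: filterS2 (V2 t Tt _ e20) (W2 t Tt _ e20) => s [Ts h1] [_ h2]; split => //.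
have -> : (fun x => v s x + w s x - (v t x + w t x)) = (fun x => (v s x - v t x) + (w s x - w t x)).
  by apply/funext => x; ring.
apply: (le_trans (HnormD (HspaceB (V1 s Ts) (V1 t Tt)) (HspaceB (W1 s Ts) (W1 t Tt)))).
by rewrite [leRHS](splitr e); apply: lerD.
Qed.

Lemma C0_in_H_scale m (c : R -> R) (f : R -> R) : Hspace m f ->
  (forall t, lifespan T t -> {for t, continuous c}) -> C0_in_H m T (fun t x => c t * f x).
Proof.
move=> Hf cc; apply/C0_in_HP; split => t Tt; first exact: HspaceZ.
move=> e e0; apply: near_withinI; apply: cvg_within.
have D0 : 0 < Hnorm m f + 1 by rewrite ltr_wpDl// Hnorm_ge0.
have d0 : 0 < e / (Hnorm m f + 1) by rewrite divr_gt0.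
have /cvgrPdist_le/(_ _ d0) := cc t Tt; apply: filterS => s h.
have -> : (fun x => c s * f x - c t * f x) = (fun x => (c s - c t) * f x).
  by apply/funext => x; ring.
rewrite HnormZ// distrC.
apply: (@le_trans _ _ (e / (Hnorm m f + 1) * (Hnorm m f + 1))); last by rewrite mulfVK// gt_eqF.
by apply: ler_pM => //; [exact: Hnorm_ge0|rewrite lerDl].
Qed.

Lemma C0_in_H_cst m (f : R -> R) : Hspace m f -> C0_in_H m T (fun _ => f).
Proof.
move=> Hf; have := C0_in_H_scale (c := fun=> 1) Hf _.
under [X in C0_in_H _ _ X]eq_fun do under eq_fun do rewrite mul1r.
by apply => t _; exact: cvg_cst.
Qed.

End curves.

(** * Products and reciprocals of curves *)

Section curve_products.
Context {R : realType}.
Variable T : \bar R.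
Implicit Types (v w : R -> R -> R) (m : nat) (t s : R).

Local Notation near_t t := (within (lifespan T) (nbhs (t : R))).

(** Continuity in the supremum norm, which controls products with merely square-integrable factors;
    curves in [H^1] have it by Sobolev embedding. *)
Definition C0_unif v :=
  (forall t, lifespan T t -> continuous (v t) /\ periodic (v t) 1) /\
  forall t, lifespan T t -> forall e : R, 0 < e ->
    \forall s \near near_t t, lifespan T s /\ forall x, `|v s x - v t x| <= e.

Lemma C0_in_H_unif m v : C0_in_H m.+1 T v -> C0_unif v.
Proof.
move=> /C0_in_HP[V1 V2]; split => t Tt.
  by split; [exact: Hspace_cont (V1 t Tt)|exact: Hspace_per (V1 t Tt)].
move=> e e0; have e30 : 0 < e / 3 by rewrite divr_gt0.
apply: filterS (V2 t Tt _ e30) => s [Ts h]; split => // x.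
apply: (le_trans (Hspace_sup x (HspaceB (V1 s Ts) (V1 t Tt)))).
by rewrite mulrC -ler_pdivlMr.
Qed.

Lemma C0_unif_bounded v t : C0_unif v -> lifespan T t -> exists2 M, 0 < M &
  forall x, `|v t x| <= M.
Proof.
move=> [V1 _] Tt; have [cv pv] := V1 t Tt; have [M vM] := per_bounded cv pv.
by exists (M + 1) => [|x]; [rewrite ltr_wpDl// (le_trans _ (vM 0))|rewrite (le_trans (vM x))// lerDl].
Qed.

Lemma C0_unif_L2 v t : C0_unif v -> lifespan T t -> L2 (v t).
Proof. by move=> [V1 _] Tt; have [cv pv] := V1 t Tt; exact: L2_cont. Qed.

Lemma C0_unif_H0 v : C0_unif v -> C0_in_H 0 T v.
Proof.
move=> cu; have [V1 V2] := cu; apply/C0_in_HP; split => t Tt.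
  by apply/Hspace0; exact: C0_unif_L2.
move=> e e0; apply: filterS (V2 t Tt e e0) => s [Ts h]; split => //.
rewrite Hnorm0; apply: L2norm_sup => //.
by apply: L2B; exact: C0_unif_L2.
Qed.

Lemma prod_dist (a b c d M K z : R) : `|c| <= M -> `|d| <= K ->
  `|a - c| <= z -> `|b - d| <= z -> z <= 1 -> `|a * b - c * d| <= z * (K + 1 + M).
Proof.
move=> cM dK ac bd z1.
have -> : a * b - c * d = (a - c) * b + c * (b - d) by ring.
have bK : `|b| <= K + 1.
  have -> : b = (b - d) + d by ring.
  by apply: (le_trans (ler_normD _ _)); rewrite addrC lerD// (le_trans bd).
apply: (le_trans (ler_normD _ _)); rewrite !normrM [leRHS]mulrDr.
by apply: lerD; [|rewrite mulrC]; apply: ler_pM.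
Qed.

Lemma C0_unifM v w : C0_unif v -> C0_unif w -> C0_unif (fun t x => v t x * w t x).
Proof.
move=> uv uw; have [V1 V2] := uv; have [W1 W2] := uw; split => t Tt.
  have [cv pv] := V1 t Tt; have [cw pw] := W1 t Tt; split.
    by move=> x; apply: cvgM; [exact: cv|exact: cw].
  by move=> x; rewrite pv pw.
move=> e e0.
have [M M0 vM] := C0_unif_bounded uv Tt; have [K K0 wK] := C0_unif_bounded uw Tt.
have D0 : 0 < K + 1 + M by rewrite !addr_gt0.
pose z := Num.min 1 (e / (K + 1 + M)).
have z0 : 0 < z by rewrite lt_min ltr01 divr_gt0.
apply: filterS2 (V2 t Tt _ z0) (W2 t Tt _ z0) => s [Ts h1] [_ h2]; split => // x.
apply: (le_trans (prod_dist (vM x) (wK x) (h1 x) (h2 x) _)); first by rewrite ge_min lexx.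
by rewrite -ler_pdivlMr// ge_min lexx orbT.
Qed.

Lemma C0_in_HM0 v w : C0_in_H 0 T v -> C0_unif w -> C0_in_H 0 T (fun t x => v t x * w t x).
Proof.
move=> /C0_in_HP[V1 V2] uw; have [W1 W2] := uw.
have meas t : lifespan T t -> measurable_fun setT (w t).
  by move=> Tt; have [cw pw] := W1 t Tt; exact: continuous_measurable_fun.
have per t : lifespan T t -> periodic (w t) 1 by move=> Tt; have [cw pw] := W1 t Tt.
have LV t : lifespan T t -> L2 (v t) by move=> Tt; exact/Hspace0/V1.
apply/C0_in_HP; split => t Tt.
  have [K K0 wK] := C0_unif_bounded uw Tt.
  by apply/Hspace0; apply: L2Mb wK; [exact: LV|exact: per|exact: meas].
move=> e e0.
have [K K0 wK] := C0_unif_bounded uw Tt.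
pose M := L2norm (v t).
have M0 : 0 <= M by exact: L2norm_ge0.
have D0 : 0 < K + 1 + M by rewrite ltr_wpDr// addr_gt0.
pose z := Num.min 1 (e / (K + 1 + M)).
have z0 : 0 < z by rewrite lt_min ltr01 divr_gt0.
apply: filterS2 (V2 t Tt _ z0) (W2 t Tt _ z0) => s [Ts h1] [_ h2]; split => //.
rewrite Hnorm0 in h1; rewrite Hnorm0.
have -> : (fun x => v s x * w s x - v t x * w t x) =
    (fun x => (v s x - v t x) * w s x + v t x * (w s x - w t x)).
  by apply/funext => x; ring.
have wK' x : `|w s x| <= K + 1.
  have -> : w s x = (w s x - w t x) + w t x by ring.
  apply: (le_trans (ler_normD _ _)); rewrite addrC lerD// (le_trans (h2 x))//.
  by rewrite ge_min lexx.
have Ld := L2B (LV s Ts) (LV t Tt).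
have pd : periodic (fun x => w s x - w t x) 1 by move=> x; rewrite !per.
have md : measurable_fun setT (fun x => w s x - w t x).
  by apply: measurable_funB; exact: meas.
have T1 := L2norm_triangle (L2Mb Ld (per s Ts) (meas s Ts) wK') (L2Mb (LV t Tt) pd md h2).
apply: (le_trans T1).
apply: (le_trans (lerD (L2normMb Ld (per s Ts) (meas s Ts) wK') (L2normMb (LV t Tt) pd md h2))).
apply: (@le_trans _ _ (z * (K + 1 + M))).
  rewrite mulrDr lerD// mulrC ler_wpM2r// addr_ge0// ltW//.
by rewrite -ler_pdivlMr// ge_min lexx orbT.
Qed.

(** Induction by the product rule. The order [maxn m 1] keeps the second factor continuous even when
    the first is only in [L2]. *)
Lemma C0_in_HM m v w : C0_in_H m T v -> C0_in_H (maxn m 1) T w ->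
  C0_in_H m T (fun t x => v t x * w t x).
Proof.
elim: m v w => [|m IH] v w Hv Hw.
  by apply: C0_in_HM0 => //; exact: C0_in_H_unif Hw.
have {}Hw : C0_in_H m.+1 T w by rewrite (maxn_idPl _) in Hw.
have [v' [vv' Hv']] := C0_in_H_wderiv Hv; have [w' [ww' Hw']] := C0_in_H_wderiv Hw.
have uv := C0_in_H_unif Hv; have uw := C0_in_H_unif Hw.
have Lt u n t : C0_in_H n T u -> lifespan T t -> L2 (u t).
  by move=> /C0_in_HP[U _] Tt; exact: Hspace_L2 (U t Tt).
apply: (C0_in_H_intro (w := fun t x => v' t x * w t x + v t x * w' t x)).
- exact/C0_unif_H0/C0_unifM.
- by have [U _] := C0_unifM uv uw; move=> t /U[].
- move=> t Tt; apply: is_wderivM.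
  + exact: Lt Hv Tt.
  + exact: Lt Hv' Tt.
  + exact: Lt Hw Tt.
  + exact: Lt Hw' Tt.
  + by have [U _] := uv; have [] := U t Tt.
  + by have [U _] := uw; have [] := U t Tt.
  + exact: vv'.
  + exact: ww'.
- apply: C0_in_HD.
    by apply: IH => //; apply: C0_in_H_le Hw; rewrite geq_max leqnSn.
  (* Here the derivative falls on [w], so [v] is the more regular factor and has to come second. *)
  under [X in C0_in_H _ _ X]eq_fun do under eq_fun do rewrite mulrC.
  by apply: IH => //; apply: C0_in_H_le Hv; rewrite geq_max leqnSn.
Qed.

Lemma per_min (f : R -> R) : continuous f -> periodic f 1 -> (forall x : R, 0 < f x) ->
  exists2 c, 0 < c & forall x : R, c <= f x.
Proof.
move=> cf pf f0; have cn : {within `[0, 1], continuous f} by exact: continuous_subspaceT.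
have [c _ fc] := EVT_min ler01 cn; exists (f c) => // x.
have [y /andP[y0 y1] ->] := per_frac x pf.
by apply: fc; rewrite in_itv/= y0 ltW.
Qed.

Lemma C0_unifV v : C0_unif v -> (forall t x, lifespan T t -> 0 < v t x) ->
  C0_unif (fun t x => (v t x)^-1).
Proof.
move=> [V1 V2] v0; split => t Tt; have [cv pv] := V1 t Tt.
  split; last by move=> x; rewrite pv.
  by move=> x; apply: cvgV; [rewrite gt_eqF// v0|exact: cv].
move=> e e0; have [c c0 vc] := per_min cv pv (fun x => v0 t x Tt).
(* The first bound keeps [v s] above [c / 2]; then the product of the two denominators is at least
   [c * c / 2], which explains the second. *)
pose z := Num.min (c / 2) (e * (c * c / 2)).
have z0 : 0 < z by rewrite lt_min !mulr_gt0// ?invr_gt0.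
apply: filterS (V2 t Tt _ z0) => s [Ts h]; split => // x.
have h1 : `|v s x - v t x| <= c / 2 by rewrite (le_trans (h x))// ge_min lexx.
have h2 : `|v s x - v t x| <= e * (c * c / 2) by rewrite (le_trans (h x))// ge_min lexx orbT.
have vt := v0 t x Tt; have vs := v0 s x Ts; have vtc := vc x.
have vsc : c / 2 <= v s x by move: h1; rewrite ler_norml => /andP[]; lra.
have -> : (v s x)^-1 - (v t x)^-1 = - (v s x - v t x) / (v s x * v t x).
  by field; rewrite !gt_eqF.
rewrite normrM normrN normfV ler_pdivrMr ?normr_gt0 ?mulf_neq0 ?gt_eqF//.
rewrite (ger0_norm (ltW (mulr_gt0 vs vt))); apply: (le_trans h2).
rewrite ler_pM2l// -mulrA [c * _]mulrC; apply: ler_pM => //; rewrite ?ltW//.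
by rewrite divr_gt0.
Qed.

(** Induction on the order through the derivative [- v' / v ^ 2]. From [2 <= m] the function [v t]
    is [C1], so this is a classical derivative, and [v'] is continuous already when [n = 0]. *)
Lemma C0_in_HV m v : C0_in_H m T v -> (2 <= m)%N ->
  (forall t x, lifespan T t -> 0 < v t x) ->
  forall n, (n <= m)%N -> C0_in_H n T (fun t x => (v t x)^-1).
Proof.
move=> Hv m2 v0; have uv : C0_unif v.
  by apply: (@C0_in_H_unif 0); apply: C0_in_H_le Hv; exact: ltnW.
have uV := C0_unifV uv v0.
have Hv2 : C0_in_H 2 T v by exact: C0_in_H_le Hv.
elim => [|n IH] nm; first exact: C0_unif_H0.
have Hv' : C0_in_H (maxn n 1) T (fun t => derive1 (v t)).
  have : C0_in_H (maxn n 1).+1 T v.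
    by apply: C0_in_H_le Hv; rewrite gtn_max nm.
  by rewrite maxnE; case: n {IH nm} => [|n] /=; exact: C0_in_H_derive1.
have D t x : lifespan T t ->
    is_derive (x : R) 1 (fun x => (v t x)^-1) (- (derive1 (v t) x * ((v t x)^-1 * (v t x)^-1))).
  move=> Tt; have /C0_in_HP[H _] := Hv2; have [cv _ _] := Hspace_C1 (H t Tt).
  have := is_deriveV (lt0r_neq0 (v0 t x Tt)) (C1_isd x cv).
  apply: isd_eq => //; rewrite -[_ *: _]/(_ * _) -exprVn expr2; ring.
have C t : lifespan T t -> C1 (fun x => (v t x)^-1) /\
    derive1 (fun x => (v t x)^-1) = (fun x => - (derive1 (v t) x * ((v t x)^-1 * (v t x)^-1))).
  move=> Tt; apply: isd_C1; first by move=> x; exact: D.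
  have [U _] := C0_unifM (C0_in_H_unif (C0_in_H_derive1 Hv2)) (C0_unifM uV uV).
  by have [ct _] := U t Tt; move=> x; apply: cvgN; exact: ct.
have P t : lifespan T t -> periodic (fun x => (v t x)^-1) 1.
  by move=> Tt; have [U _] := uV; have [] := U t Tt.
apply: (C0_in_H_intro (w := fun t x => -1 * (derive1 (v t) x * ((v t x)^-1 * (v t x)^-1)))).
- exact: C0_unif_H0.
- by move=> t Tt; apply: C1_continuous; have [] := C t Tt.
- move=> t Tt; have [c1 d1] := C t Tt; have := C1_wderiv c1 (P t Tt); rewrite d1.
  by under [X in is_wderiv _ X]eq_fun do rewrite -mulN1r.
- have cN n' : C0_in_H n' T (fun _ _ => -1) by apply: C0_in_H_cst; exact: Hspace_cst.
  under [X in C0_in_H _ _ X]eq_fun do under eq_fun do rewrite mulrC.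
  apply: C0_in_HM; last exact: cN.
  case: n IH nm Hv' => [|n] IH nm Hv'.
    by apply: C0_in_HM0; [exact: C0_in_H_le Hv'|exact: C0_unifM].
  have {}Hv' : C0_in_H n.+1 T (fun t => derive1 (v t)) by rewrite (maxn_idPl _) in Hv'.
  have {}IH := IH (ltnW nm).
  have e1 : maxn n.+1 1 = n.+1 by apply/maxn_idPl.
  have I2 : C0_in_H n.+1 T (fun t x => (v t x)^-1 * (v t x)^-1).
    by apply: (C0_in_HM IH); rewrite e1.
  by apply: (C0_in_HM Hv'); rewrite e1.
Qed.

End curve_products.

Section static_product.
Context {R : realType}.
Implicit Types (f g : R -> R) (m : nat).

(** The case of curves that are constant in time, read off at time 0. *)
Lemma HspaceM m f g : Hspace m f -> Hspace (maxn m 1) g -> Hspace m (fun x => f x * g x).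
Proof.
move=> Hf Hg.
have /C0_in_HP[H _] := C0_in_HM (C0_in_H_cst +oo%E Hf) (C0_in_H_cst +oo%E Hg).
by apply: (H 0); split => //; rewrite ltry.
Qed.
End static_product.

(** * Time derivatives of curves *)

Section time_derivative.
Context {R : realType}.
Variable T : \bar R.
Implicit Types (v w : R -> R -> R) (F : R -> R) (m : nat) (t s : R).

Local Notation near_t t := (within (lifespan T) (nbhs (t : R))).
Local Notation near'_t t := (within (lifespan T `\ (t : R)) (nbhs (t : R))).

Lemma cvg0_near (A : set R) t (f : R -> R) (e : R) :
  f @ within A (nbhs t) --> (0 : R) -> 0 < e -> \forall s \near within A (nbhs t), f s <= e.
Proof.
move=> /cvgrPdist_le H e0; apply: filterS (H e e0) => s.
by rewrite sub0r normrN; exact: le_trans (ler_norm _).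
Qed.

Definition tcontinuous F := forall t, lifespan T t -> F @ near_t t --> F t.

Lemma near_lifespan t : 0 < t -> (t%:E < T)%E -> \forall s \near t, lifespan T s.
Proof.
move=> t0 tT.
have h0 : \forall s \near t, 0 < s by exact: lt_nbhsr.
have [b tb bT] : exists2 b : R, t < b & forall s, s < b -> (s%:E < T)%E.
  case: T tT => [r| |]// tT.
    by exists r => // s; rewrite lte_fin.
  by exists (t + 1); [rewrite ltrDl|move=> s _; rewrite ltry].
have h1 : \forall s \near t, s < b by exact: lt_nbhsl.
by apply: filterS2 h0 h1 => s s0 /bT sT; split => //; exact: ltW.
Qed.

Lemma lifespan_between s t r : lifespan T s -> lifespan T t -> s <= r <= t -> lifespan T r.
Proof.
move=> [s0 _] [_ tT] /andP[sr rt]; split; first exact: le_trans sr.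
by apply: le_lt_trans tT; rewrite lee_fin.
Qed.

(** Around an interior time a whole neighbourhood lies in the lifespan, so the restriction built
    into [is_tderiv] disappears and the ordinary rules of differentiation apply. *)
Lemma is_tderiv_isd F t l : 0 < t -> (t%:E < T)%E -> is_tderiv T F t l ->
  is_derive t 1 F l.
Proof.
move=> t0 tT Fl.
have H : (fun h : R => h^-1 *: ((F \o shift t) (h *: (1 : R)) - F t)) @ 0^' --> l.
  apply/cvgrPdist_le => e e0.
  move/cvgrPdist_le/(_ _ e0) : Fl; rewrite near_withinE => Fl.
  move: Fl => /nbhs_ballP[d2 /= d20 Hd2].
  have := near_lifespan t0 tT => /nbhs_ballP[d1 /= d10 Hd1].
  rewrite near_withinE; apply/nbhs_ballP; exists (Num.min d1 d2); first by rewrite /= lt_min d10.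
  move=> h; rewrite /ball/= lt_min => /andP[hd1 hd2] h0.
  have hE : h *: (1 : R) + t = h + t by rewrite [_%:A]mulr1.
  have E : t - (h + t) = 0 - h by ring.
  have Ts : lifespan T (h + t) by apply: Hd1; rewrite /ball/= E.
  have := Hd2 (h + t) _ (conj Ts _); rewrite /ball/= E => /(_ hd2); rewrite addrK /= hE -[_^-1 *: _]/(_^-1 * _) mulrC; apply.
  by move=> /= /eqP; rewrite -subr_eq0 addrK; exact/negP.
apply: DeriveDef; first by apply/cvg_ex; exists l.
by apply/cvg_lim.
Qed.

Lemma is_tderiv_tcont F t l : lifespan T t -> is_tderiv T F t l -> F @ near_t t --> F t.
Proof.
move=> Tt /cvgrPdist_le/(_ _ ltr01); rewrite near_withinE => Fl.
apply/cvgrPdist_le => e e0; rewrite near_withinE.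
have D0 : 0 < `|l| + 1 by rewrite ltr_wpDl.
have z0 : 0 < e / (`|l| + 1) by rewrite divr_gt0.
have B : \forall s \near t, `|t - s| < e / (`|l| + 1).
  by apply/nbhs_ballP; exists (e / (`|l| + 1)).
apply: filterS2 Fl B => s H st Ts; have [->|nst] := eqVneq s t; first by rewrite subrr normr0 ltW.
have {}H := H (conj Ts (elimN eqP nst)).
have st0 : s - t != 0 by rewrite subr_eq0.
have h1 : `|(F s - F t) / (s - t)| <= `|l| + 1.
  have -> : (F s - F t) / (s - t) = l - (l - (F s - F t) / (s - t)) by ring.
  by apply: (le_trans (ler_normB _ _)); rewrite lerD2l.
rewrite distrC -(mulfVK st0 (F s - F t)) normrM.
apply: (@le_trans _ _ ((`|l| + 1) * (e / (`|l| + 1)))).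
  by apply: ler_pM => //; rewrite distrC ltW.
by rewrite mulrC mulfVK// gt_eqF.
Qed.

Lemma tmvt F F' s t : tcontinuous F ->
  (forall r, 0 < r -> (r%:E < T)%E -> is_derive r 1 F (F' r)) ->
  lifespan T s -> lifespan T t -> s < t ->
  exists r, [/\ s < r < t, 0 < r, (r%:E < T)%E & F t - F s = F' r * (t - s)].
Proof.
move=> cF dF Ts Tt st; have [s0 sT] := Ts; have [t0 tT] := Tt.
have H r : s < r < t -> 0 < r /\ (r%:E < T)%E.
  move=> /andP[sr rt]; split; first exact: le_lt_trans sr.
  by apply: lt_trans tT; rewrite lte_fin.
have [r|/=|r] := @MVT R F F' s t st.
- by rewrite in_itv/= => /H[r0 rT]; exact: dF.
- apply/subspace_continuousP => x; rewrite /= in_itv/= => sxt.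
  apply: cvg_trans (cF x (lifespan_between Ts Tt sxt)).
  apply: cvg_app; apply: within_subset => y; rewrite /= in_itv/=.
  exact: lifespan_between.
- rewrite in_itv/= => str FE; have [r0 rT] := H r str.
  by exists r.
Qed.

(** The mean value theorem for [s] on either side of [t], in the form suited to difference quotients
    at [t]. *)
Lemma tmvt' F F' s t : tcontinuous F ->
  (forall r, 0 < r -> (r%:E < T)%E -> is_derive r 1 F (F' r)) ->
  lifespan T s -> lifespan T t -> s != t ->
  exists r, [/\ lifespan T r, `|r - t| <= `|s - t| & (F s - F t) / (s - t) = F' r].
Proof.
move=> cF dF Ts Tt st; have [lst|lts] := ltP s t.
  have [r [/andP[sr rt] r0 rT FE]] := tmvt cF dF Ts Tt lst.
  exists r; split; [by split => //; exact: ltW| |].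
    by rewrite !ltr0_norm ?subr_lt0//; lra.
  rewrite -[F s - F t]opprB FE -[s - t]opprB.
  by field; rewrite subr_eq0 gt_eqF.
have {}lts : t < s by rewrite lt_neqAle eq_sym st.
have [r [/andP[tr rs] r0 rT FE]] := tmvt cF dF Tt Ts lts.
exists r; split; [by split => //; exact: ltW| |].
  by rewrite !gtr0_norm ?subr_gt0//; lra.
by rewrite FE mulfK// subr_eq0 gt_eqF.
Qed.

Lemma tderiv0_cst F : tcontinuous F ->
  (forall r, 0 < r -> (r%:E < T)%E -> is_derive r 1 F 0) ->
  forall t, lifespan T t -> F t = F 0.
Proof.
move=> cF dF t Tt; have [t0 tT] := Tt.
move: t0; rewrite le_eqVlt => /predU1P[<-//|t0].
have T0 : lifespan T 0 by split => //; apply: le_lt_trans tT; rewrite lee_fin ltW.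
have [r [_ _ _ /eqP]] := tmvt cF dF T0 Tt t0.
by rewrite mul0r subr_eq0 => /eqP.
Qed.

Definition tdiffL2 v w := forall t, lifespan T t ->
  (fun s => L2norm (fun x => (v s x - v t x) / (s - t) - w t x)) @ near'_t t --> (0 : R).

(** At each [x] the difference quotient equals [w r x] for some [r] between [s] and [t]. This [r]
    depends on [x], but uniform continuity of [w] in time makes that harmless. *)
Lemma tdiffL2_pointwise v w : (forall t, lifespan T t -> L2 (v t)) -> C0_unif T w ->
  (forall t x, lifespan T t -> is_tderiv T (v ^~ x) t (w t x)) -> tdiffL2 v w.
Proof.
move=> Lv uw vw t Tt; apply/nonneg_cvg0P; first by move=> s; exact: L2norm_ge0.
move=> e e0; have [_ W2] := uw; have := W2 t Tt e e0.
rewrite !near_withinE => /nbhs_ballP[d /= d0 Hd].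
apply/nbhs_ballP; exists d => //= s sd [Ts st].
have Q : L2 (fun x => (v s x - v t x) / (s - t)).
  under eq_fun do rewrite mulrC.
  by apply/L2Z/L2B; exact: Lv.
apply: L2norm_sup; first by apply: L2B => //; exact: C0_unif_L2 uw Tt.
move=> x.
have [|||r [Tr rt ->]] := @tmvt' (v ^~ x) (w ^~ x) s t _ _ Ts Tt.
- by move=> r Tr; exact: is_tderiv_tcont Tr (vw r x Tr).
- move=> r r0 rT; apply: is_tderiv_isd => //; apply: vw.
  by split => //; exact: ltW.
- exact/eqP.
have [] := Hd r _ Tr; last by move=> _; exact.
by rewrite /ball/= distrC; apply: le_lt_trans rt _; rewrite distrC.
Qed.

(** Time and space derivatives are interchanged by duality. Against a test function [h], the space
    derivative moves onto [h], so [ip (v' s) h] is differentiable in [s] with derivative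
    [ip (w' s) h]. The mean value theorem turns its difference quotient into [ip (w' r) h], where
    [r] depends on [h]; continuity of [w'] bounds the error by [e * L2norm h] uniformly, and
    [L2_dual] concludes. *)
Lemma tdiffL2_wderiv v w v' w' : tdiffL2 v w ->
  (forall t, lifespan T t -> L2 (v t)) -> (forall t, lifespan T t -> L2 (w t)) ->
  (forall t, lifespan T t -> L2 (v' t)) -> C0_in_H 0 T w' ->
  (forall t, lifespan T t -> is_wderiv (v t) (v' t)) ->
  (forall t, lifespan T t -> is_wderiv (w t) (w' t)) -> tdiffL2 v' w'.
Proof.
move=> vw Lv Lw Lv' /C0_in_HP[W1 W2] dv dw t Tt.
have Lw' s : lifespan T s -> L2 (w' s) by move=> Ts; exact/Hspace0/W1.
apply/nonneg_cvg0P; first by move=> s; exact: L2norm_ge0.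
move=> e e0; have := W2 t Tt e e0.
rewrite !near_withinE => /nbhs_ballP[d /= d0 Hd].
apply/nbhs_ballP; exists d => //= s sd [Ts /eqP st].
have LQ (u : R -> R -> R) r s' : (forall t, lifespan T t -> L2 (u t)) -> lifespan T r -> lifespan T s' -> L2 (fun x => (u s' x - u r x) / (s' - r)).
  move=> Lu Tr Ts'; under eq_fun do rewrite mulrC.
  by apply/L2Z/L2B; exact: Lu.
apply: L2_dual; [by apply: L2B; [exact: LQ|exact: Lw']|exact: ltW|].
move=> h ph ch; have Lh := C1_L2 ch ph; have Lh' := C1_L2_derive1 ch ph.
have D r : lifespan T r -> is_tderiv T (fun s => ip (v' s) h) r (ip (w' r) h).
  move=> Tr; rewrite /is_tderiv; apply/cvgrPdist_le => z z0.
  have zh : 0 < z / (L2norm (derive1 h) + 1).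
    by rewrite divr_gt0// ltr_wpDl// L2norm_ge0.
  have := cvg0_near (vw r Tr) zh; rewrite !near_withinE; apply: filterS => s' H [Ts' s'r].
  have {}H := H (conj Ts' s'r).
  have -> : ip (w' r) h - (ip (v' s') h - ip (v' r) h) / (s' - r) =
      ip (fun x => (v s' x - v r x) / (s' - r) - w r x) (derive1 h).
    rewrite ipBl//; [|exact: LQ|exact: Lw].
    rewrite (is_wderiv_ip (dw r Tr) ph ch).
    have -> : ip (fun x => (v s' x - v r x) / (s' - r)) (derive1 h) = (s' - r)^-1 * (ip (v s') (derive1 h) - ip (v r) (derive1 h)).
      rewrite -ipBl//; [|exact: Lv|exact: Lv].
      rewrite -ipZl//; last by apply: L2B; exact: Lv.
      by apply: eq_Rintegral => x _; rewrite [_^-1 * _]mulrC.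
    by rewrite (is_wderiv_ip (dv s' Ts') ph ch) (is_wderiv_ip (dv r Tr) ph ch); ring.
  apply: (le_trans (Cauchy_Schwarz (L2B (LQ v r s' Lv Tr Ts') (Lw r Tr)) Lh')).
  apply: (@le_trans _ _ (z / (L2norm (derive1 h) + 1) * (L2norm (derive1 h) + 1))).
    by apply: ler_pM => //; [exact: L2norm_ge0|exact: L2norm_ge0|rewrite lerDl].
  by rewrite mulfVK// gt_eqF// ltr_wpDl// L2norm_ge0.
have [||r [Tr rt E]] := @tmvt' (fun s => ip (v' s) h) (fun s => ip (w' s) h) s t _ _ Ts Tt st.
- by move=> r Tr; exact: is_tderiv_tcont Tr (D r Tr).
- move=> r r0 rT; apply: is_tderiv_isd => //; apply: D.
  by split => //; exact: ltW.
have -> : ip (fun x => (v' s x - v' t x) / (s - t) - w' t x) h = ip (fun x => w' r x - w' t x) h.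
  rewrite (ipBl (LQ v' t s Lv' Tt Ts) (Lw' t Tt) Lh) (ipBl (Lw' r Tr) (Lw' t Tt) Lh).
  congr (_ - _); rewrite -E.
  rewrite -ipBl//; [|exact: Lv'|exact: Lv'].
  rewrite mulrC -ipZl//; last by apply: L2B; exact: Lv'.
  by apply: eq_Rintegral => x _; rewrite [_^-1 * _]mulrC.
apply: (le_trans (Cauchy_Schwarz (L2B (Lw' r Tr) (Lw' t Tt)) Lh)).
apply: ler_wpM2r; first exact: L2norm_ge0.
have [] := Hd r _ Tr; last by rewrite Hnorm0.
by rewrite /ball/= distrC; apply: le_lt_trans rt _; rewrite distrC.
Qed.

(** Differentiability in [L2] upgrades itself to [H^m], once the curve and its derivative are known
    to be continuous there. Only the [L2] statement is therefore checked for concrete curves. *)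
Lemma tdiffH m v w : C0_in_H m T v -> C0_in_H m T w -> tdiffL2 v w ->
  forall t, lifespan T t ->
  (fun s => Hnorm m (fun x => (v s x - v t x) / (s - t) - w t x)) @ near'_t t --> (0 : R).
Proof.
elim: m v w => [|m IH] v w Hv Hw vw t Tt.
  by under eq_fun do rewrite Hnorm0; exact: vw.
have [v' [dv Hv']] := C0_in_H_wderiv Hv; have [w' [dw Hw']] := C0_in_H_wderiv Hw.
have Lt u n s : C0_in_H n T u -> lifespan T s -> L2 (u s).
  by move=> /C0_in_HP[U _] Ts; exact: Hspace_L2 (U s Ts).
have vw' : tdiffL2 v' w'.
  apply: (tdiffL2_wderiv vw) => // [s|s|s|].
  - exact: Lt Hv.
  - exact: Lt Hw.
  - exact: Lt Hv'.
  - exact: C0_in_H_le Hw'.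
have {}IH := IH _ _ Hv' Hw' vw' t Tt.
apply/nonneg_cvg0P; first by move=> s; exact: Hnorm_ge0.
move=> e e0; have e20 : 0 < e / 2 by rewrite divr_gt0.
have := cvg0_near (vw t Tt) e20; have := cvg0_near IH e20.
rewrite !near_withinE; apply: filterS2 => s h1 h2 [Ts st].
have {}h1 := h1 (conj Ts st); have {}h2 := h2 (conj Ts st).
have L1 := L2B (Lt _ _ _ Hv' Ts) (Lt _ _ _ Hv' Tt).
have L0 := L2B (Lt _ _ _ Hv Ts) (Lt _ _ _ Hv Tt).
have L1' := L2Z (s - t)^-1 L1; have L0' := L2Z (s - t)^-1 L0.
have E (u : R -> R -> R) : (fun x => (u s x - u t x) / (s - t)) = (fun x => (s - t)^-1 * (u s x - u t x)).
  by apply/funext => x; rewrite mulrC.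
have W : is_wderiv (fun x => (v s x - v t x) / (s - t) - w t x)
   (fun x => (v' s x - v' t x) / (s - t) - w' t x).
  apply: is_wderivB; rewrite ?E//.
  - exact: Lt Hw Tt.
  - exact: Lt Hw' Tt.
  - apply: is_wderivZ => //; apply: is_wderivB.
    + exact: Lt Hv Ts.
    + exact: Lt Hv Tt.
    + exact: Lt Hv' Ts.
    + exact: Lt Hv' Tt.
    + exact: dv.
    + exact: dv.
  - exact: dw.
apply: (le_trans (HnormS_le m _ W)).
  apply: L2B; last exact: Lt Hw' Tt.
  by under eq_fun do rewrite mulrC.
by rewrite [leRHS](splitr e) lerD.
Qed.

Lemma C1_in_H_intro m v w : C0_in_H m T v -> C0_in_H m T w -> tdiffL2 v w ->
  C1_in_H m T v w.
Proof. by move=> Hv Hw vw; split => //; exact: tdiffH. Qed.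

End time_derivative.

(** * Circle diffeomorphisms *)

Section diffeo.
Context {R : realType}.
Implicit Types (f g h N q : R -> R) (c M : R).

Local Notation mu := (@lebesgue_measure R).

Lemma deriv_growth f N c (x y : R) : (forall x, is_derive (x : R) 1 f (N x)) ->
  (forall x, c <= N x) -> x <= y -> c * (y - x) <= f y - f x.
Proof.
move=> df cN; rewrite le_eqVlt => /predU1P[->|xy]; first by rewrite !subrr mulr0.
have cf : {within `[x, y], continuous f}.
  by apply: continuous_subspaceT => z; exact: isd_continuous (df z).
have [z _ ->] := @MVT R f N x y xy (fun z _ => df z) cf.
by rewrite ler_pM2r// subr_gt0.
Qed.

Lemma deriv_lip f N M : (forall x, is_derive (x : R) 1 f (N x)) ->
  (forall x, `|N x| <= M) -> forall x y, `|f x - f y| <= M * `|x - y|.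
Proof.
move=> df NM x y; wlog yx : x y / y < x => [H|].
  by have [/H //|/H|->] := ltgtP y x; [rewrite distrC [`|y - x|]distrC|rewrite !subrr !normr0 mulr0].
have cf : {within `[y, x], continuous f}.
  by apply: continuous_subspaceT => z; exact: isd_continuous (df z).
have [z _ ->] := @MVT R f N y x yx (fun z _ => df z) cf.
by rewrite normrM ler_wpM2r.
Qed.

(** A slope of at least [c] makes [f] unbounded in both directions, so the intermediate value
    theorem gives surjectivity; the same growth bound read backwards is the Lipschitz bound of the
    inverse. *)
Lemma increasing_inverse f N c : (forall x, is_derive (x : R) 1 f (N x)) ->
  0 < c -> (forall x, c <= N x) ->
  exists g, [/\ cancel f g, cancel g f, {homo f : x y / x < y} &
    forall x y, `|g x - g y| <= c^-1 * `|x - y|].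
Proof.
move=> df c0 cN; have gr := fun x y => @deriv_growth f N c x y df cN.
have cf : continuous f by move=> z; exact: isd_continuous (df z).
have surj z : exists x, f x = z.
  (* Growth at rate [c] over a distance [b] covers [|z - f 0|], so [z] lies between [f (- b)] and
     [f b]. *)
  pose b := `|z - f 0| / c.
  have b0 : 0 <= b by rewrite divr_ge0// ltW.
  have bc : c * b = `|z - f 0| by rewrite /b mulrC mulfVK// gt_eqF.
  have h1 : f (- b) <= z.
    have := gr (- b) 0; rewrite oppr_le0 => /(_ b0); rewrite sub0r opprK bc => h.
    have := ler_norm (- (z - f 0)); rewrite normrN; lra.
  have h2 : z <= f b.
    have := gr 0 b b0; rewrite subr0 bc => h.
    have := ler_norm (z - f 0); lra.
  have fb : f (- b) <= f b by exact: le_trans h1 h2.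
  have bb : - b <= b by rewrite ge0_cp.
  have [] := @IVT R f (- b) b z bb.
  - exact: continuous_subspaceT.
  - by rewrite (min_idPl fb) (max_idPr fb) h1 h2.
  - by move=> x _ fx; exists x.
have /choice [g gK] := surj.
have fmono x y : x < y -> f x < f y.
  move=> xy; rewrite -subr_gt0; apply: lt_le_trans (gr _ _ (ltW xy)).
  by rewrite mulr_gt0// subr_gt0.
have finj : injective f.
  by move=> x y fxy; case: (ltgtP x y) => // xy; have := fmono _ _ xy; rewrite fxy ltxx.
have fK : cancel f g by move=> x; apply: finj; rewrite gK.
exists g; split => // x y.
wlog yx : x y / g y <= g x => [H|].
  by have [/H //|/ltW/H] := leP (g y) (g x); rewrite distrC [`|y - x|]distrC.
rewrite ger0_norm ?subr_ge0// ler_pdivlMl//.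
by apply: (le_trans (gr _ _ yx)); rewrite !gK ler_norm.
Qed.

Lemma preimage_itv_inverse f g (a b : R) : cancel f g -> cancel g f ->
  {homo f : x y / x < y} -> g @^-1` `]a, b] = `]f a, f b].
Proof.
move=> fK gK fm; have fle := le_mono fm; have flt := leW_mono fle.
by apply/seteqP; split => z /=; rewrite !in_itv/=; have <- := gK z; rewrite fK flt fle.
Qed.

Lemma pushforward_inverse_itv f g (a b : R) : cancel f g -> cancel g f ->
  {homo f : x y / x < y} -> a <= b ->
  pushforward mu (g : R -> measurableTypeR R) `]a, b] = (f b - f a)%:E.
Proof.
move=> fK gK fm ab; rewrite /pushforward (preimage_itv_inverse _ _ fK gK fm).
rewrite lebesgue_measure_itv/= lte_fin; case: ltP => [_|]; first by rewrite EFinB.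
move: ab; rewrite le_eqVlt => /predU1P[->|/fm ab]; first by rewrite subrr.
by rewrite leNgt ab.
Qed.

(** A one-sided change of variables for merely measurable [h]. The image of Lebesgue measure under
    [g] gives []a, b]] the mass [f b - f a]. Adding the image under the inverse of
    [(M + 1) * x - f x] completes it to exactly [M + 1] times Lebesgue measure, as seen on
    intervals, and dropping that nonnegative part yields the inequality. *)
Lemma integral_comp_inverse f N g c M (h : R -> \bar R) (D : set R) :
  (forall x, is_derive (x : R) 1 f (N x)) ->
  0 < c -> (forall x, c <= N x <= M) -> cancel f g -> cancel g f ->
  measurable D -> measurable_fun setT h -> (forall x, 0 <= h x)%E ->
  (\int[mu]_(x in g @^-1` D) h (g x) <= (M + 1)%:E * \int[mu]_(x in D) h x)%E.
Proof.
move=> df c0 cNM fK gK mD mh h0.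
have M0 : 0 < M + 1.
  by have /andP[cN NM] := cNM 0; rewrite ltr_wpDl// (le_trans (ltW c0))// (le_trans cN).
have [g' [fK' gK' fm glip]] := increasing_inverse df c0 (fun x => proj1 (andP (cNM x))).
have gE : g' = g by apply/funext => x; rewrite -{1}(gK x) fK'.
rewrite {}gE {g' fK' gK'} in glip fm.
(* Since [N <= M], its slope is at least 1, so [f2] has an increasing inverse as well. *)
pose f2 x := (M + 1) * x - f x.
have df2 (x : R) : is_derive x 1 f2 ((M + 1) * 1 - N x).
  by apply: isdB => //; apply: isdZ; exact: isd_id.
have N2 x : 1 <= (M + 1) * 1 - N x by have /andP[cN NM] := cNM x; lra.
have [g2 [fK2 gK2 fm2 glip2]] := increasing_inverse df2 ltr01 N2.
have mg : measurable_fun setT (g : measurableTypeR R -> measurableTypeR R).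
  by apply: continuous_measurable_fun; exact: lip_continuous glip.
have mg2 : measurable_fun setT (g2 : measurableTypeR R -> measurableTypeR R).
  by apply: continuous_measurable_fun; exact: lip_continuous glip2.
pose nu1' : {measure set (measurableTypeR R) -> \bar R} := pushforward mu (g : R -> measurableTypeR R).
pose nu2' : {measure set (measurableTypeR R) -> \bar R} := pushforward mu (g2 : R -> measurableTypeR R).
pose nu1 := nu1' mg; pose nu2 := nu2' mg2.
have k0 : 0 <= (M + 1)^-1 by rewrite invr_ge0 ltW.
pose k : {nonneg R} := NngNum k0.
have muE A : measurable A -> mu A = mscale k (measure_add nu1 nu2) A.
  apply: lebesgue_measure_unique => _ [[a b]] _ <- /=.
  have [ab|ba] := ltP a b; last by rewrite set_itv_ge ?measure0// -leNgt.
  rewrite -[RHS]/(((M + 1)^-1)%:E * measure_add nu1 nu2 `]a, b])%E measure_addE.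
  have -> : nu1 `]a, b] = (f b - f a)%:E := pushforward_inverse_itv fK gK fm (ltW ab).
  have -> : nu2 `]a, b] = (f2 b - f2 a)%:E := pushforward_inverse_itv fK2 gK2 fm2 (ltW ab).
  rewrite lebesgue_measure_itv/= lte_fin.
  rewrite -EFinD -EFinM.
  have -> : (M + 1)^-1 * (f b - f a + (f2 b - f2 a)) = b - a.
    by rewrite /f2; field; rewrite gt_eqF.
  by rewrite ab EFinB.
have mhD : measurable_fun D h by exact: measurable_funS mh.
have h0D x : D x -> (0 <= h x)%E by move=> _.
have -> : (\int[mu]_(x in D) h x = (M + 1)^-1%:E * \int[measure_add nu1 nu2]_(x in D) h x)%E.
  rewrite (@eq_measure_integral _ _ _ _ (mscale k (measure_add nu1 nu2))).
    by rewrite ge0_integral_mscale.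
  by move=> A mA _; exact: muE.
rewrite muleA -EFinM mulfV ?gt_eqF// mul1e ge0_integral_measure_add//.
have -> : (\int[mu]_(x in g @^-1` D) h (g x) = \int[nu1]_(x in D) h x)%E.
  by rewrite (@ge0_integral_pushforward _ _ _ _ _ _ mg).
by rewrite leeDl// integral_ge0.
Qed.

(** The normalization [f 0 = 0] makes both maps preserve [[0, 1]], over which all integrals are
    taken. *)
Definition circle_diffeo f g :=
  [/\ circle_diffeo_inverse f g, f 0 = 0 & forall x, 0 < derive1 f x].

Lemma lift_derive1_periodic f : C1 f -> (forall x, f (x + 1) = f x + 1) ->
  periodic (derive1 f) 1.
Proof.
move=> cf fp x; have h1 := isd_shift (C1_isd (x + 1) cf).
have h2 := isdD (C1_isd x cf) (isd_cst 1 x).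
have E : (fun x => f (x + 1)) = (fun x => f x + 1) by apply/funext.
by rewrite -(isd_derive1 h1) E (isd_derive1 h2) addr0.
Qed.

Lemma lift_derive1_min f : C1 f -> (forall x, f (x + 1) = f x + 1) ->
  (forall x, 0 < derive1 f x) -> exists c M, 0 < c /\ forall x, c <= derive1 f x <= M.
Proof.
move=> cf fp f0; have pf := lift_derive1_periodic cf fp.
have cf' : continuous (derive1 f) by case: cf.
have [c c0 fc] := per_min cf' pf f0; have [M fM] := per_bounded cf' pf.
by exists c, M; split => // x; rewrite fc/= (le_trans (ler_norm _)).
Qed.

Lemma circle_diffeo_ex f : C1 f -> (forall x, f (x + 1) = f x + 1) -> f 0 = 0 ->
  (forall x, 0 < derive1 f x) -> exists g, circle_diffeo f g.
Proof.
move=> cf fp f00 f0; have [c [M [c0 fcM]]] := lift_derive1_min cf fp f0.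
have df := fun x => C1_isd x cf.
have [g [fK gK fm glip]] := increasing_inverse df c0 (fun x => proj1 (andP (fcM x))).
exists g; split => //; split => //.
  by move=> x; rewrite -{1}(gK x) -fp fK.
split => //.
have cg : continuous g by exact: lip_continuous glip.
suff [] : C1 g /\ derive1 g = fun x => (derive1 f (g x))^-1 by [].
have dg (x : R) : is_derive x 1 g (derive1 f (g x))^-1.
  rewrite -{1}(gK x); apply: is_derive_inverse.
  - by near=> y; exact: fK.
  - by near=> y; exact: isd_continuous (df y).
  - by rewrite gt_eqF.
apply: (isd_C1 dg) => x; apply: cvgV; first by rewrite gt_eqF.
by apply: continuous_comp; [exact: cg|case: cf => _; exact].
Unshelve. all: by end_near. Qed.

Section circle_diffeo_theory.
Variables f g : R -> R.
Hypothesis fg : circle_diffeo f g.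

Let cf : C1 f. Proof. by case: fg => -[_ _ []]. Qed.
Let cg : C1 g. Proof. by case: fg => -[_ _ []]. Qed.
Let fK : cancel f g. Proof. by case: fg => -[]. Qed.
Let gK : cancel g f. Proof. by case: fg => -[]. Qed.
Let fp x : f (x + 1) = f x + 1. Proof. by case: fg => -[]. Qed.
Let gp x : g (x + 1) = g x + 1. Proof. by case: fg => -[]. Qed.
Let f00 : f 0 = 0. Proof. by case: fg. Qed.
Let f0 x : 0 < derive1 f x. Proof. by case: fg. Qed.
Let cg0 : continuous g. Proof. exact: C1_continuous. Qed.

Lemma circle_inverse_derive1 x : derive1 g x = (derive1 f (g x))^-1.
Proof.
have := isd_comp (C1_isd (g x) cf) (C1_isd x cg).
have -> : (fun y => f (g y)) = id by apply/funext.
move=> /isd_derive1; rewrite (isd_derive1 (isd_id x)) => /esym H.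
by rewrite -[RHS]mulr1 -H mulKf// gt_eqF.
Qed.

Lemma circle_inverse_lip c : 0 < c -> (forall x, c <= derive1 f x) ->
  forall x y, `|g x - g y| <= c^-1 * `|x - y|.
Proof.
move=> c0 fc; apply: (deriv_lip (N := derive1 g)); first by move=> x; exact: C1_isd.
move=> x; rewrite circle_inverse_derive1 ger0_norm; last by rewrite invr_ge0 ltW.
by rewrite lef_pV2 ?posrE.
Qed.

Lemma circle_comp_per (h : R -> R) : periodic h 1 -> periodic (h \o g) 1.
Proof. by move=> ph x; rewrite /= gp ph. Qed.

(** Substitution bounds the squared norm with the factor [M + 1]. As [M + 1 >= 1], this is at most
    its square, and the norm estimate comes out without a root. *)
Lemma circle_comp_norm (h : R -> R) M : L2 h -> (forall x, derive1 f x <= M) ->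
  L2 (fun x => h (g x)) /\ L2norm (fun x => h (g x)) <= (M + 1) * L2norm h.
Proof.
move=> Lh fM; have [ph mh h2] := Lh.
have [c [M' [c0 fcM]]] := lift_derive1_min cf fp f0.
have df := fun x => C1_isd x cf.
have pre : g @^-1` `[0, 1] = `[0, 1].
  have [g' [fK' gK' fm glip]] := increasing_inverse df c0 (fun x => proj1 (andP (fcM x))).
  have fle := le_mono fm.
  have f1 : f 1 = 1 by rewrite -[in LHS](add0r 1) fp f00 add0r.
  by apply/seteqP; split => x /=; rewrite !in_itv/= -[0 <= g x]fle -[g x <= 1]fle gK f00 f1.
have mhg : measurable_fun setT (fun x => h (g x)).
  by apply: measurableT_comp => //; exact: continuous_measurable_fun.
have cM x : c <= derive1 f x <= M by rewrite fM andbT; have /andP[] := fcM x.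
have H := @integral_comp_inverse f (derive1 f) g c M (fun x => (h x ^+ 2)%:E) `[0, 1]
  df c0 cM fK gK (measurable_itv _).
have {}H := H _ (fun x => _).
have M0 : 0 < M + 1.
  by have /andP[cN NM] := cM 0; rewrite ltr_wpDl// (le_trans (ltW c0))// (le_trans cN).
have le2 : (\int[mu]_(x in `[0%R, 1%R]) (h (g x) ^+ 2)%:E <=
    (M + 1)%:E * \int[mu]_(x in `[0%R, 1%R]) (h x ^+ 2)%:E)%E.
  have := H _ _; rewrite pre; apply.
    by apply/measurable_EFinP; exact: measurable_funX.
  by move=> x; rewrite lee_fin sqr_ge0.
have fin : (\int[mu]_(x in `[0%R, 1%R]) (h x ^+ 2)%:E \is a fin_num)%E.
  exact: (integrable_fin_num _ h2).
have Lhg : L2 (fun x => h (g x)).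
  split => //; first exact: circle_comp_per.
  apply/integrableP; split.
    by apply/measurable_EFinP; apply: measurable_funTS; exact: measurable_funX.
  under eq_integral do rewrite gee0_abs ?lee_fin ?sqr_ge0//.
  apply: (le_lt_trans le2); rewrite -(fineK fin) -EFinM ltry//.
split => //.
rewrite -(@ler_pXn2r _ 2) ?nnegrE ?mulr_ge0 ?L2norm_ge0 ?(ltW M0)//.
rewrite exprMn !sqr_sqrtr ?Rintegral_ge0//; try by move=> ? _; exact: sqr_ge0.
apply: (@le_trans _ _ ((M + 1) * \int[mu]_(x in `[0, 1]) h x ^+ 2)).
  rewrite -lee_fin EFinM /Rintegral fineK//.
    by rewrite fineK.
  by apply: (integrable_fin_num _ (L2_sq Lhg)).
apply: ler_wpM2r; first by apply: Rintegral_ge0 => ? _; exact: sqr_ge0.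
have M1 : 1 <= M + 1 by have /andP[a b] := cM 0; rewrite lerDr (le_trans (ltW c0))// (le_trans a).
by rewrite expr2; apply: ler_peMl => //; exact: ltW.
Qed.

(** The chain rule is classical for the [C1] approximations of [h]; composition and multiplication
    by the bounded [derive1 g] are continuous in [L2], so it passes to the limit. *)
Lemma circle_comp_wderiv (h h' : R -> R) : continuous h -> L2 h -> L2 h' ->
  is_wderiv h h' ->
  is_wderiv (fun x => h (g x)) (fun x => h' (g x) / derive1 f (g x)).
Proof.
move=> ch Lh Lh' hh'.
have [c [M [c0 fcM]]] := lift_derive1_min cf fp f0.
have fM x : derive1 f x <= M by have /andP[] := fcM x.
have comp (u : R -> R) (Lu : L2 u) := circle_comp_norm Lu fM.
pose w x := derive1 g x.
have cw : continuous w by case: cg.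
have mw := continuous_measurable_fun cw.
have pw : periodic w 1 by exact: lift_derive1_periodic.
have [K wK] := per_bounded cw pw.
have K0 : 0 <= K by exact: le_trans (wK 0).
have M0 : 0 < M + 1.
  by have /andP[cN NM] := fcM 0; rewrite ltr_wpDl// (le_trans (ltW c0))// (le_trans cN).
have -> : (fun x => h' (g x) / derive1 f (g x)) = (fun x => h' (g x) * w x).
  by apply/funext => x; rewrite /w circle_inverse_derive1.
have [Lhg _] := comp _ Lh; have [Lhg' _] := comp _ Lh'.
have Lr := L2Mb Lhg' pw mw wK.
apply: is_wderiv_closed => // e e0.
pose D := K * (M + 1) + 1.
have D0 : 0 < D by rewrite ltr_wpDl// mulr_ge0// ltW.
have d0 : 0 < e / D / 2 by rewrite !divr_gt0.
have [q [pq cq hq hq']] := H1_approx ch Lh Lh' hh' d0.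
have Lq := C1_L2 cq pq; have Lq' := C1_L2_derive1 cq pq.
have [Lqg _] := comp _ Lq; have [Lqg' _] := comp _ Lq'.
have De : e / D / 2 * D = e / 2 by field; rewrite gt_eqF.
have e2 : e / 2 < e by rewrite ltr_pdivrMr// ltr_pMr// ltr1n.
exists (fun x => q (g x)), (fun x => derive1 q (g x) * w x); split => //.
- exact: L2Mb wK.
- have dq x : is_derive (x : R) 1 (fun x => q (g x)) (derive1 q (g x) * w x).
    by apply: isd_comp; exact: C1_isd.
  have ct : continuous (fun x => derive1 q (g x) * w x).
    move=> x; apply: cvgM; last exact: cw.
    by apply: continuous_comp; [exact: cg0|case: cq => _; exact].
  have [c1 <-] := isd_C1 dq ct.
  by apply: C1_wderiv => //; exact: circle_comp_per.
- apply: le_lt_trans e2; rewrite -De.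
  apply: (@le_trans _ _ (e / D / 2 * 1)); last first.
    by apply: ler_wpM2l; [exact: ltW|rewrite /D lerDr mulr_ge0// ltW].
  by rewrite mulr1; apply: L2norm_sup => //; exact: L2B.
- apply: le_lt_trans e2; rewrite -De.
  have -> : (fun x => h' (g x) * w x - derive1 q (g x) * w x) =
     (fun x => (fun y => h' y - derive1 q y) (g x) * w x).
    by apply/funext => x; rewrite mulrBl.
  have [L1 n1] := comp _ (L2B Lh' Lq').
  apply: (le_trans (L2normMb L1 pw mw wK)).
  apply: (@le_trans _ _ (K * ((M + 1) * (e / D / 2)))).
    by apply: ler_wpM2l => //; apply: (le_trans n1); apply: ler_wpM2l => //; exact: ltW.
  have -> : K * ((M + 1) * (e / D / 2)) = e / D / 2 * (K * (M + 1)) by ring.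
  by apply: ler_wpM2l; [exact: ltW|rewrite /D lerDl].
Qed.

End circle_diffeo_theory.

End diffeo.

(** * Composition of curves with the inverse of a moving diffeomorphism *)

Section curve_composition.
Context {R : realType}.
Variable T : \bar R.
Implicit Types (v w : R -> R -> R) (m : nat) (t s : R).

Local Notation near_t t := (within (lifespan T) (nbhs (t : R))).

Variables (n : nat) (Phi psi : R -> R -> R).
Hypothesis n2 : (2 <= n)%N.
Hypothesis Pp : forall t, lifespan T t -> circle_diffeo (Phi t) (psi t).
(** A lift is not periodic, but its displacement [Phi t x - x] is. *)
Hypothesis PU : C0_unif T (fun t x => Phi t x - x).
Hypothesis PN : C0_in_H n T (fun t => derive1 (Phi t)).

Let PNU : C0_unif T (fun t => derive1 (Phi t)).
Proof. by apply: (@C0_in_H_unif _ _ 0); apply: C0_in_H_le PN; exact: ltnW. Qed.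

(** Write [psi s x = psi t (Phi t (psi s x))]: its argument differs from [x] by the displacement of
    [Phi t] against [Phi s] at [psi s x], and [psi t] is Lipschitz with constant [c^-1]. *)
Lemma psi_unif t (e : R) : lifespan T t -> 0 < e ->
  \forall s \near near_t t, lifespan T s /\ forall x, `|psi s x - psi t x| <= e.
Proof.
move=> Tt e0; have [[_ _ [cP _] _ _] _ P0] := Pp Tt.
have Pper : forall x, Phi t (x + 1) = Phi t x + 1 by have [[]] := Pp Tt.
have [c [M [c0 cM]]] := lift_derive1_min cP Pper P0.
have cN x : c <= derive1 (Phi t) x by have /andP[] := cM x.
have [_ U2] := PU.
apply: filterS (U2 t Tt (c * e) (mulr_gt0 c0 e0)) => s [Ts h]; split => // x.
have [[_ _ _ _ sK] _ _] := Pp Ts; have [[_ _ _ tK _] _ _] := Pp Tt.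
have -> : psi s x = psi t (Phi t (psi s x)) by rewrite tK.
apply: (le_trans (circle_inverse_lip (Pp Tt) c0 cN _ _)).
rewrite ler_pdivrMl//; apply: le_trans (h (psi s x)).
have -> : Phi t (psi s x) - x =
    - (Phi s (psi s x) - psi s x - (Phi t (psi s x) - psi s x)) by rewrite sK; ring.
by rewrite normrN.
Qed.

(** A square-integrable [v t] has no modulus of continuity to absorb the motion of [psi]; a [C1]
    approximation [q] of it does. *)
Lemma C0_in_H0_comp v : C0_in_H 0 T v -> C0_in_H 0 T (fun t x => v t (psi t x)).
Proof.
move=> /C0_in_HP[V1 V2].
have LV t : lifespan T t -> L2 (v t) by move=> Tt; exact/Hspace0/V1.
have bd t : lifespan T t -> exists2 M : R, 0 <= M & forall x, derive1 (Phi t) x <= M.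
  move=> Tt; have [M M0 NM] := C0_unif_bounded PNU Tt.
  by exists M => [|x]; [exact: ltW|exact: le_trans (ler_norm _) (NM x)].
apply/C0_in_HP; split => t Tt.
  have [M _ NM] := bd t Tt.
  by apply/Hspace0; have [] := circle_comp_norm (Pp Tt) (LV t Tt) NM.
move=> e e0; have [M M0 NM] := bd t Tt.
have D0 : 0 < 4 * (M + 1 + 1) by lra.
pose z := e / (4 * (M + 1 + 1)).
have z0 : 0 < z by rewrite divr_gt0.
have [q [pq cq vq]] := C1_dense (LV t Tt) z0.
have Lq := C1_L2 cq pq.
have [K qK] := per_bounded (proj2 cq) (periodic_derive1 cq pq).
have K0 : 0 <= K by exact: le_trans (qK 0).
have K10 : 0 < 4 * (K + 1) by rewrite mulr_gt0// ltr_wpDl.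
have y0 : 0 < e / (4 * (K + 1)) by rewrite divr_gt0.
have [_ N2] := PNU.
apply: filterS3 (N2 t Tt 1 ltr01) (psi_unif Tt y0) (V2 t Tt z z0).
move=> s [Ts h1] [_ h2] [_ h3]; split => //.
have NMs x : derive1 (Phi s) x <= M + 1.
  have := h1 x; rewrite ler_norml => /andP[_]; have := NM x; lra.
have NMt x : derive1 (Phi t) x <= M + 1 by have := NM x; lra.
rewrite Hnorm0 in h3; rewrite Hnorm0.
have [L1 n1] := circle_comp_norm (Pp Ts) (L2B (LV s Ts) (LV t Tt)) NMs.
have [L2' n2'] := circle_comp_norm (Pp Ts) (L2B (LV t Tt) Lq) NMs.
have [L3 n3] := circle_comp_norm (Pp Tt) (L2B (LV t Tt) Lq) NMt.
have [L4 _] := circle_comp_norm (Pp Ts) Lq NMs.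
have [L5 _] := circle_comp_norm (Pp Tt) Lq NMt.
have n4 : L2norm (fun x => q (psi s x) - q (psi t x)) <= e / 4.
  apply: L2norm_sup; first exact: L2B.
  move=> x; apply: (le_trans (deriv_lip (fun x => C1_isd x cq) qK _ _)).
  apply: (@le_trans _ _ ((K + 1) * (e / (4 * (K + 1))))).
    by apply: ler_pM => //; rewrite lerDl.
  have -> // : (K + 1) * (e / (4 * (K + 1))) = e / 4.
  by field; rewrite gt_eqF// ltr_wpDl.
have -> : (fun x => v s (psi s x) - v t (psi t x)) =
   (* Four errors of size at most [e / 4]: the change of [v], the approximation by [q] at both
      times, and the motion of [psi] inside [q]. *)
   (fun x => (v s (psi s x) - v t (psi s x)) + ((v t (psi s x) - q (psi s x)) +
     ((q (psi s x) - q (psi t x)) - (v t (psi t x) - q (psi t x))))).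
  by apply/funext => x; ring.
apply: (le_trans (L2norm_triangle L1 (L2D L2' (L2B (L2B L4 L5) L3)))).
have t1 := L2norm_triangle L2' (L2B (L2B L4 L5) L3).
have t2 := L2norm_triangle (L2B L4 L5) (L2N L3).
rewrite L2normN in t2.
have m1 : 0 < M + 1 + 1 by rewrite ltr_wpDl// addr_ge0.
have m0 := ltW m1.
have zE : (M + 1 + 1) * z = e / 4.
  by rewrite /z; field; rewrite gt_eqF.
have k1 := le_trans n1 (ler_wpM2l m0 h3).
have k2 := le_trans n2' (ler_wpM2l m0 (ltW vq)).
have k3 := le_trans n3 (ler_wpM2l m0 (ltW vq)).
rewrite zE in k1 k2 k3.
apply: (le_trans (lerD k1 (le_trans t1 (lerD k2 (le_trans t2 (lerD n4 k3)))))).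
lra.
Qed.

(** The derivative of [v t \o psi t] is [v' t / derive1 (Phi t)] composed with [psi t], so the
    induction never differentiates [psi]. The reachable order is one above that of
    [derive1 (Phi t)]. *)
Lemma C0_in_H_comp m v : (m <= n.+1)%N -> C0_in_H m T v ->
  C0_in_H m T (fun t x => v t (psi t x)).
Proof.
elim: m v => [|m IH] v mn Hv; first exact: C0_in_H0_comp.
have [v' [vv' Hv']] := C0_in_H_wderiv Hv.
have Lt u j t : C0_in_H j T u -> lifespan T t -> L2 (u t).
  by move=> /C0_in_HP[U _] Tt; exact: Hspace_L2 (U t Tt).
have cv t : lifespan T t -> continuous (v t).
  by move=> Tt; have [U _] := C0_in_H_unif Hv; have [] := U t Tt.
apply: (C0_in_H_intro (w := fun t x => v' t (psi t x) / derive1 (Phi t) (psi t x))).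
- by apply: C0_in_H0_comp; exact: C0_in_H_le Hv.
- move=> t Tt x; have [[_ _ [_ cp] _ _] _ _] := Pp Tt.
  by apply: continuous_comp; [exact: C1_continuous|exact: cv].
- move=> t Tt; apply: (circle_comp_wderiv (Pp Tt)).
  + exact: cv.
  + exact: Lt Hv Tt.
  + exact: Lt Hv' Tt.
  + exact: vv'.
- apply: (IH (fun t y => v' t y / derive1 (Phi t) y)); first exact: ltnW.
  apply: C0_in_HM => //.
  apply: (C0_in_HV PN n2).
    by move=> t x Tt; have [] := Pp Tt.
  by rewrite geq_max -ltnS mn ltnW.
Qed.

End curve_composition.

(** * Time derivatives along moving points *)

Section chain_rule.
Context {R : realType}.
Variable T : \bar R.
Implicit Types (v w G : R -> R -> R) (F p : R -> R) (m : nat) (t s : R).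

Local Notation near'_t t := (within (lifespan T `\ (t : R)) (nbhs (t : R))).

(** Uniformity in [x] is what allows the difference quotient to be evaluated at a point that moves
    with [s]. *)
Definition tdiff_unif v w := forall t, lifespan T t -> forall e : R, 0 < e ->
  \forall s \near near'_t t, forall x, `|(v s x - v t x) / (s - t) - w t x| <= e.

Lemma tdiff_unif_pointwise v w : C0_unif T w ->
  (forall t x, lifespan T t -> is_tderiv T (v ^~ x) t (w t x)) -> tdiff_unif v w.
Proof.
move=> uw vw t Tt e e0; have [_ W2] := uw; have := W2 t Tt e e0.
rewrite !near_withinE => /nbhs_ballP[d /= d0 Hd].
apply/nbhs_ballP; exists d => //= s sd [Ts st] x.
have [|||r [Tr rt ->]] := @tmvt' _ _ (v ^~ x) (w ^~ x) s t _ _ Ts Tt.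
- by move=> r Tr; exact: is_tderiv_tcont Tr (vw r x Tr).
- by move=> r r0 rT; exact: is_tderiv_isd r0 rT (vw r x (conj (ltW r0) rT)).
- exact/eqP.
have [] := Hd r _ Tr; last by move=> _; exact.
by rewrite /ball/= distrC; apply: le_lt_trans rt _; rewrite distrC.
Qed.

Lemma tdiff_unif_H m v w : C1_in_H m.+1 T v w -> tdiff_unif v w.
Proof.
move=> [/C0_in_HP[V1 _] /C0_in_HP[W1 _] H] t Tt e e0.
have e30 : 0 < e / 3 by rewrite divr_gt0.
have := cvg0_near (H t Tt) e30; rewrite !near_withinE; apply: filterS => s Hs [Ts st] x.
have {}Hs := Hs (conj Ts st).
have HQ : Hspace m.+1 (fun x => (v s x - v t x) / (s - t) - w t x).
  apply: HspaceB; last exact: W1.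
  under [X in Hspace _ X]eq_fun do rewrite mulrC.
  by apply: HspaceZ; apply: HspaceB; exact: V1.
apply: (le_trans (Hspace_sup x HQ)).
by rewrite mulrC -ler_pdivlMr.
Qed.

Lemma is_tderiv_cvg F t l : lifespan T t -> is_tderiv T F t l -> F @ near'_t t --> F t.
Proof.
move=> Tt /(is_tderiv_tcont Tt); apply: cvg_trans.
by apply: cvg_app; apply: within_subset => s [].
Qed.

(** The Caratheodory form of the derivative avoids division by [p s - p t], which may vanish. *)
Lemma tderiv_comp f p t (l m : R) : lifespan T t -> is_derive (p t) 1 f l ->
  is_tderiv T p t m -> is_tderiv T (fun s => f (p s)) t (l * m).
Proof.
move=> Tt /is_derive1_caratheodory [h [fE ch hl]] pm.
have hp : (fun s => h (p s)) @ near'_t t --> l.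
  rewrite -hl; apply: (cvg_comp _ _ (is_tderiv_cvg Tt pm)); exact: ch.
rewrite /is_tderiv.
under eq_fun do rewrite fE -mulrA.
exact: cvgM.
Qed.

(** The increment is split into the change in time at the moving point [p s] and the change in space
    at the fixed time [t]. *)
Lemma tderiv_chain G Gt p t (l m : R) : lifespan T t -> tdiff_unif G Gt ->
  {for p t, continuous (Gt t)} -> is_derive (p t) 1 (G t) l -> is_tderiv T p t m ->
  is_tderiv T (fun s => G s (p s)) t (Gt t (p t) + l * m).
Proof.
move=> Tt GG cG dG pm.
have h1 := tderiv_comp Tt dG pm.
have h2 : (fun s => Gt t (p s)) @ near'_t t --> Gt t (p t).
  exact: (cvg_comp _ _ (is_tderiv_cvg Tt pm) cG).
have h3 : (fun s => (G s (p s) - G t (p s)) / (s - t) - Gt t (p s)) @ near'_t t --> (0 : R).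
  apply/cvgrPdist_le => e e0; apply: filterS (GG t Tt e e0) => s H.
  by rewrite sub0r normrN.
rewrite /is_tderiv; have -> : (fun s => (G s (p s) - G t (p t)) / (s - t)) =
  (fun s => (G s (p s) - G t (p s)) / (s - t) - Gt t (p s) + Gt t (p s)
     + (G t (p s) - G t (p t)) / (s - t)).
  by apply/funext => s; rewrite subrK -mulrDl; congr (_ / _); ring.
by rewrite -[Gt t (p t)]add0r; apply: cvgD; [exact: cvgD|exact: h1].
Qed.

End chain_rule.

(** * Periodic identities almost everywhere on the line *)

Section ae_periodic.
Context {R : realType}.
Implicit Types (f g h : R -> R).

Local Notation mu := (@lebesgue_measure R).

(** The exceptional set is covered by the integer translates of the one in [[0, 1]], a countable
    union of null sets. *)
Lemma eqae_setT f g : periodic f 1 -> periodic g 1 -> eqae f g ->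
  {ae mu, forall x : R, f x = g x}.
Proof.
move=> pf pg [N [mN N0 fgN]].
pose S (a : R) := (fun x : R => x + a) @^-1` N.
have S0 a : mu.-negligible (S a).
  have := lebesgue_measure_shift a mN; rewrite /pushforward => H.
  exists (S a); split => //; last exact: etrans H N0.
  rewrite -[S a]setTI; apply: (measurable_funD _ _ measurableT) => //.
have : mu.-negligible (\bigcup_n (S n%:R `|` S (- n%:R))).
  by apply: negligible_bigcup => n; apply: negligibleU; exact: S0.
apply: negligibleS => x /= fx.
have xN : N (x - (Num.floor x)%:~R).
  apply: fgN => /= H; apply: fx.
  have := H _; rewrite -mulrNz !per_int//; apply.
  have := floorD1_gt x; rewrite intrD => h.
  rewrite /= in_itv/= mulrNz subr_ge0 floor_le/= lerBlDr addrC; exact: ltW.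
move: xN; case: (Num.floor x) => n.
  by move=> xN; exists n => //; right.
by rewrite NegzE mulrNz opprK => xN; exists n.+1 => //; left.
Qed.

End ae_periodic.

(** * Pointwise form of the equations *)

Section strong_form.
Context {R : realType}.
Variable K : nat.
Implicit Types (f g u ut rho : R -> R).

Local Notation mu := (@lebesgue_measure R).

Lemma Hspace_wderivn1 m f : Hspace m.+2 f -> eqae (wderivn 1 f) (derive1 f) /\ L2 (wderivn 1 f).
Proof.
move=> Hf; have [cf wf Hf'] := Hspace_C1 Hf.
by have [Lw _ e] := wderivP (Hspace_L2 Hf') wf.
Qed.

Lemma Hspace_wderivn2 m f : Hspace m.+2 f ->
  wderivn 2 f = wderiv (derive1 f) /\ L2 (wderiv (derive1 f)) /\
  is_wderiv (derive1 f) (wderiv (derive1 f)).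
Proof.
move=> Hf; have [cf wf Hf'] := Hspace_C1 Hf.
have [e L1] := Hspace_wderivn1 Hf.
have [g [fg Hg]] := Hspace_wderiv Hf'.
have [Lw ww _] := wderivP (Hspace_L2 Hg) fg.
split => //; exact: (eqae_wderiv L1 (Hspace_L2 Hf') e).
Qed.

(** The once-integrated first equation with its nonconstant terms on one side. At the regularity of
    a solution it is continuous, even when the terms of its derivative are only square
    integrable. *)
Definition HS2_density u ut rho : R -> R := fun x =>
  derive1 ut x + u x * derive1 (derive1 u) x + derive1 u x ^+ 2 / 2 - rho x ^+ 2 / 2.

(* The x-derivative of HS2_density; the first equation says that it vanishes. *)
Definition HS2_residual u ut rho : R -> R := fun x =>
  wderivn 2 ut x + u x * wderivn 3 u x + 2 * wderivn 1 u x * wderivn 2 u x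
    - rho x * wderivn 1 rho x.

(** The product rule gives a weak derivative [G] written with classical derivatives where they
    exist; these agree almost everywhere with the [wderivn] in the equation, so [G] agrees with the
    residual. *)
Lemma HS2_density_wderiv u ut rho : Hspace K.+3 u -> Hspace K.+2 ut -> Hspace K.+2 rho ->
  [/\ exists G, [/\ L2 G, is_wderiv (HS2_density u ut rho) G & eqae G (HS2_residual u ut rho)],
      continuous (HS2_density u ut rho), periodic (HS2_density u ut rho) 1 &
      periodic (HS2_residual u ut rho) 1].
Proof.
move=> Hu Hut Hr.
have [cu wu Hu'] := Hspace_C1 Hu; have [cu' wu' Hu''] := Hspace_C1 Hu'.
have [cr wr Hr'] := Hspace_C1 Hr; have [ct wt Ht'] := Hspace_C1 Hut.
have [e2 [L2t w2t]] := Hspace_wderivn2 Hut.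
have [eu1 Lu1] := Hspace_wderivn1 Hu; have [er1 Lr1] := Hspace_wderivn1 Hr.
have [e2u [L2u w2u]] := Hspace_wderivn2 Hu.
have [e3u [L3u w3u]] := Hspace_wderivn2 Hu'.
(* A genuine equality, although [wderivn 1 u] and [derive1 u] agree only almost everywhere: a
   further [wderiv] does not distinguish them. *)
have E3 : wderivn 3 u = wderiv (derive1 (derive1 u)).
  rewrite wderivnS -e3u; exact: (eqae_wderivn (j := 2) Lu1 (Hspace_L2 Hu') eu1 isT).
have e2u' : eqae (wderivn 2 u) (derive1 (derive1 u)).
  by rewrite e2u; exact: (is_wderiv_unique L2u (Hspace_L2 Hu'') w2u wu').
have Lu := Hspace_L2 Hu; have Lu' := Hspace_L2 Hu'; have Lu'' := Hspace_L2 Hu''.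
have Lr := Hspace_L2 Hr; have Lr' := Hspace_L2 Hr'; have Lt' := Hspace_L2 Ht'.
have cu0 := Hspace_cont Hu; have cu1 := Hspace_cont Hu'; have cu2 := Hspace_cont Hu''.
have cr0 := Hspace_cont Hr; have ct1 := Hspace_cont Ht'; have cr1 := Hspace_cont Hr'.
have pu0 := Hspace_per Hu; have pu1 := Hspace_per Hu'; have pu2 := Hspace_per Hu''.
have pr0 := Hspace_per Hr; have pr1 := Hspace_per Hr'; have pt1 := Hspace_per Ht'.
have [M uM] := per_bounded cu0 pu0.
have cM (f g : R -> R) : continuous f -> continuous g -> continuous (fun x => f x * g x).
  by move=> cf cg x; apply: cvgM; [exact: cf|exact: cg].
have mu0 := continuous_measurable_fun cu0.
have LM f g : continuous f -> periodic f 1 -> continuous g -> periodic g 1 -> L2 (fun x => f x * g x).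
  move=> cf pf cg pg; apply: L2_cont; first exact: cM.
  by move=> x; rewrite pf pg.
have Luw : L2 (fun x => u x * wderivn 3 u x).
  by rewrite E3; under eq_fun do rewrite mulrC; exact: L2Mb uM.
pose G := fun x => (wderiv (derive1 ut) x + (derive1 u x * derive1 (derive1 u) x + u x * wderivn 3 u x))
    + ((1 / 2) * (derive1 (derive1 u) x * derive1 u x + derive1 u x * derive1 (derive1 u) x)
       - (1 / 2) * (derive1 rho x * rho x + rho x * derive1 rho x)).
have L1 := LM _ _ cu1 pu1 cu2 pu2; have L1' := LM _ _ cu2 pu2 cu1 pu1.
have L4 := LM _ _ cr1 pr1 cr0 pr0; have L4' := LM _ _ cr0 pr0 cr1 pr1.
have LG : L2 G.
  exact: (L2D (L2D L2t (L2D L1 Luw)) (L2B (L2Z _ (L2D L1' L1)) (L2Z _ (L2D L4 L4')))).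
have W : is_wderiv (HS2_density u ut rho) G.
  have -> : HS2_density u ut rho = fun x =>
      (derive1 ut x + u x * derive1 (derive1 u) x) +
      ((1 / 2) * (derive1 u x * derive1 u x) - (1 / 2) * (rho x * rho x)).
    by apply/funext => x; rewrite /HS2_density; field.
  have Luu := LM _ _ cu1 pu1 cu1 pu1; have Lrr := LM _ _ cr0 pr0 cr0 pr0.
  have Luu2 := LM _ _ cu0 pu0 cu2 pu2.
  apply: is_wderivD.
  - exact: (L2D Lt' Luu2).
  - exact: (L2B (L2Z _ Luu) (L2Z _ Lrr)).
  - exact: (L2D L2t (L2D L1 Luw)).
  - exact: (L2B (L2Z _ (L2D L1' L1)) (L2Z _ (L2D L4 L4'))).
  - apply: (is_wderivD Lt' Luu2 L2t (L2D L1 Luw) w2t).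
    by rewrite E3; exact: (is_wderivM Lu Lu' Lu'' L3u cu0 cu2 wu w3u).
  - apply: (is_wderivB (L2Z _ Luu) (L2Z _ Lrr) (L2Z _ (L2D L1' L1)) (L2Z _ (L2D L4 L4'))).
      exact: (is_wderivZ _ Luu (L2D L1' L1) (is_wderivM Lu' Lu'' Lu' Lu'' cu1 cu1 wu' wu')).
    exact: (is_wderivZ _ Lrr (L2D L4 L4') (is_wderivM Lr Lr' Lr Lr' cr0 cr0 wr wr)).
have EG : eqae G (HS2_residual u ut rho).
  move: eu1 er1 e2u'.
  apply: (@filterS3 _ _ (ae_filter_ringOfSetsType mu)) => x h1 h2 h3 xI.
  by rewrite /G /HS2_residual h1// h2// h3// e2; field.
split.
- by exists G.
- move=> x; apply: cvgB; first apply: cvgD; first apply: cvgD.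
  + exact: ct1.
  + exact: (cM _ _ cu0 cu2).
  + by apply: cvgM; [exact: (cM _ _ cu1 cu1)|exact: cvg_cst].
  + by apply: cvgM; [exact: (cM _ _ cr0 cr0)|exact: cvg_cst].
- by move=> x; rewrite /HS2_density pu0 pu1 pu2 pr0 pt1.
- have [p1 _ _] := Lu1; have [p2 _ _] := Lr1; have [p3 _ _] := L2t; have [p4 _ _] := L2u; have [p5 _ _] := L3u.
  by move=> x; rewrite /HS2_residual p1 p2 e2 p3 e2u p4 E3 p5 pu0 pr0.
Qed.

End strong_form.

(** * The explicit solution *)

Section explicit_flow.
Context {R : realType}.
Variables (K : nat) (u0 rho0 : R -> R).
Hypothesis Hu0 : Hspace K.+3 u0.
Hypothesis Hrho0 : Hspace K.+2 rho0.
Hypothesis u00 : u0 0 = 0.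
Hypothesis energy : L2norm (derive1 u0) ^+ 2 + L2norm rho0 ^+ 2 = 4.

Local Notation mu := (@lebesgue_measure R).
Local Notation a := (derive1 u0).

(** The [- 1] comes from replacing [cos t ^+ 2] by [1 - sin t ^+ 2] in the integrand of
    [phi_formula]. *)
Definition beta (y : R) : R := (a y ^+ 2 + rho0 y ^+ 2) / 4 - 1.

Definition Beta : R -> R := integral_from0 beta.

(* Expanding the square in phi_formula, the coefficients of cos t sin t and of
   sin^2 t are the derivatives of u0 and of Beta; J is the derivative of Phi in y. *)
Definition Phi (t y : R) : R := y + (cos t * sin t * u0 y + sin t ^+ 2 * Beta y).
Definition Phi_t (t y : R) : R := (cos t ^+ 2 - sin t ^+ 2) * u0 y + 2 * (cos t * sin t) * Beta y.
Definition Phi_tt (t y : R) : R := - 4 * (cos t * sin t) * u0 y + 2 * (cos t ^+ 2 - sin t ^+ 2) * Beta y.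
Definition J (t y : R) : R := 1 + (cos t * sin t * a y + sin t ^+ 2 * beta y).
Definition J_t (t y : R) : R := (cos t ^+ 2 - sin t ^+ 2) * a y + 2 * (cos t * sin t) * beta y.
Definition J_tt (t y : R) : R := - 4 * (cos t * sin t) * a y + 2 * (cos t ^+ 2 - sin t ^+ 2) * beta y.

Lemma u0_C1 : C1 u0. Proof. by have [] := Hspace_C1 Hu0. Qed.

Lemma slope_Hspace : Hspace K.+2 a. Proof. by have [] := Hspace_C1 Hu0. Qed.

Lemma beta_Hspace : Hspace K.+2 beta.
Proof.
have m1 : maxn K.+2 1 = K.+2 by apply/maxn_idPl.
apply: HspaceB; last exact: Hspace_cst.
under [X in Hspace _ X]eq_fun do rewrite mulrC.
apply/HspaceZ/HspaceD.
  by under [X in Hspace _ X]eq_fun do rewrite expr2; apply: HspaceM; rewrite ?m1; exact: slope_Hspace.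
by under [X in Hspace _ X]eq_fun do rewrite expr2; apply: HspaceM; rewrite ?m1; exact: Hrho0.
Qed.

(** Here the energy normalization to 4 enters: it makes [Beta] periodic, and hence [Phi t] the lift
    of a circle map. *)
Lemma beta_mean0 : ip beta (fun=> 1) = 0.
Proof.
have La := Hspace_L2 slope_Hspace; have Lr := Hspace_L2 Hrho0.
rewrite ip1 /beta.
have Iar := integD (L2_sq La) (L2_sq Lr).
have I4 := integZ (1 / 4) Iar.
have -> : \int[mu]_(x in `[0, 1]) ((a x ^+ 2 + rho0 x ^+ 2) / 4 - 1) =
  \int[mu]_(x in `[0, 1]) ((1 / 4) * (a x ^+ 2 + rho0 x ^+ 2) - 1).
  by apply: eq_Rintegral => x _; field.
rewrite RintegralB//; last exact: (integ_cst 1).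
rewrite RintegralZl// RintegralD//; [|exact: L2_sq|exact: L2_sq].
rewrite int01_cst.
have E f : L2norm f ^+ 2 = \int[mu]_(x in `[0, 1]) f x ^+ 2.
  by rewrite L2norm_sq; apply: eq_Rintegral => x _; rewrite expr2.
by rewrite -!E energy; lra.
Qed.

Lemma Beta_C1 : C1 Beta /\ derive1 Beta = beta.
Proof. exact: from0_C1 (Hspace_cont beta_Hspace). Qed.

Lemma Beta_isd (y : R) : is_derive y 1 Beta (beta y).
Proof. by have [cB <-] := Beta_C1; exact: C1_isd. Qed.

Lemma Beta_Hspace : Hspace K.+3 Beta.
Proof.
have [cB dB] := Beta_C1; have cb := Hspace_cont beta_Hspace.
have pb := Hspace_per beta_Hspace; have pB := from0_periodic cb pb beta_mean0.
apply: (Hspace_intro (g := beta)).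
- exact: C1_L2.
- exact: C1_continuous.
- by rewrite -dB; exact: C1_wderiv.
- exact: beta_Hspace.
Qed.

Lemma Beta0 : Beta 0 = 0. Proof. exact: integral_from00. Qed.

Lemma Phi_isd (t y : R) : is_derive y 1 (Phi t) (J t y).
Proof.
exact: (isdD (isd_id y) (isdD (isdZ _ (C1_isd y u0_C1)) (isdZ _ (Beta_isd y)))).
Qed.

Lemma Phi_t_isd (t y : R) : is_derive y 1 (Phi_t t) (J_t t y).
Proof.
exact: (isdD (isdZ _ (C1_isd y u0_C1)) (isdZ _ (Beta_isd y))).
Qed.

Lemma Phi_tt_isd (t y : R) : is_derive y 1 (Phi_tt t) (J_tt t y).
Proof.
exact: (isdD (isdZ _ (C1_isd y u0_C1)) (isdZ _ (Beta_isd y))).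
Qed.

Lemma isd_cos_sin (t : R) : is_derive t 1 (fun t => cos t * sin t) (cos t ^+ 2 - sin t ^+ 2).
Proof.
have := isdM (is_derive_cos t) (is_derive_sin t).
by apply: isd_eq => //; ring.
Qed.

Lemma isd_sin2 (t : R) : is_derive t 1 (fun t => sin t ^+ 2) (2 * (cos t * sin t)).
Proof.
have := isd_sq (is_derive_sin t).
by apply: isd_eq => //; ring.
Qed.

Lemma isd_cos2Bsin2 (t : R) : is_derive t 1 (fun t => cos t ^+ 2 - sin t ^+ 2) (- 4 * (cos t * sin t)).
Proof.
have := isdB (isd_sq (is_derive_cos t)) (isd_sin2 t).
by apply: isd_eq => //; ring.
Qed.

Lemma Phi_tisd (y t : R) : is_derive t 1 (Phi ^~ y) (Phi_t t y).
Proof.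
have := isdD (isd_cst y t) (isdD (isdM (isd_cos_sin t) (isd_cst (u0 y) t)) (isdM (isd_sin2 t) (isd_cst (Beta y) t))).
by apply: isd_eq => //; rewrite /Phi_t; ring.
Qed.

Lemma Phi_t_tisd (y t : R) : is_derive t 1 (Phi_t ^~ y) (Phi_tt t y).
Proof.
have := isdD (isdM (isd_cos2Bsin2 t) (isd_cst (u0 y) t)) (isdM (isdZ 2 (isd_cos_sin t)) (isd_cst (Beta y) t)).
by apply: isd_eq => //; rewrite /Phi_tt; ring.
Qed.

Lemma J_tisd (y t : R) : is_derive t 1 (J ^~ y) (J_t t y).
Proof.
have := isdD (isd_cst 1 t) (isdD (isdM (isd_cos_sin t) (isd_cst (a y) t)) (isdM (isd_sin2 t) (isd_cst (beta y) t))).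
by apply: isd_eq => //; rewrite /J_t; ring.
Qed.

Lemma J_t_tisd (y t : R) : is_derive t 1 (J_t ^~ y) (J_tt t y).
Proof.
have := isdD (isdM (isd_cos2Bsin2 t) (isd_cst (a y) t)) (isdM (isdZ 2 (isd_cos_sin t)) (isd_cst (beta y) t)).
by apply: isd_eq => //; rewrite /J_tt; ring.
Qed.

(** For [f = J_t / J] and [g = rho0 / J] this is the equation [f' = - f^2/2 + g^2/2 - 2] along the
    flow with denominators cleared. *)
Lemma J_identity (t y : R) :
  2 * J t y * J_tt t y = J_t t y ^+ 2 + rho0 y ^+ 2 - 4 * J t y ^+ 2.
Proof.
have r2 : rho0 y ^+ 2 = 4 * beta y + 4 - a y ^+ 2 by rewrite /beta; field.
rewrite r2 /J /J_t /J_tt; have sc := cos2Dsin2 t.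
set c := cos t in sc *; set s := sin t in sc *; set A := a y; set b := beta y.
(* Powers of [c ^+ 2 + s ^+ 2 = 1] make both sides homogeneous of degree 4 in [c] and [s], after
   which the identity is polynomial. *)
have e1 : 1 + (c * s * A + s ^+ 2 * b) = (c ^+ 2 + s ^+ 2) + (c * s * A + s ^+ 2 * b) by rewrite sc.
have e2 : 4 * b + 4 - A ^+ 2 = (4 * b + 4 - A ^+ 2) * (c ^+ 2 + s ^+ 2) ^+ 2.
  by rewrite sc expr1n mulr1.
by rewrite e1 e2; ring.
Qed.

Lemma JE (t y : R) : J t y =
  (cos t + a y / 2 * sin t) ^+ 2 + rho0 y ^+ 2 / 4 * sin t ^+ 2.
Proof.
rewrite /J /beta; have sc := cos2Dsin2 t; set c := cos t in sc *; set s := sin t in sc *.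
have -> : (1 : R) + (c * s * a y + s ^+ 2 * ((a y ^+ 2 + rho0 y ^+ 2) / 4 - 1)) =
  c ^+ 2 + s ^+ 2 + (c * s * a y + s ^+ 2 * ((a y ^+ 2 + rho0 y ^+ 2) / 4 - 1)).
  by rewrite sc.
by field.
Qed.

Lemma Phi_period (t y : R) : Phi t (y + 1) = Phi t y + 1.
Proof.
have pu := Hspace_per Hu0; have pB := Hspace_per Beta_Hspace.
by rewrite /Phi pu pB; ring.
Qed.

Lemma Phi00 t : Phi t 0 = 0.
Proof. by rewrite /Phi u00 Beta0 !mulr0 !addr0. Qed.

Lemma J_cont t : continuous (J t).
Proof.
have ca := Hspace_cont slope_Hspace; have cb := Hspace_cont beta_Hspace.
move=> y; apply: cvgD; first exact: cvg_cst.
by apply: cvgD; apply: cvgM; [exact: cvg_cst|exact: ca|exact: cvg_cst|exact: cb].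
Qed.

Lemma Phi_C1 t : C1 (Phi t) /\ derive1 (Phi t) = J t.
Proof. exact: isd_C1 (Phi_isd t) (@J_cont t). Qed.

Lemma Phi_diffeo t : (forall y, 0 < J t y) -> exists psi, circle_diffeo (Phi t) psi.
Proof.
move=> Jp; have [cP dP] := Phi_C1 t; apply: circle_diffeo_ex => //.
- exact: Phi_period.
- exact: Phi00.
- by rewrite dP.
Qed.

Lemma Phi_integral (t x : R) : integral_from0 (J t) x = Phi t x.
Proof.
have D (y : R) : is_derive y 1 (fun y => integral_from0 (J t) y - Phi t y) 0.
  rewrite -[X in is_derive _ _ _ X](subrr (J t y)); apply: isdB; last exact: Phi_isd.
  by apply: is_derive_from0_cont; exact: J_cont.
have := eq_isd0 D x 0; rewrite integral_from00 Phi00 subrr => /eqP.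
by rewrite subr_eq0 => /eqP.
Qed.

Lemma phi_formulaE (t : R) : phi_formula u0 rho0 t = Phi t.
Proof.
apply/funext => x; rewrite -Phi_integral; congr integral_from0.
by apply/funext => y; rewrite JE.
Qed.

Section curves.
Variable T : \bar R.

Lemma continuous_cos_sin (t : R) : {for t, continuous (fun t : R => cos t * sin t)}.
Proof. exact: isd_continuous (isd_cos_sin t). Qed.

Lemma continuous_sin2 (t : R) : {for t, continuous (fun t : R => sin t ^+ 2)}.
Proof. exact: isd_continuous (isd_sin2 t). Qed.

Lemma continuous_cos2Bsin2 (t : R) : {for t, continuous (fun t : R => cos t ^+ 2 - sin t ^+ 2)}.
Proof. exact: isd_continuous (isd_cos2Bsin2 t). Qed.

Lemma continuous_scale (c : R) (f : R -> R) (t : R) : {for t, continuous f} -> {for t, continuous (fun t => c * f t)}.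
Proof. by move=> cf; apply: cvgM; [exact: cvg_cst|exact: cf]. Qed.

(** The explicit curves are, up to a part constant in time, of this separated form; continuity in
    time is then that of trigonometric coefficients. *)
Lemma C0_in_H_scaleD m (f g : R -> R) (c d : R -> R) : Hspace m f -> Hspace m g ->
  (forall t : R, {for t, continuous c}) -> (forall t : R, {for t, continuous d}) ->
  C0_in_H m T (fun t y => c t * f y + d t * g y).
Proof. by move=> Hf Hg cc cd; apply: C0_in_HD; apply: C0_in_H_scale. Qed.

Lemma C0_Phi : C0_in_H K.+3 T (fun t y => Phi t y - y).
Proof.
have := C0_in_H_scaleD Hu0 Beta_Hspace continuous_cos_sin continuous_sin2.
have -> // : (fun t y => Phi t y - y) = (fun t y => cos t * sin t * u0 y + sin t ^+ 2 * Beta y).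
by apply/funext => t; apply/funext => y; rewrite /Phi addrC addKr.
Qed.

Lemma C0_Phi_t : C0_in_H K.+3 T Phi_t.
Proof. apply: (@C0_in_H_scaleD _ _ _ (fun t => cos t ^+ 2 - sin t ^+ 2) (fun t => 2 * (cos t * sin t)) Hu0 Beta_Hspace continuous_cos2Bsin2) => t.
exact: continuous_scale (@continuous_cos_sin t). Qed.

Lemma C0_Phi_tt : C0_in_H K.+3 T Phi_tt.
Proof.
apply: (@C0_in_H_scaleD _ _ _ (fun t => - 4 * (cos t * sin t)) (fun t => 2 * (cos t ^+ 2 - sin t ^+ 2)) Hu0 Beta_Hspace) => t.
  exact: continuous_scale (@continuous_cos_sin t).
exact: continuous_scale (@continuous_cos2Bsin2 t).
Qed.

Lemma C0_J : C0_in_H K.+2 T J.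
Proof.
apply: C0_in_HD; first by apply: C0_in_H_cst; exact: Hspace_cst.
exact: (C0_in_H_scaleD slope_Hspace beta_Hspace continuous_cos_sin continuous_sin2).
Qed.

Lemma C0_J_t : C0_in_H K.+2 T J_t.
Proof. apply: (@C0_in_H_scaleD _ _ _ (fun t => cos t ^+ 2 - sin t ^+ 2) (fun t => 2 * (cos t * sin t)) slope_Hspace beta_Hspace continuous_cos2Bsin2) => t.
exact: continuous_scale (@continuous_cos_sin t). Qed.

Lemma isd_tderiv (F : R -> R) (t l : R) : is_derive t 1 F l -> is_tderiv T F t l.
Proof.
move=> /is_derive1_caratheodory [h [FE ch hl]]; rewrite /is_tderiv.
have H : h @ within (lifespan T `\ t) (nbhs t) --> l.
  by rewrite -hl; apply: cvg_trans ch; apply: cvg_app; exact: cvg_within.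
apply: cvg_trans H; apply: near_eq_cvg; rewrite near_withinE; apply: nearW => s [_ st].
by rewrite FE mulfK// subr_eq0; exact/eqP.
Qed.

End curves.
End explicit_flow.

(** * The explicit formulas define a solution as long as [J > 0] *)

Section existence.
Context {R : realType}.
Variables (K : nat) (u0 rho0 : R -> R).
Hypothesis Hu0 : Hspace K.+3 u0.
Hypothesis Hrho0 : Hspace K.+2 rho0.
Hypothesis u00 : u0 0 = 0.
Hypothesis energy : L2norm (derive1 u0) ^+ 2 + L2norm rho0 ^+ 2 = 4.
Variable T : \bar R.
Hypothesis T_gt0 : (0 < T)%E.

Local Notation mu := (@lebesgue_measure R).
Local Notation Phi := (Phi u0 rho0).
Local Notation Phi_t := (Phi_t u0 rho0).
Local Notation Phi_tt := (Phi_tt u0 rho0).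
Local Notation J := (J u0 rho0).
Local Notation J_t := (J_t u0 rho0).
Local Notation J_tt := (J_tt u0 rho0).

Hypothesis J_gt0 : forall t y, lifespan T t -> 0 < J t y.

Section with_inverse.
Variable psi : R -> R -> R.
Hypothesis Hpsi : forall t, lifespan T t -> circle_diffeo (Phi t) (psi t).

Definition sol_u (t x : R) := Phi_t t (psi t x).
Definition sol_rho (t x : R) := rho0 (psi t x) / J t (psi t x).
(** Obtained by differentiating [sol_u t (Phi t y) = Phi_t t y] in [t]. *)
Definition sol_ut (t x : R) := Phi_tt t (psi t x) - sol_u t x * derive1 (sol_u t) x.
(** The second equation solved for the time derivative; that this is the actual derivative is shown
    in [sol_rho_tderiv]. *)
Definition sol_rhot (t x : R) :=
  -1 * (derive1 (sol_u t) x * sol_rho t x + sol_u t x * derive1 (sol_rho t) x).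

Let derive1_Phi : (fun t => derive1 (Phi t)) = J.
Proof. by apply/funext => t; have [] := Phi_C1 Hu0 Hrho0 t. Qed.

Let HJ := C0_J Hu0 Hrho0 T.

Let NV m : (m <= K.+2)%N -> C0_in_H m T (fun t y => (J t y)^-1).
Proof. by move=> mK; apply: (C0_in_HV HJ). Qed.

Let m1 m : maxn m.+1 1 = m.+1. Proof. by apply/maxn_idPl. Qed.

Let HPhi : C0_unif T (fun t x => Phi t x - x) := C0_in_H_unif (C0_Phi Hu0 Hrho0 energy T).

Let compH m v : (m <= K.+3)%N -> C0_in_H m T v -> C0_in_H m T (fun t x => v t (psi t x)).
Proof.
move=> mK Hv.
have PN : C0_in_H K.+2 T (fun t => derive1 (Phi t)) by rewrite derive1_Phi.
exact: (@C0_in_H_comp R T K.+2 Phi psi isT Hpsi HPhi PN m v mK Hv).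
Qed.

Let unifW m v : C0_in_H m.+1 T v -> C0_unif T v. Proof. exact: C0_in_H_unif. Qed.

Lemma sol_u_H : C0_in_H K.+3 T sol_u.
Proof. by apply: compH => //; exact: C0_Phi_t. Qed.

Definition lag_rho (t y : R) := rho0 y / J t y.

Let lag_rho_H : C0_in_H K.+2 T lag_rho.
Proof.
by apply: C0_in_HM; [exact: C0_in_H_cst|rewrite m1; exact: NV].
Qed.

Lemma sol_rho_H : C0_in_H K.+2 T sol_rho.
Proof. exact: (compH (leqnSn _) lag_rho_H). Qed.

Let psi_isd t x : lifespan T t -> is_derive (x : R) 1 (psi t) (J t (psi t x))^-1.
Proof.
move=> Tt; have pd := Hpsi Tt; have := circle_inverse_derive1 pd x.
have [_ ->] := Phi_C1 Hu0 Hrho0 t => <-.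
by apply: C1_isd; have [[_ _ [_ ?] _ _] _ _] := pd.
Qed.

Let sol_u_isd t x : lifespan T t ->
  is_derive (x : R) 1 (sol_u t) (J_t t (psi t x) / J t (psi t x)).
Proof. by move=> Tt; apply: isd_comp (psi_isd x Tt); exact: Phi_t_isd Hu0 Hrho0 _ _. Qed.

Let C1_at m v t : C0_in_H m.+2 T v -> lifespan T t -> C1 (v t).
Proof. by move=> /C0_in_HP[V _] Tt; have [] := Hspace_C1 (V t Tt). Qed.

Let sol_rho_isd t x : lifespan T t ->
  is_derive (x : R) 1 (sol_rho t) (derive1 (lag_rho t) (psi t x) / J t (psi t x)).
Proof.
move=> Tt; have cl := C1_at lag_rho_H Tt.
exact: (isd_comp (C1_isd (psi t x) cl) (psi_isd x Tt)).
Qed.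

Let Phi_psi t x : lifespan T t -> Phi t (psi t x) = x.
Proof. by move=> Tt; have [[_ _ _ _ ->] _ _] := Hpsi Tt. Qed.

(** Implicit differentiation by hand. With [z s = Phi t (psi s x)] one has [psi s x = psi t (z s)],
    so only the fixed map [psi t] has to be differentiated in space. The derivative of [z] at [t]
    needs just the uniform continuity of [psi] in time. *)
Let psi_tderiv t x : lifespan T t ->
  is_tderiv T (psi ^~ x) t (- (sol_u t x / J t (psi t x))).
Proof.
move=> Tt.
have PP : tdiff_unif T Phi Phi_t.
  apply: tdiff_unif_pointwise; first exact: unifW (C0_Phi_t Hu0 Hrho0 energy T).
  by move=> s y Ts; exact: isd_tderiv (Phi_tisd u0 rho0 y s).
have psi_cvg : psi ^~ x @ within (lifespan T `\ t) (nbhs t) --> psi t x.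
  apply/cvgrPdist_le => e e0.
  have := psi_unif Hpsi HPhi Tt e0.
  rewrite !near_withinE; apply: filterS => s H [Ts _].
  by have [_ /(_ x)] := H Ts; rewrite distrC.
have c1 : continuous (Phi_t t).
  by have [U _] := unifW (C0_Phi_t Hu0 Hrho0 energy T); have [] := U t Tt.
(* Equal to [Phi t (psi s x)] on the lifespan because [Phi s (psi s x) = x]; this form displays the
   time increment of [Phi]. *)
pose z s := x - (Phi s (psi s x) - Phi t (psi s x)).
have zt : is_tderiv T z t (- Phi_t t (psi t x)).
  rewrite /is_tderiv.
  have h1 : (fun s => (Phi s (psi s x) - Phi t (psi s x)) / (s - t) - Phi_t t (psi s x)) @ within (lifespan T `\ t) (nbhs t) --> (0 : R).
    apply/cvgrPdist_le => e e0; apply: filterS (PP t Tt e e0) => s H.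
    by rewrite sub0r normrN.
  have h2 : (fun s => Phi_t t (psi s x)) @ within (lifespan T `\ t) (nbhs t) --> Phi_t t (psi t x).
    exact: (cvg_comp _ _ psi_cvg (c1 _)).
  have -> : (fun s => (z s - z t) / (s - t)) = (fun s => - ((Phi s (psi s x) - Phi t (psi s x)) / (s - t) - Phi_t t (psi s x) + Phi_t t (psi s x))).
    by apply/funext => s; rewrite /z subrr subr0 subrK -mulNr; congr (_ / _); ring.
  by apply: cvgN; rewrite -[X in _ --> X]add0r; exact: cvgD.
have zt0 : z t = x by rewrite /z subrr subr0.
have pz : is_derive (z t) 1 (psi t) (J t (psi t x))^-1 by rewrite zt0; exact: psi_isd.
have := tderiv_comp Tt pz zt.
have -> : (J t (psi t x))^-1 * - Phi_t t (psi t x) = - (sol_u t x / J t (psi t x)).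
  by rewrite mulrN mulrC.
rewrite /is_tderiv zt0; apply: cvg_trans.
apply: near_eq_cvg; rewrite near_withinE; apply: nearW => s [Ts _].
have zE : z s = Phi t (psi s x) by rewrite /z Phi_psi//; ring.
by rewrite zE; have [[_ _ _ -> _] _ _] := Hpsi Tt.
Qed.

Lemma sol_u_tderiv t x : lifespan T t -> is_tderiv T (sol_u ^~ x) t (sol_ut t x).
Proof.
move=> Tt.
have P12 : tdiff_unif T Phi_t Phi_tt.
  apply: tdiff_unif_pointwise; first exact: unifW (C0_Phi_tt Hu0 Hrho0 energy T).
  by move=> s y Ts; exact: isd_tderiv (Phi_t_tisd u0 rho0 y s).
have c2 : continuous (Phi_tt t).
  by have [U _] := unifW (C0_Phi_tt Hu0 Hrho0 energy T); have [] := U t Tt.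
have := tderiv_chain (p := psi ^~ x) Tt P12 (c2 _) (Phi_t_isd Hu0 Hrho0 t (psi t x)) (@psi_tderiv t x Tt).
have -> // : Phi_tt t (psi t x) + J_t t (psi t x) * - (sol_u t x / J t (psi t x)) = sol_ut t x.
by rewrite /sol_ut (isd_derive1 (sol_u_isd x Tt)); ring.
Qed.

Let cst_H m (c : R) : C0_in_H m T (fun _ _ => c).
Proof. exact: (@C0_in_H_cst R T m (fun=> c) (Hspace_cst m c)). Qed.

(** Written as a product of reciprocals with a factor [-1], so that closure under products applies
    directly. *)
Definition lag_rhot (t y : R) := -1 * (rho0 y * (J_t t y * ((J t y)^-1 * (J t y)^-1))).

Let lag_rhot_unif : C0_unif T lag_rhot.
Proof.
have UV := unifW (NV (leqnn _)).
have Uc : C0_unif T (fun _ _ => -1 : R) := unifW (cst_H 1 (-1)).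
have Ur : C0_unif T (fun=> rho0) := unifW (C0_in_H_cst T Hrho0).
have U1 : C0_unif T J_t := unifW (C0_J_t Hu0 Hrho0 T).
exact: (C0_unifM Uc (C0_unifM Ur (C0_unifM U1 (C0_unifM UV UV)))).
Qed.

Let lag_rho_tisd t y : lifespan T t -> is_derive (t : R) 1 (lag_rho ^~ y) (lag_rhot t y).
Proof.
move=> Tt; have n0 : J t y != 0 by rewrite gt_eqF// J_gt0.
have dN := J_tisd u0 rho0 y t.
have dV := @is_deriveV R (fun s => J s y) t (J_t t y) 1 n0 dN.
have := isdM (isd_cst (rho0 y) t) dV.
by apply: isd_eq; rewrite // /lag_rhot /GRing.scale /= expr2 invfM; ring.
Qed.

Lemma sol_rho_tderiv t x : lifespan T t -> is_tderiv T (sol_rho ^~ x) t (sol_rhot t x).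
Proof.
move=> Tt.
have LD : tdiff_unif T lag_rho lag_rhot.
  by apply: (tdiff_unif_pointwise lag_rhot_unif) => s y Ts; exact: isd_tderiv (lag_rho_tisd y Ts).
have cl : continuous (lag_rhot t) by have [U _] := lag_rhot_unif; have [] := U t Tt.
have C1l := C1_at lag_rho_H Tt.
have := tderiv_chain (p := psi ^~ x) Tt LD (cl _) (C1_isd (psi t x) C1l) (@psi_tderiv t x Tt).
have n0 : J t (psi t x) != 0 by rewrite gt_eqF// J_gt0.
suff -> : lag_rhot t (psi t x) + derive1 (lag_rho t) (psi t x) * - (sol_u t x / J t (psi t x)) = sol_rhot t x by [].
rewrite /sol_rhot (isd_derive1 (sol_u_isd x Tt)) (isd_derive1 (sol_rho_isd x Tt)) /lag_rhot /sol_rho.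
by field.
Qed.

Let HM m v w : C0_in_H m.+1 T v -> C0_in_H m.+1 T w -> C0_in_H m.+1 T (fun t x => v t x * w t x).
Proof. by move=> Hv Hw; apply: (C0_in_HM Hv); rewrite m1. Qed.

Let HN m v : C0_in_H m.+1 T v -> C0_in_H m.+1 T (fun t x => -1 * v t x).
Proof. exact: HM (cst_H _ _). Qed.

Lemma sol_ut_H : C0_in_H K.+2 T sol_ut.
Proof.
have H2 : C0_in_H K.+2 T (fun t x => Phi_tt t (psi t x)).
  exact: C0_in_H_le (leqnSn _) (compH (leqnn _) (C0_Phi_tt Hu0 Hrho0 energy T)).
have Hx := C0_in_H_derive1 sol_u_H.
have Hu := C0_in_H_le (leqnSn _) sol_u_H.
have := C0_in_HD H2 (HN (HM Hu Hx)).
by congr (C0_in_H _ _ _); apply/funext => t; apply/funext => x; rewrite mulN1r.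
Qed.

Lemma sol_rhot_H : C0_in_H K.+1 T sol_rhot.
Proof.
have Hux := C0_in_H_le (leqnSn _) (C0_in_H_derive1 sol_u_H).
have Hr := C0_in_H_le (leqnSn _) sol_rho_H.
have Hrx := C0_in_H_derive1 sol_rho_H.
have Hu := C0_in_H_le (leqW (leqnSn _)) sol_u_H.
exact: HN (C0_in_HD (HM Hux Hr) (HM Hu Hrx)).
Qed.

Lemma sol_u_C1 : C1_in_H K.+2 T sol_u sol_ut.
Proof.
have Hu := C0_in_H_le (leqnSn _) sol_u_H.
apply: (C1_in_H_intro Hu sol_ut_H); apply: tdiffL2_pointwise.
- by move=> t Tt; have [V _] := Hu; exact: Hspace_L2 (V t Tt).
- exact: unifW sol_ut_H.
- by move=> t x; exact: sol_u_tderiv.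
Qed.

Lemma sol_rho_C1 : C1_in_H K.+1 T sol_rho sol_rhot.
Proof.
have Hr := C0_in_H_le (leqnSn _) sol_rho_H.
apply: (C1_in_H_intro Hr sol_rhot_H); apply: tdiffL2_pointwise.
- by move=> t Tt; have [V _] := Hr; exact: Hspace_L2 (V t Tt).
- exact: unifW sol_rhot_H.
- by move=> t x; exact: sol_rho_tderiv.
Qed.

(** In [sol_ut] the term [sol_u * derive1 (sol_u)] is subtracted, so the second space derivatives
    cancel and [J_identity] is what remains. *)
Lemma sol_density t x : lifespan T t -> HS2_density (sol_u t) (sol_ut t) (sol_rho t) x = - 2.
Proof.
move=> Tt; have n0 : J t (psi t x) != 0 by rewrite gt_eqF// J_gt0.
have [Hu _] := sol_u_H.
have [C1u _ Hux] := Hspace_C1 (Hu t Tt).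
have [C1ux _ _] := Hspace_C1 Hux.
have dut : is_derive (x : R) 1 (sol_ut t) (J_tt t (psi t x) * (J t (psi t x))^-1
   - (sol_u t x * derive1 (derive1 (sol_u t)) x + derive1 (sol_u t) x * derive1 (sol_u t) x)).
  have d2 := isd_comp (Phi_tt_isd Hu0 Hrho0 t (psi t x)) (psi_isd x Tt).
  have := isdB d2 (isdM (C1_isd x C1u) (C1_isd x C1ux)).
  by apply: isd_eq => //; ring.
rewrite /HS2_density (isd_derive1 dut) (isd_derive1 (sol_u_isd x Tt)) /sol_rho.
have := J_identity u0 rho0 t (psi t x).
move: (derive1 _ x) => uxx; move: (J _ _) n0 (J_t _ _) (J_tt _ _) (rho0 _) (sol_u _ _) => n n0 p q r v E.
have -> : q = (p ^+ 2 + r ^+ 2 - 4 * n ^+ 2) / (2 * n).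
  by rewrite -E; field.
by field.
Qed.

Lemma sol_HS2 : HS2_solution K.+3 u0 rho0 T sol_u sol_rho.
Proof.
have T0 : lifespan T 0 by split.
have Phi0x x : Phi 0 x = x by rewrite /Phi cos0 sin0; ring.
have psi0x x : psi 0 x = x by rewrite -[LHS]Phi0x Phi_psi.
split.
- exact: sol_u_H.
- exact: sol_rho_H.
- move=> t Tt; have [[_ _ _ pK _] p0 _] := Hpsi Tt.
  have -> : sol_u t 0 = Phi_t t 0 by rewrite /sol_u -{1}p0 pK.
  by rewrite /Phi_t u00 Beta0; ring.
- split=> x.
    by rewrite /sol_u psi0x /Phi_t cos0 sin0; ring.
  by rewrite /sol_rho psi0x /J cos0 sin0; rewrite expr0n mul0r mulr0 !mul0r !addr0 divr1.
exists sol_ut, sol_rhot; split; [exact: sol_u_C1|exact: sol_rho_C1|].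
move=> t t0 tT; have Tt : lifespan T t by split; first exact: ltW.
have [Hu _] := sol_u_H; have [Hut _] := sol_ut_H; have [Hr _] := sol_rho_H.
split.
  (* The density is constant, so its weak derivative, and with it the residual, vanishes almost
     everywhere. *)
  have [[G [LG dG GE]] _ _ pR] := HS2_density_wderiv (Hu t Tt) (Hut t Tt) (Hr t Tt).
  have dE : HS2_density (sol_u t) (sol_ut t) (sol_rho t) = (fun=> -2).
    by apply/funext => x; exact: sol_density.
  have d0 : is_wderiv (HS2_density (sol_u t) (sol_ut t) (sol_rho t)) (fun=> 0).
    have [Cc dc] := C1_cst (-2 : R); rewrite dE -dc; exact: (C1_wderiv Cc).
  have R0 : eqae (HS2_residual (sol_u t) (sol_ut t) (sol_rho t)) (fun=> 0).
    exact: (eqae_trans (eqae_sym GE) (is_wderiv_unique LG (L2_cst 0) dG d0)).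
  have p0 : periodic (fun _ : R => 0 : R) 1 by [].
  have := eqae_setT pR p0 R0.
  apply: (@filterS _ _ (ae_filter_ringOfSetsType mu)) => x.
  by rewrite /HS2_residual => /eqP; rewrite subr_eq0 => /eqP.
have HuW : Hspace (maxn K.+2 1) (sol_u t) by rewrite m1; exact: HspaceW (Hu t Tt).
have Hm : Hspace K.+2 (fun y => sol_u t y * sol_rho t y).
  by have := HspaceM (Hr t Tt) HuW; under [X in Hspace _ X]eq_fun do rewrite mulrC.
have [E _] := Hspace_wderivn1 Hm.
have [C1u _ _] := Hspace_C1 (Hu t Tt).
have [C1r _ _] := Hspace_C1 (Hr t Tt).
have [C1m dm] := C1M C1u C1r.
have [_ [L _ _]] := Hspace_wderivn1 Hm.
have pd := periodic_derive1 C1m (Hspace_per Hm).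
have := eqae_setT L pd E.
apply: (@filterS _ _ (ae_filter_ringOfSetsType mu)) => x ->.
by rewrite dm /sol_rhot mulN1r addNr.
Qed.

End with_inverse.

Lemma HS2_explicit_solution : exists u rho, HS2_solution K.+3 u0 rho0 T u rho.
Proof.
have /choice[psi Hpsi] (t : R) : exists g, lifespan T t -> circle_diffeo (Phi t) g.
  have [Tt|nT] := pselect (lifespan T t); last by exists id.
  have [g Hg] := Phi_diffeo Hu0 Hrho0 u00 energy (fun y => J_gt0 y Tt).
  by exists g.
by exists (sol_u psi), (sol_rho psi); exact: sol_HS2.
Qed.

End existence.

(** * Characteristics of an arbitrary solution *)

Section time_bounds.
Context {R : realType}.
Variable T : \bar R.

Lemma tcontinuous_bounded (F : R -> R) t : tcontinuous T F -> lifespan T t ->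
  exists M, forall s, 0 <= s <= t -> F s <= M.
Proof.
move=> cF Tt; have T0 : lifespan T 0 by split=> //; apply: le_lt_trans Tt.2; rewrite lee_fin; case: Tt.
have c : {within `[0, t], continuous F}.
  apply/subspace_continuousP => x; rewrite /= in_itv/= => sxt.
  apply: cvg_trans (cF x (lifespan_between T0 Tt sxt)).
  apply: cvg_app; apply: within_subset => y; rewrite /= in_itv/=.
  exact: lifespan_between.
have [m _ H] := EVT_max Tt.1 c.
by exists (F m) => s st; apply: H; rewrite in_itv.
Qed.

Lemma tderiv_tcontinuous (F F' : R -> R) :
  (forall t, lifespan T t -> is_tderiv T F t (F' t)) -> tcontinuous T F.
Proof. by move=> H t Tt; exact: is_tderiv_tcont Tt (H t Tt). Qed.

Lemma Hnorm_tcontinuous m (v : R -> R -> R) : C0_in_H m T v -> tcontinuous T (fun t => Hnorm m (v t)).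
Proof.
move=> /C0_in_HP[V C] t Tt; apply/cvgrPdist_le => e e0.
apply: filterS (C t Tt e e0) => s [Ts]; apply: le_trans.
have Hst := HspaceB (V s Ts) (V t Tt).
have h1 : Hnorm m (v s) <= Hnorm m (fun x => v s x - v t x) + Hnorm m (v t).
  have := HnormD Hst (V t Tt).
  by under [X in Hnorm m X <= _]eq_fun do rewrite subrK.
have h2 : Hnorm m (v t) <= Hnorm m (fun x => v s x - v t x) + Hnorm m (v s).
  have := HnormD (HspaceZ (-1) Hst) (V s Ts).
  rewrite (HnormZ (-1) Hst) normrN1 mul1r.
  by under [X in Hnorm m X <= _]eq_fun do rewrite mulN1r opprB subrK.
by rewrite ler_norml lerBlDr h2 lerNl opprB lerBlDr h1.
Qed.

(** The norm is continuous in time, hence bounded on [[0, t]]; this supplies the constants for the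
    Gronwall arguments. *)
Lemma C0_in_H_bounded m (v : R -> R -> R) t : C0_in_H m.+1 T v -> lifespan T t ->
  exists M, forall s x, 0 <= s <= t -> `|v s x| <= M.
Proof.
move=> Hv Tt; have [V _] := Hv.
have [M HM] := tcontinuous_bounded (Hnorm_tcontinuous Hv) Tt.
have T0 : lifespan T 0 by split=> //; apply: le_lt_trans Tt.2; rewrite lee_fin; case: Tt.
exists (3 * M) => s x st; have Ts := lifespan_between T0 Tt st.
by apply: (le_trans (Hspace_sup x (V s Ts))); rewrite ler_pM2l// HM.
Qed.

Lemma C1_in_H_tdiffL2 m (v w : R -> R -> R) : C1_in_H m T v w -> tdiffL2 T v w.
Proof.
move=> [_ _ D] t Tt; apply/nonneg_cvg0P; first by move=> s; exact: L2norm_ge0.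
move=> e e0; apply: filterS (cvg0_near (D t Tt) e0) => s; apply: le_trans.
exact: L2norm_Hnorm.
Qed.

Lemma C1_in_H_derive1 m (v w : R -> R -> R) : C1_in_H m.+2 T v w ->
  C1_in_H m.+1 T (fun t => derive1 (v t)) (fun t => derive1 (w t)).
Proof.
move=> H; have [Hv Hw _] := H; have [V _] := Hv; have [W _] := Hw.
have Hv' := C0_in_H_derive1 Hv; have Hw' := C0_in_H_derive1 Hw.
apply: (C1_in_H_intro Hv' Hw').
apply: (tdiffL2_wderiv (C1_in_H_tdiffL2 H) _ _ _ (C0_in_H_le (leq0n _) Hw')) => t Tt.
- exact: Hspace_L2 (V t Tt).
- exact: Hspace_L2 (W t Tt).
- by have [V' _] := Hv'; exact: Hspace_L2 (V' t Tt).
- by have [] := Hspace_C1 (V t Tt).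
- by have [] := Hspace_C1 (W t Tt).
Qed.

(** With the difference quotient [q s], the quotient of squared norms is [2 * ip (q s) (v t)] plus
    [s - t] times [L2norm (q s) ^+ 2]. *)
Lemma L2norm_sq_tderiv (v w : R -> R -> R) t :
  (forall s, lifespan T s -> L2 (v s)) -> L2 (w t) -> tdiffL2 T v w -> lifespan T t ->
  is_tderiv T (fun s => L2norm (v s) ^+ 2) t (2 * ip (w t) (v t)).
Proof.
move=> Lv Lw D Tt; have Lt := Lv t Tt.
pose q s x := (v s x - v t x) / (s - t).
have Lq s : lifespan T s -> L2 (q s).
  move=> Ts; rewrite /q; under [X in L2 X]eq_fun do rewrite mulrC.
  by apply: L2Z; apply: L2B => //; exact: Lv.
pose C := L2norm (w t) + 1.
have C0 : 0 <= C by rewrite addr_ge0 ?L2norm_ge0.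
(* [C] bounds [L2norm (q s)] near [t]; [d * Q] then bounds the total error when both [s - t] and the
   distance of [q s] from [w t] are at most [d]. *)
pose Q := 2 * L2norm (v t) + C ^+ 2.
have Q0 : 0 <= Q by rewrite addr_ge0 ?sqr_ge0// mulr_ge0// L2norm_ge0.
apply/cvgrPdist_le => e e0.
have Q1 : 0 < Q + 1 by rewrite ltr_wpDl.
pose d := Num.min 1 (e / (Q + 1)).
have d0 : 0 < d by rewrite lt_min ltr01 divr_gt0.
have d1 : d <= 1 by rewrite ge_min lexx.
have dQ : d * (Q + 1) <= e by rewrite -ler_pdivlMr// ge_min lexx orbT.
have near1 : \forall s \near within (lifespan T `\ t) (nbhs t), [/\ lifespan T s, s - t != 0 & `|s - t| <= d].
  rewrite near_withinE; apply/nbhs_ballP; exists d => //= s; rewrite /ball/= distrC => /ltW sd [Ts /eqP st].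
  by split; rewrite // subr_eq0.
apply: filterS2 (cvg0_near (D t Tt) d0) near1 => s h [Ts st sd].
have {}Lq := Lq s Ts; set r := s - t in st sd *.
have E : v s = (fun x => v t x + r * q s x).
  by apply/funext => x; rewrite /q -/r; field.
have Lrq : L2 (fun x => r * q s x) by exact: L2Z.
have E2 : (L2norm (v s) ^+ 2 - L2norm (v t) ^+ 2) / r = 2 * ip (q s) (v t) + r * L2norm (q s) ^+ 2.
  have LD : L2 (fun x => v t x + r * q s x) by exact: L2D.
  rewrite !L2norm_sq E (ipDl Lt Lrq LD) (ipDr Lt Lrq Lt) (ipDr Lt Lrq Lrq).
  by rewrite (ipZl _ Lq Lrq) (ipZr _ Lq Lt) (ipZr _ Lq Lq) (ipC (v t)) (ipZl _ Lq Lt); field.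
rewrite E2 {E2 E}.
have Lqw : L2 (fun x => q s x - w t x) by exact: L2B.
have h1 : L2norm (q s) <= C.
  have := L2norm_triangle Lqw Lw.
  under [X in L2norm X <= _]eq_fun do rewrite subrK.
  move=> /le_trans; apply; rewrite /C addrC lerD2l; exact: le_trans h d1.
have h2 := Cauchy_Schwarz Lqw Lt; rewrite (ipBl Lq Lw Lt) in h2.
have h3 : L2norm (q s) ^+ 2 <= C ^+ 2 by rewrite ler_pXn2r ?nnegrE ?L2norm_ge0.
have h4 : `|r * L2norm (q s) ^+ 2| <= d * C ^+ 2.
  by rewrite normrM [X in _ * X]ger0_norm ?sqr_ge0// ler_pM// sqr_ge0.
have h5 : L2norm (fun x => q s x - w t x) * L2norm (v t) <= d * L2norm (v t).
  by rewrite ler_wpM2r// L2norm_ge0.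
have h6 : `|2 * (ip (q s) (v t) - ip (w t) (v t)) + r * L2norm (q s) ^+ 2| <= d * (Q + 1).
  apply: (le_trans (ler_normD _ _)); rewrite normrM [X in X * _]ger0_norm//.
  apply: (le_trans (lerD (ler_wpM2l _ (le_trans h2 h5)) h4)) => //.
  by rewrite /Q mulrDr mulr1 mulrDr; move: (ltW d0); lra.
rewrite distrC; apply: le_trans dQ; apply: le_trans h6.
by rewrite mulrBr -addrA [X in _ + X]addrC addrA.
Qed.

(** The function [expR (- C * r) * y r - B * r] has nonpositive derivative, as the exponential is at
    most 1 for [r >= 0]. *)
Lemma gronwall (y y' : R -> R) (C B t : R) : tcontinuous T y ->
  (forall r, 0 < r -> (r%:E < T)%E -> is_derive r 1 y (y' r)) ->
  0 <= C -> 0 <= B -> lifespan T t ->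
  (forall r, 0 < r < t -> y' r <= C * y r + B) ->
  y t <= expR (C * t) * (y 0 + B * t).
Proof.
move=> cy dy C0 B0 Tt H; have [t0 tT] := Tt.
have T0 : lifespan T 0 by split=> //; exact: le_lt_trans tT.
move: t0; rewrite le_eqVlt => /predU1P[<-|t0].
  by rewrite !mulr0 expR0 mul1r addr0.
pose e (r : R) := expR ((- C) * r).
have de (r : R) : is_derive r 1 e (e r * - C).
  have := isd_comp (is_derive_expR ((- C) * r)) (isdZ (- C) (isd_id r)).
  by apply: isd_eq => //; rewrite mulr1.
pose G r := e r * y r - B * r.
have ce : continuous e by move=> r; exact: isd_continuous (de r).
have cG : tcontinuous T G.
  move=> r Tr; apply: cvgB; first by apply: cvgM; [apply: cvg_within_filter; exact: ce|exact: cy].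
  by apply: cvgM; [exact: cvg_cst|apply: cvg_within_filter; exact: cvg_id].
have dG r : 0 < r -> (r%:E < T)%E -> is_derive r 1 G ((e r * - C * y r + e r * y' r) - B).
  move=> r0 rT; have := isdB (isdM (de r) (dy r r0 rT)) (isdZ B (isd_id r)).
  by apply: isd_eq => //; rewrite mulr1.
have [r [rt r0 rT GE]] := tmvt cG dG T0 Tt t0.
have er : 0 < e r by exact: expR_gt0.
have er1 : e r <= 1 by rewrite -expR0 ler_expR mulNr oppr_le0 mulr_ge0// ltW.
have Gle : G t - G 0 <= 0.
  rewrite GE subr0 mulr_le0_ge0//; last exact: ltW.
  have h1 : e r * y' r <= e r * (C * y r + B) by rewrite ler_pM2l// H.
  have h2 : e r * B <= 1 * B by rewrite ler_wpM2r.
  by move: h1 h2; nra.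
move: Gle; rewrite /G /e !mulr0 expR0 mul1r subr0 => Gle.
have E1 : expR (C * t) * expR (- C * t) = 1 by rewrite -expRD mulNr subrr expR0.
have : expR (C * t) * (expR (- C * t) * y t) <= expR (C * t) * (y 0 + B * t).
  by rewrite ler_pM2l ?expR_gt0//; lra.
by rewrite mulrA E1 mul1r.
Qed.

End time_bounds.

(** * Second-order estimates *)

Section second_order.
Context {R : realType}.
Implicit Types (f : R -> R).

(** Two uses of the mean value theorem give the constant [M] instead of [M / 2], which suffices
    here. *)
Lemma taylor2_bound f N Q M : (forall x, is_derive (x : R) 1 f (N x)) ->
  (forall x, is_derive (x : R) 1 N (Q x)) -> (forall x, `|Q x| <= M) ->
  forall x y, `|f y - f x - N x * (y - x)| <= M * (y - x) ^+ 2.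
Proof.
move=> df dN QM x y; have M0 : 0 <= M := le_trans (normr_ge0 _) (QM x).
have [c cx E] : exists2 c : R, `|c - x| <= `|y - x| & f y - f x = N c * (y - x).
  have cf (a b : R) : {within `[a, b], continuous f}.
    by apply: continuous_subspaceT => z; exact: isd_continuous (df z).
  have [xy|yx|<-] := ltgtP x y.
  - have [c + E] := @MVT R f N x y xy (fun z _ => df z) (cf _ _).
    rewrite in_itv/= => /andP[xc cy]; exists c; last exact: E.
    by rewrite !ger0_norm ?subr_ge0 ?lerD2r; rewrite ltW.
  - have [c + E] := @MVT R f N y x yx (fun z _ => df z) (cf _ _).
    rewrite in_itv/= => /andP[yc cx]; exists c.
      by rewrite distrC [`|y - x|]distrC !ger0_norm ?subr_ge0 ?lerD2l ?lerN2; rewrite ltW.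
    by rewrite -[LHS]opprB E; ring.
  - by exists x; rewrite ?subrr// mulr0.
rewrite E -mulrBl normrM -real_normK ?num_real// expr2 mulrA ler_wpM2r//.
by apply: (le_trans (deriv_lip dN QM c x)); rewrite ler_wpM2l.
Qed.

Lemma quadratic_isd f (x l C : R) :
  (forall h, `|f (x + h) - f x - h * l| <= C * h ^+ 2) -> is_derive x 1 f l.
Proof.
move=> H.
have C0 : 0 <= C by have := H 1; rewrite expr1n mulr1; exact: le_trans.
have D : (fun h : R => h^-1 *: ((f \o shift x) (h *: (1 : R)) - f x)) @ 0^' --> l.
  apply/cvgrPdist_le => e e0.
  have C1 : 0 < C + 1 by rewrite ltr_wpDl.
  rewrite near_withinE; apply/nbhs_ballP; exists (e / (C + 1)); first by rewrite /= divr_gt0.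
  move=> h; rewrite /ball/= sub0r normrN ltr_pdivlMr// => hd /eqP h0.
  have {}h0 : h != 0 by apply/eqP.
  have -> : h *: (1 : R) + x = x + h by rewrite [_%:A]mulr1 addrC.
  have -> : l - h^-1 *: (f (x + h) - f x) = - (f (x + h) - f x - h * l) / h.
    rewrite [_^-1 *: _]mulrC; move: (f (x + h) - f x) => v.
    by rewrite mulNr mulrBl mulrAC divff// mul1r opprB.
  rewrite normrM normrN normfV ler_pdivrMr ?normr_gt0//.
  apply: (le_trans (H h)); rewrite -(real_normK (num_real h)) expr2 mulrA ler_wpM2r//.
  by apply: le_trans (ltW hd); rewrite mulrC ler_wpM2l// lerDl.
by apply: DeriveDef; [apply/cvg_ex; exists l|apply/cvg_lim].
Qed.

End second_order.

Lemma is_tderivD {R : realType} (T : \bar R) (F G : R -> R) t l m :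
  is_tderiv T F t l -> is_tderiv T G t m -> is_tderiv T (fun s => F s + G s) t (l + m).
Proof.
move=> dF dG; rewrite /is_tderiv.
have -> : (fun s => (F s + G s - (F t + G t)) / (s - t)) =
    (fun s => (F s - F t) / (s - t) + (G s - G t) / (s - t)).
  by apply/funext => s; ring.
exact: cvgD dF dG.
Qed.

(** * Energy, characteristics and flow of a given solution *)

Section solution.
Context {R : realType}.
Variables (K : nat) (T : \bar R) (u rho ut rhot : R -> R -> R).
Hypothesis Hu : C0_in_H K.+3 T u.
Hypothesis Hr : C0_in_H K.+2 T rho.
Hypothesis C1u : C1_in_H K.+2 T u ut.
Hypothesis C1r : C1_in_H K.+1 T rho rhot.

Local Notation mu := (@lebesgue_measure R).
Local Notation ux t := (derive1 (u t)).
Local Notation uxx t := (derive1 (derive1 (u t))).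
Local Notation rx t := (derive1 (rho t)).
Local Notation utx t := (derive1 (ut t)).

Hypothesis pde_u : forall t, 0 < t -> (t%:E < T)%E ->
  {ae mu, forall x : R, wderivn 2 (ut t) x + u t x * wderivn 3 (u t) x
     + 2 * wderivn 1 (u t) x * wderivn 2 (u t) x = rho t x * wderivn 1 (rho t) x}.
Hypothesis pde_rho : forall t, 0 < t -> (t%:E < T)%E ->
  {ae mu, forall x : R, rhot t x + wderivn 1 (fun y => u t y * rho t y) x = 0}.

Let Hut : C0_in_H K.+2 T ut. Proof. by case: C1u. Qed.
Let Hrt : C0_in_H K.+1 T rhot. Proof. by case: C1r. Qed.

Let u_at t (Tt : lifespan T t) : Hspace K.+3 (u t). Proof. by case: Hu => H _; exact: H. Qed.
Let r_at t (Tt : lifespan T t) : Hspace K.+2 (rho t). Proof. by case: Hr => H _; exact: H. Qed.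
Let ut_at t (Tt : lifespan T t) : Hspace K.+2 (ut t). Proof. by case: Hut => H _; exact: H. Qed.
Let rt_at t (Tt : lifespan T t) : Hspace K.+1 (rhot t). Proof. by case: Hrt => H _; exact: H. Qed.
Let ux_at t (Tt : lifespan T t) : Hspace K.+2 (ux t).
Proof. by have [] := Hspace_C1 (u_at Tt). Qed.
Let u_isd t x (Tt : lifespan T t) : is_derive (x : R) 1 (u t) (ux t x).
Proof. by apply: C1_isd; have [] := Hspace_C1 (u_at Tt). Qed.
Let ux_isd t x (Tt : lifespan T t) : is_derive (x : R) 1 (ux t) (uxx t x).
Proof. by apply: C1_isd; have [] := Hspace_C1 (ux_at Tt). Qed.
Let r_isd t x (Tt : lifespan T t) : is_derive (x : R) 1 (rho t) (rx t x).
Proof. by apply: C1_isd; have [] := Hspace_C1 (r_at Tt). Qed.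
Let ut_isd t x (Tt : lifespan T t) : is_derive (x : R) 1 (ut t) (utx t x).
Proof. by apply: C1_isd; have [] := Hspace_C1 (ut_at Tt). Qed.

Let inT t : 0 < t -> (t%:E < T)%E -> lifespan T t.
Proof. by move=> t0 tT; split; first exact: ltW. Qed.

Let wu t (Tt : lifespan T t) : Hspace K.+2 (u t). Proof. exact: HspaceW (u_at Tt). Qed.

Let m1 m : maxn m.+1 1 = m.+1. Proof. by apply/maxn_idPl. Qed.

(** All terms of the second equation are continuous, so it holds at every point. *)
Lemma rhot_eq t x : 0 < t -> (t%:E < T)%E -> rhot t x = - (ux t x * rho t x + u t x * rx t x).
Proof.
move=> t0 tT; have Tt := inT t0 tT.
have HuW : Hspace (maxn K.+2 1) (u t) by rewrite m1; exact: wu.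
have Hm : Hspace K.+2 (fun y => u t y * rho t y).
  by have := HspaceM (r_at Tt) HuW; under [X in Hspace _ X]eq_fun do rewrite mulrC.
have [E _] := Hspace_wderivn1 Hm.
have [cu _ _] := Hspace_C1 (u_at Tt).
have [cr _ _] := Hspace_C1 (r_at Tt).
have [cm dm] := C1M cu cr.
have [_ _ Hdm] := Hspace_C1 Hm.
pose f x := rhot t x + derive1 (fun y => u t y * rho t y) x.
have Hf : Hspace K.+1 f by exact: HspaceD (rt_at Tt) Hdm.
have f0 : eqae f (fun=> 0).
  have P : eqae (fun x => rhot t x + wderivn 1 (fun y => u t y * rho t y) x) (fun=> 0).
    by apply: (@filterS _ _ (ae_filter_ringOfSetsType mu)) (pde_rho t0 tT) => y /= + _.
  apply: (@filterS2 _ _ (ae_filter_ringOfSetsType mu)) E P => y /= E P y01.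
  by rewrite /f -(E y01) P.
have n0 : L2norm f = 0 by rewrite (eqae_L2norm f0 (Hspace_L2 Hf) (L2_cst 0)) L2norm_cst normr0.
have := L2norm0_cont (Hspace_cont Hf) (Hspace_L2 Hf) n0 x.
by rewrite /f dm; move=> /eqP; rewrite addr_eq0 => /eqP.
Qed.

Let p01 (f : R -> R) : C1 f -> periodic f 1 -> \int[mu]_(x in `[0, 1]) derive1 f x = 0.
Proof.
move=> cf pf; rewrite (FTC_C1 cf ler01).
by have := pf 0; rewrite add0r => ->; rewrite subrr.
Qed.

Let en t := L2norm (ux t) ^+ 2 + L2norm (rho t) ^+ 2.

Let density_en t x : 0 < t -> (t%:E < T)%E -> HS2_density (u t) (ut t) (rho t) x = - en t / 2.
Proof.
move=> t0 tT; have Tt := inT t0 tT.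
have [[G [LG dG GE]] cD pD pR] := HS2_density_wderiv (u_at Tt) (ut_at Tt) (r_at Tt).
have R0 : eqae (HS2_residual (u t) (ut t) (rho t)) (fun=> 0).
  apply: (@filterS _ _ (ae_filter_ringOfSetsType mu)) (pde_u t0 tT) => y E _.
  exact: (etrans (congr1 (fun z => z - _) E) (subrr _)).
have D0 : is_wderiv (HS2_density (u t) (ut t) (rho t)) (fun=> 0).
  exact: is_wderiv_eqae_r LG (L2_cst 0) (eqae_trans GE R0) dG.
have cst := wderiv0_cst_cont cD pD D0.
set c := HS2_density _ _ _ x.
have [cut _ _] := Hspace_C1 (ut_at Tt).
have [cu _ Hux] := Hspace_C1 (u_at Tt).
have [cux _ Huxx] := Hspace_C1 Hux.
have cuxx := Hspace_cont Huxx.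
(* Its derivative is the constant [c] plus half the energy density; integrating over the circle
   identifies [c]. *)
pose F y := ut t y + u t y * ux t y.
have [cF dF] : C1 F /\ derive1 F = (fun y => c + (ux t y * ux t y + rho t y * rho t y) / 2).
  have -> : (fun y => c + (ux t y * ux t y + rho t y * rho t y) / 2) =
      (fun y => utx t y + (ux t y * ux t y + u t y * uxx t y)).
    by apply/funext => y; rewrite /c (cst x y) /HS2_density; field.
  apply: isd_C1 => y; first exact: isdD (ut_isd y Tt) (isdM (u_isd y Tt) (ux_isd y Tt)).
  have [_ cutx] := cut; have c1 := Hspace_cont (u_at Tt); have c2 := Hspace_cont Hux.
  by apply: cvgD; [exact: cutx|apply: cvgD; apply: cvgM; [exact: c2|exact: c2|exact: c1|exact: cuxx]].
have pF : periodic F 1.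
  move=> y; rewrite /F (Hspace_per (ut_at Tt)) (Hspace_per (u_at Tt)).
  by rewrite (Hspace_per Hux).
have := p01 cF pF; rewrite dF.
have Lx := Hspace_L2 Hux; have Lr := Hspace_L2 (r_at Tt).
have I2 := integD (L2_integM Lx Lx) (L2_integM Lr Lr).
rewrite RintegralD//; first last.
- by under [X in _.-integrable _ X]eq_fun do rewrite mulrC; exact: integZ.
- exact: integ_cst.
rewrite int01_cst.
have -> : \int[mu]_(y in `[0, 1]) ((ux t y * ux t y + rho t y * rho t y) / 2) =
   \int[mu]_(y in `[0, 1]) (1 / 2 * (ux t y * ux t y + rho t y * rho t y)).
  by apply: eq_Rintegral => y _; field.
rewrite RintegralZl// RintegralD//; [|exact: L2_integM|exact: L2_integM].
by rewrite /en !L2norm_sq /ip; lra.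
Qed.

Let C1ux : C1_in_H K.+1 T (fun t => ux t) (fun t => utx t).
Proof. exact: C1_in_H_derive1 C1u. Qed.

Let en_tderiv t : lifespan T t ->
  is_tderiv T en t (2 * ip (utx t) (ux t) + 2 * ip (rhot t) (rho t)).
Proof.
move=> Tt.
have Lx s : lifespan T s -> L2 (ux s) by move=> Ts; exact: Hspace_L2 (ux_at Ts).
have Lr s : lifespan T s -> L2 (rho s) by move=> Ts; exact: Hspace_L2 (r_at Ts).
have Lut : L2 (utx t) by have [] := Hspace_C1 (ut_at Tt) => _ _ /Hspace_L2.
have d1 := L2norm_sq_tderiv Lx Lut (C1_in_H_tdiffL2 C1ux) Tt.
have d2 := L2norm_sq_tderiv Lr (Hspace_L2 (rt_at Tt)) (C1_in_H_tdiffL2 C1r) Tt.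
exact: is_tderivD d1 d2.
Qed.

Let en_stationary t : 0 < t -> (t%:E < T)%E -> ip (utx t) (ux t) + ip (rhot t) (rho t) = 0.
Proof.
move=> t0 tT; have Tt := inT t0 tT.
have [cu _ Hux] := Hspace_C1 (u_at Tt).
have [_ _ Hutx] := Hspace_C1 (ut_at Tt).
have [cr _ Hrx] := Hspace_C1 (r_at Tt).
pose c := - en t / 2.
(* The energy flux: inserting both equations shows that its space derivative is half the time
   derivative of the energy density, so the integral over the circle vanishes. *)
pose F y := u t y * (c - (ux t y ^+ 2 + rho t y ^+ 2) / 2).
have Fd y : is_derive (y : R) 1 F (utx t y * ux t y + rhot t y * rho t y).
  have dq := isdD (isd_sq (ux_isd y Tt)) (isd_sq (r_isd y Tt)).
  have := isdM (u_isd y Tt) (isdB (isd_cst c y) (isdM dq (isd_cst (2^-1) y))).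
  have := density_en y t0 tT; rewrite /HS2_density -/c => E.
  have -> : utx t y = c - u t y * uxx t y - ux t y ^+ 2 / 2 + rho t y ^+ 2 / 2 by rewrite -E; ring.
  rewrite (rhot_eq y t0 tT).
  by apply: isd_eq => //; field.
have [cF dF] : C1 F /\ derive1 F = (fun y => utx t y * ux t y + rhot t y * rho t y).
  have c1 := Hspace_cont Hutx; have c2 := Hspace_cont Hux.
  have c3 := Hspace_cont (rt_at Tt); have c4 := Hspace_cont (r_at Tt).
  by apply: (isd_C1 Fd) => y; apply: cvgD; apply: cvgM; [exact: c1|exact: c2|exact: c3|exact: c4].
have pF : periodic F 1.
  by move=> y; rewrite /F (Hspace_per (u_at Tt)) (Hspace_per Hux) (Hspace_per (r_at Tt)).
have := p01 cF pF; rewrite dF RintegralD//; apply: L2_integM.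
- exact: Hspace_L2 Hutx.
- exact: Hspace_L2 Hux.
- exact: Hspace_L2 (rt_at Tt).
- exact: Hspace_L2 (r_at Tt).
Qed.

Lemma HS2_energy t : lifespan T t ->
  L2norm (ux t) ^+ 2 + L2norm (rho t) ^+ 2 = L2norm (ux 0) ^+ 2 + L2norm (rho 0) ^+ 2.
Proof.
apply: (@tderiv0_cst _ T en); first exact: tderiv_tcontinuous en_tderiv.
move=> r r0 rT; have := is_tderiv_isd r0 rT (en_tderiv (inT r0 rT)).
by apply: isd_eq => //; rewrite -mulrDr en_stationary// mulr0.
Qed.

Hypothesis energy0 : L2norm (ux 0) ^+ 2 + L2norm (rho 0) ^+ 2 = 4.

Lemma HS2_density_cst t x : 0 < t -> (t%:E < T)%E ->
  utx t x + u t x * uxx t x + ux t x ^+ 2 / 2 - rho t x ^+ 2 / 2 = -2.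
Proof.
move=> t0 tT; have := density_en x t0 tT; rewrite /HS2_density => ->.
by rewrite /en (HS2_energy (inT t0 tT)) energy0; field.
Qed.

Variables (u0 rho0 : R -> R).
Hypothesis Hu0 : Hspace K.+3 u0.
Hypothesis Hrho0 : Hspace K.+2 rho0.
Hypothesis u00 : u0 0 = 0.
Hypothesis u_init : u 0 = u0.
Hypothesis r_init : rho 0 = rho0.

Local Notation J := (J u0 rho0).
Local Notation J_t := (J_t u0 rho0).
Local Notation J_tt := (J_tt u0 rho0).

Variable phi : R -> R -> R.
Hypothesis flow : flow_map T u phi.

Let phi_tderiv t x : lifespan T t -> is_tderiv T (phi ^~ x) t (u t (phi t x)).
Proof. by case: flow => _ _ H; exact: H. Qed.

Let f x t := ux t (phi t x).
Let g x t := rho t (phi t x).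

Let f_tderiv x t : lifespan T t ->
  is_tderiv T (f x) t (utx t (phi t x) + uxx t (phi t x) * u t (phi t x)).
Proof.
move=> Tt; have [_ _ /Hspace_cont cut] := Hspace_C1 (ut_at Tt).
have D := tdiff_unif_H C1ux.
exact: (tderiv_chain (p := phi ^~ x) Tt D (cut _) (ux_isd (phi t x) Tt) (@phi_tderiv t x Tt)).
Qed.

Let g_tderiv x t : lifespan T t ->
  is_tderiv T (g x) t (rhot t (phi t x) + rx t (phi t x) * u t (phi t x)).
Proof.
move=> Tt; have crt := Hspace_cont (rt_at Tt).
exact: (tderiv_chain (p := phi ^~ x) Tt (tdiff_unif_H C1r) (crt _) (r_isd (phi t x) Tt) (@phi_tderiv t x Tt)).
Qed.

Let f_isd x t : 0 < t -> (t%:E < T)%E ->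
  is_derive t 1 (f x) (- f x t ^+ 2 / 2 + g x t ^+ 2 / 2 - 2).
Proof.
move=> t0 tT; have := is_tderiv_isd t0 tT (@f_tderiv x t (inT t0 tT)).
have := HS2_density_cst (phi t x) t0 tT; rewrite -/(f x t) -/(g x t) => E.
by apply: isd_eq => //; rewrite -E; ring.
Qed.

Let g_isd x t : 0 < t -> (t%:E < T)%E -> is_derive t 1 (g x) (- (f x t * g x t)).
Proof.
move=> t0 tT; have := is_tderiv_isd t0 tT (@g_tderiv x t (inT t0 tT)).
have := rhot_eq (phi t x) t0 tT; rewrite -/(f x t) -/(g x t) => E.
by apply: isd_eq => //; rewrite E; ring.
Qed.

Let f_cont x : tcontinuous T (f x). Proof. exact: (tderiv_tcontinuous (@f_tderiv x)). Qed.
Let g_cont x : tcontinuous T (g x). Proof. exact: (tderiv_tcontinuous (@g_tderiv x)). Qed.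

Let bounds t : lifespan T t -> exists2 M : R, 0 <= M & forall s x, 0 <= s <= t ->
  [/\ `|ux s x| <= M, `|uxx s x| <= M & `|rho s x| <= M].
Proof.
move=> Tt; have Hx := C0_in_H_derive1 Hu.
have [M1 H1] := C0_in_H_bounded Hx Tt.
have [M2 H2] := C0_in_H_bounded (C0_in_H_derive1 Hx) Tt.
have [M3 H3] := C0_in_H_bounded Hr Tt.
exists (Num.max 0 (Num.max M1 (Num.max M2 M3))) => [|s x st]; first by rewrite le_max lexx.
by split; rewrite !le_max ?(H1 s x st) ?(H2 s x st) ?(H3 s x st) ?orbT.
Qed.

Let J_ttE t x : J_tt t x = (2 + (derive1 u0 x ^+ 2 + rho0 x ^+ 2) / 2) - 4 * J t x.
Proof.
rewrite /J_tt /J /beta.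
have -> : cos t ^+ 2 = 1 - sin t ^+ 2 by rewrite -(cos2Dsin2 t) addrK.
by field.
Qed.

Let a x : R := derive1 u0 x.

Let lifespan_le s t : lifespan T t -> 0 <= s <= t -> lifespan T s.
Proof.
move=> Tt /andP[s0 st]; split => //; apply: le_lt_trans Tt.2; by rewrite lee_fin.
Qed.

Let isd_tcont (F F' : R -> R) : (forall t, is_derive (t : R) 1 F (F' t)) -> tcontinuous T F.
Proof. by move=> dF; apply: (@tderiv_tcontinuous _ T F F') => t _; exact: isd_tderiv. Qed.

(* f J - J_t and (f^2 + g^2 + 4) J / 2 - c0 solve a linear homogeneous system of
   differential equations with zero initial data. *)
Lemma HS2_characteristic x t : lifespan T t ->
  f x t * J t x = J_t t x /\ (f x t ^+ 2 + g x t ^+ 2 + 4) * J t x = 4 + a x ^+ 2 + rho0 x ^+ 2.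
Proof.
move=> Tt; have [M M0 HM] := bounds Tt.
pose c0 := 2 + (a x ^+ 2 + rho0 x ^+ 2) / 2.
pose p s := f x s * J s x - J_t s x.
pose z s := (f x s ^+ 2 + g x s ^+ 2 + 4) / 2 * J s x - c0.
pose h s := (f x s ^+ 2 + g x s ^+ 2 + 4) / 2.
have cJ := isd_tcont (J_tisd u0 rho0 x).
have cJ_t := isd_tcont (J_t_tisd u0 rho0 x).
have cp : tcontinuous T p.
  by move=> s Ts; apply: cvgB; [apply: cvgM; [exact: f_cont|exact: cJ]|exact: cJ_t].
have cz : tcontinuous T z.
  move=> s Ts; apply: cvgB; last exact: cvg_cst.
  apply: cvgM; last exact: cJ.
  apply: cvgM; last exact: cvg_cst.
  apply: cvgD; last exact: cvg_cst.
  by apply: cvgD; rewrite expr2; apply: cvgM; [exact: f_cont|exact: f_cont|exact: g_cont|exact: g_cont].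
have dp s : 0 < s -> (s%:E < T)%E -> is_derive s 1 p (z s - f x s * p s).
  move=> s0 sT; have := isdB (isdM (f_isd x s0 sT) (J_tisd u0 rho0 x s)) (J_t_tisd u0 rho0 x s).
  by apply: isd_eq => //; rewrite J_ttE /z /p /c0 /a; field.
have dz s : 0 < s -> (s%:E < T)%E -> is_derive s 1 z (- h s * p s).
  move=> s0 sT; have df := f_isd x s0 sT; have dg := g_isd x s0 sT.
  have dh := isdM (isdD (isdD (isd_sq df) (isd_sq dg)) (isd_cst 4 s)) (isd_cst (2^-1) s).
  have := isdB (isdM dh (J_tisd u0 rho0 x s)) (isd_cst c0 s).
  by apply: isd_eq => //; rewrite /h /p; field.
pose y s := p s ^+ 2 + z s ^+ 2.
have cy : tcontinuous T y.
  by move=> s Ts; apply: cvgD; rewrite expr2; apply: cvgM; [exact: cp|exact: cp|exact: cz|exact: cz].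
pose y' s := 2 * p s * (z s - f x s * p s) + 2 * z s * (- h s * p s).
have dy s : 0 < s -> (s%:E < T)%E -> is_derive s 1 y (y' s).
  move=> s0 sT; have := isdD (isd_sq (dp s s0 sT)) (isd_sq (dz s s0 sT)).
  by apply: isd_eq.
pose C := 1 + 2 * M + (M ^+ 2 + 2).
have C0 : 0 <= C by rewrite !addr_ge0 ?mulr_ge0 ?sqr_ge0.
have y0 : y 0 = 0.
  have phi0 : phi 0 x = x by case: flow.
  have f0 : f x 0 = a x by rewrite /f phi0 u_init.
  have g0 : g x 0 = rho0 x by rewrite /g phi0 r_init.
  rewrite /y /p /z f0 g0 /J /J_t /c0 cos0 sin0 /a.
  by field.
have : y t <= expR (C * t) * (y 0 + 0 * t).
  apply: gronwall cy dy C0 (lexx 0) Tt _ => s /andP[s0 st].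
  have st' : 0 <= s <= t by rewrite !ltW.
  have [fM _ gM] := HM s (phi s x) st'.
  have {}fM : `|f x s| <= M by [].
  have gM' : `|g x s| <= M by have [_ _ ?] := HM s (phi s x) st'.
  rewrite addr0 /y' /y /C.
  have h0 : 0 <= h s <= M ^+ 2 + 2.
    have := lerXn2r 2 (normr_ge0 (f x s)) M0 fM; have := lerXn2r 2 (normr_ge0 (g x s)) M0 gM'.
    rewrite !real_normK ?num_real// /h => g2 f2.
    by have := sqr_ge0 (f x s); have := sqr_ge0 (g x s); lra.
  move: fM; rewrite ler_norml => /andP[f1 f2].
  move: (f x s) (p s) (z s) (h s) f1 f2 h0 => F P Z H f1 f2 /andP[h1 h2].
  have e1 : 2 * P * Z <= P ^+ 2 + Z ^+ 2 by have := sqr_ge0 (P - Z); rewrite sqrrB; lra.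
  have e2 : - (2 * P * Z) <= P ^+ 2 + Z ^+ 2 by have := sqr_ge0 (P + Z); rewrite sqrrD; lra.
  have e3 : - F * P ^+ 2 <= M * P ^+ 2 by rewrite ler_wpM2r ?sqr_ge0// lerNl.
  have e4 : H * - (2 * P * Z) <= H * (P ^+ 2 + Z ^+ 2) by rewrite ler_wpM2l.
  have e5 : H * (P ^+ 2 + Z ^+ 2) <= (M ^+ 2 + 2) * (P ^+ 2 + Z ^+ 2).
    by rewrite ler_wpM2r// addr_ge0 ?sqr_ge0.
  have e6 : 0 <= M * Z ^+ 2 by rewrite mulr_ge0 ?sqr_ge0.
  by move: e1 e2 e3 e4 e5 e6; rewrite !mulrDl !mulrDr; nra.
rewrite y0 mul0r addr0 mulr0 => yle.
have p2 : p t ^+ 2 = 0 by apply/eqP; rewrite eq_le sqr_ge0 andbT; apply: le_trans yle; rewrite lerDl sqr_ge0.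
have z2 : z t ^+ 2 = 0 by apply/eqP; rewrite eq_le sqr_ge0 andbT; apply: le_trans yle; rewrite lerDr sqr_ge0.
move: p2 z2 => /eqP; rewrite sqrf_eq0 subr_eq0 => /eqP pE /eqP; rewrite sqrf_eq0 subr_eq0 => /eqP zE.
by split=> //; move: zE; rewrite /c0; lra.
Qed.

(** A product of [J] with a positive factor equals [4 + a ^+ 2 + rho0 ^+ 2], so [J] cannot
    vanish. *)
Lemma HS2_J_gt0 x t : lifespan T t -> 0 < J t x.
Proof.
move=> Tt; have [_ E] := HS2_characteristic x Tt.
have h0 : 0 < f x t ^+ 2 + g x t ^+ 2 + 4 by rewrite ltr_wpDl// addr_ge0 ?sqr_ge0.
by rewrite -(pmulr_rgt0 _ h0) E ltr_wpDr ?sqr_ge0// ltr_wpDr ?sqr_ge0.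
Qed.

(** The time derivative is [- f g J + g J_t], which is 0 since [J_t = f J]. *)
Lemma HS2_rho_transport x t : lifespan T t -> rho t (phi t x) * J t x = rho0 x.
Proof.
move=> Tt; pose q s := g x s * J s x.
have cJ := isd_tcont (J_tisd u0 rho0 x).
have cq : tcontinuous T q by move=> s Ts; apply: cvgM; [exact: g_cont|exact: cJ].
have dq s : 0 < s -> (s%:E < T)%E -> is_derive s 1 q 0.
  move=> s0 sT; have := isdM (g_isd x s0 sT) (J_tisd u0 rho0 x s).
  have [<- _] := HS2_characteristic x (inT s0 sT).
  by apply: isd_eq => //; ring.
have := tderiv0_cst cq dq Tt; rewrite /q /g => ->.
have phi0 : phi 0 x = x by case: flow.
by rewrite phi0 r_init /J cos0 sin0; ring.
Qed.

(** Each trajectory is known only as the solution of its own equation, so smooth dependence on [x]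
    is proved here. A first Gronwall argument shows that neighbouring trajectories stay within a
    multiple of [|h|]; a second, with the quadratic Taylor error of [u] as source, bounds the
    deviation from [h * J] by a multiple of [h ^+ 2]. The linearized equation [J_t = f J] comes from
    [HS2_characteristic]. *)
Let phi_isd t x : lifespan T t -> is_derive (x : R) 1 (phi t) (J t x).
Proof.
move=> Tt; have [M M0 HM] := bounds Tt; have t0 : 0 <= t by case: Tt.
have phi0 y : phi 0 y = y by case: flow.
pose E := expR (2 * M * t).
(* The squared deviation is at most [X * (h ^+ 2) ^+ 2]: the Taylor error is at most
   [M * (E * h ^+ 2)], where [E * h ^+ 2] bounds the squared distance of the trajectories. *)
pose X := expR ((2 * M + 1) * t) * ((M * E) ^+ 2 * t).
apply: (@quadratic_isd _ _ _ _ (Num.sqrt X)) => h.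
pose D s := phi s (x + h) - phi s x.
pose D' s := u s (phi s (x + h)) - u s (phi s x).
have cphi y : tcontinuous T (phi ^~ y).
  by apply: (@tderiv_tcontinuous _ T _ (fun s => u s (phi s y))) => s; exact: phi_tderiv.
have cD : tcontinuous T D by move=> s Ts; apply: cvgB; exact: cphi.
have dphi y s : 0 < s -> (s%:E < T)%E -> is_derive s 1 (phi ^~ y) (u s (phi s y)).
  by move=> s0 sT; exact: is_tderiv_isd s0 sT (@phi_tderiv s y (inT s0 sT)).
have dD s : 0 < s -> (s%:E < T)%E -> is_derive s 1 D (D' s).
  by move=> s0 sT; exact: isdB (dphi _ s s0 sT) (dphi _ s s0 sT).
have in_t s r : lifespan T s -> s <= t -> 0 < r < s -> 0 <= r <= t /\ lifespan T r.
  move=> Ts st /andP[r0 rs]; have rt : 0 <= r <= t by rewrite ltW//= (le_trans (ltW rs)).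
  by split=> //; exact: lifespan_le Tt rt.
have Dle s : lifespan T s -> s <= t -> D s ^+ 2 <= E * h ^+ 2.
  move=> Ts st.
  have cD2 : tcontinuous T (fun s => D s ^+ 2).
    by move=> r Tr; rewrite expr2; apply: cvgM; exact: cD.
  have dD2 r : 0 < r -> (r%:E < T)%E -> is_derive r 1 (fun s => D s ^+ 2) (2 * D r * D' r).
    by move=> r0 rT; apply: isd_sq; exact: dD.
  have M20 : 0 <= 2 * M by rewrite mulr_ge0.
  have := gronwall cD2 dD2 M20 (lexx 0) Ts.
  rewrite mul0r addr0 /D !phi0 addrAC subrr add0r -/(D s) => G.
  apply: (le_trans (G _)); last by rewrite ler_wpM2r ?sqr_ge0// ler_expR ler_wpM2l.
  move=> r rs; have [rt Tr] := in_t s r Ts st rs.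
  rewrite -/(D r) addr0 -mulrA -[leRHS]mulrA ler_pM2l//.
  apply: (le_trans (ler_norm _)); rewrite normrM -real_normK ?num_real//.
  have L : `|D' r| <= M * `|D r|.
    by apply: (deriv_lip (fun y => u_isd y Tr)) => y; have [] := HM r y rt.
  by rewrite expr2 mulrCA ler_wpM2l.
(* Gronwall for the difference between phi(x + h) - phi(x) and its linearization *)
pose W s := D s - h * J s x.
have cW : tcontinuous T W.
  by move=> s Ts; apply: cvgB; [exact: cD|apply: cvgM; [exact: cvg_cst|exact: (isd_tcont (J_tisd u0 rho0 x))]].
pose W' s := D' s - h * J_t s x.
have dW s : 0 < s -> (s%:E < T)%E -> is_derive s 1 W (W' s).
  by move=> s0 sT; exact: isdB (dD s s0 sT) (isdZ h (J_tisd u0 rho0 x s)).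
have cW2 : tcontinuous T (fun s => W s ^+ 2).
  by move=> r Tr; rewrite expr2; apply: cvgM; exact: cW.
have dW2 r : 0 < r -> (r%:E < T)%E -> is_derive r 1 (fun s => W s ^+ 2) (2 * W r * W' r).
  by move=> r0 rT; apply: isd_sq; exact: dW.
pose B := (M * (E * h ^+ 2)) ^+ 2.
have W0 : W 0 ^+ 2 = 0.
  by rewrite /W /D !phi0 /J cos0 sin0; ring.
have C0 : 0 <= 2 * M + 1 by rewrite addr_ge0// mulr_ge0.
have : W t ^+ 2 <= expR ((2 * M + 1) * t) * (W 0 ^+ 2 + B * t).
  apply: (gronwall cW2 dW2 C0 (sqr_ge0 _) Tt) => r rt.
  have [rt' Tr] := in_t t r Tt (lexx t) rt.
  have [fM _ _] := HM r (phi r x) rt'.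
  have e1 : `|W' r - ux r (phi r x) * W r| <= M * (E * h ^+ 2).
    have [fN _] := HS2_characteristic x Tr.
    have -> : W' r - ux r (phi r x) * W r = D' r - ux r (phi r x) * D r.
      by rewrite /W' /W -fN /f; ring.
    apply: (le_trans (taylor2_bound (fun y => u_isd y Tr) (fun y => ux_isd y Tr) (M := M) _ _ _)).
      by move=> y; have [] := HM r y rt'.
    by rewrite ler_wpM2l//; apply: Dle => //; case/andP: rt'.
  move: fM e1; rewrite /B; move: (ux r _) (W r) (W' r) (E * h ^+ 2) => F w w' e fM e1.
  have {}e1 : (w' - F * w) ^+ 2 <= (M * e) ^+ 2.
    by rewrite -real_normK ?num_real// lerXn2r ?nnegrE// (le_trans (normr_ge0 _) e1).
  have e2 : 2 * w * (w' - F * w) <= w ^+ 2 + (w' - F * w) ^+ 2.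
    by have := sqr_ge0 (w - (w' - F * w)); rewrite sqrrB; lra.
  have e3 : F * w ^+ 2 <= M * w ^+ 2.
    by rewrite ler_wpM2r ?sqr_ge0//; exact: le_trans (ler_norm _) fM.
  have -> : 2 * w * w' = 2 * w * (w' - F * w) + 2 * (F * w ^+ 2) by ring.
  by move: e1 e2 e3; lra.
rewrite W0 add0r => Wle.
have {}Wle : W t ^+ 2 <= X * (h ^+ 2) ^+ 2.
  have -> // : X * (h ^+ 2) ^+ 2 = expR ((2 * M + 1) * t) * (B * t) by rewrite /X /B; ring.
have X0 : 0 <= X by rewrite mulr_ge0 ?expR_ge0// mulr_ge0// sqr_ge0.
have S0 : 0 <= Num.sqrt X * h ^+ 2 by rewrite (mulr_ge0 (sqrtr_ge0 X) (sqr_ge0 h)).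
rewrite -/(D t) -/(W t) -(@ler_pXn2r _ 2) ?nnegrE//.
by rewrite real_normK ?num_real// exprMn sqr_sqrtr.
Qed.

Lemma HS2_flowE t : lifespan T t -> phi t = Phi u0 rho0 t.
Proof.
move=> Tt; apply/funext => x.
have d y : is_derive (y : R) 1 (fun y => phi t y - Phi u0 rho0 t y) 0.
  have := isdB (phi_isd y Tt) (Phi_isd Hu0 Hrho0 t y).
  by apply: isd_eq => //; rewrite subrr.
have phi00 : phi t 0 = 0 by case: flow => _ H _; exact: H.
have := eq_isd0 d x 0; rewrite phi00 (Phi00 rho0 u00) subrr => /eqP.
by rewrite subr_eq0 => /eqP.
Qed.

End solution.

(** * The maximal time of existence *)

Section maximal_solution.
Context {R : realType}.
Variables (K : nat) (u0 rho0 : R -> R).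
Hypothesis Hu0 : Hspace K.+3 u0.
Hypothesis Hrho0 : Hspace K.+2 rho0.
Hypothesis u00 : u0 0 = 0.
Hypothesis energy : L2norm (derive1 u0) ^+ 2 + L2norm rho0 ^+ 2 = 4.

Local Notation a := (derive1 u0).
Local Notation J := (J u0 rho0).
Local Notation Phi := (Phi u0 rho0).

Lemma HS2_solution_flow T u rho phi : HS2_solution K.+3 u0 rho0 T u rho -> flow_map T u phi ->
  forall t, lifespan T t ->
  [/\ phi t = Phi t, forall x, 0 < J t x & forall x, rho t (phi t x) * J t x = rho0 x].
Proof.
move=> [Hu Hr _ [/funext iu /funext ir] [ut [rhot [C1u C1r pde]]]] flow t Tt.
have pu s (s0 : 0 < s) (sT : (s%:E < T)%E) := (pde s s0 sT).1.
have pr s (s0 : 0 < s) (sT : (s%:E < T)%E) := (pde s s0 sT).2.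
have en0 : L2norm (derive1 (u 0)) ^+ 2 + L2norm (rho 0) ^+ 2 = 4 by rewrite iu ir.
split.
- exact: (HS2_flowE Hu Hr C1u C1r pu pr en0 Hu0 Hrho0 u00 iu ir flow Tt).
- by move=> x; exact: (HS2_J_gt0 Hu Hr C1u C1r pu pr en0 iu ir flow x Tt).
- by move=> x; exact: (HS2_rho_transport Hu Hr C1u C1r pu pr en0 iu ir flow x Tt).
Qed.

Lemma J_ge0 t x : 0 <= J t x.
Proof. by rewrite JE addr_ge0 ?sqr_ge0// mulr_ge0 ?sqr_ge0// mulr_ge0 ?sqr_ge0. Qed.

(** Of the two squares in [J], the one with [rho0] is positive unless [sin t = 0], and then
    [cos t ^+ 2 = 1]. *)
Lemma J_gt0_nonzero t x : rho0 x != 0 -> 0 < J t x.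
Proof.
move=> r0; rewrite JE; have [s0|s0] := eqVneq (sin t) 0.
  have := cos2Dsin2 t; rewrite s0 expr0n addr0 !mulr0 !addr0 => ->; exact: ltr01.
rewrite ltr_wpDl ?sqr_ge0// mulr_gt0//; last by rewrite exprn_even_gt0.
by rewrite divr_gt0// exprn_even_gt0.
Qed.

(** The zeros of [rho0] in one period form a compact set, and every zero has a translate there with
    the same slope. *)
Lemma zero_slope_minimum : (exists x, rho0 x = 0) ->
  exists m, is_minimum [set a x | x in [set x | rho0 x = 0]] m.
Proof.
move=> [x0 rx0].
have pr := Hspace_per Hrho0; have cr := Hspace_cont Hrho0.
have Ha := slope_Hspace Hu0; have pa := Hspace_per Ha; have ca := Hspace_cont Ha.
have frac x : exists y, [/\ 0 <= y <= 1, rho0 y = rho0 x & a y = a x].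
  exists (x + (- Num.floor x)%:~R); rewrite !per_int//; split=> //.
  have := floorD1_gt x; rewrite intrD mulrNz => h.
  by apply/andP; split; [rewrite subr_ge0 floor_le|lra].
pose Z := `[0, 1] `&` rho0 @^-1` [set 0].
have cZ : compact Z.
  apply: compact_closedI; first exact: segment_compact.
  by apply: preimage_closed; [move=> x _; exact: cr|exact: closed_eq].
have Z0 : Z !=set0.
  have [y [y01 ry _]] := frac x0; exists y; split; first by rewrite /= in_itv.
  by rewrite /= ry.
have ca' : {within Z, continuous a} by exact: continuous_subspaceT.
have [c + cmin] := compact_EVT_min Z0 cZ ca'.
rewrite inE => -[_ rc]; exists (a c); split; first by exists c.
move=> _ [x /= rx <-]; have [y [y01 ry <-]] := frac x.
by apply: cmin; rewrite inE; split; rewrite /= ?in_itv ?ry.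
Qed.

Section blowup.
Variable m : R.
Hypothesis m_min : is_minimum [set a x | x in [set x | rho0 x = 0]] m.

Let th := atan (m / 2).
Let ts := pi / 2 + th.

Lemma blowup_time_gt0 : 0 < ts.
Proof. by have := atan_gtNpi2 (m / 2); rewrite /ts /th; lra. Qed.

Let costh : 0 < cos th.
Proof. by apply: cos_gt0_pihalf; rewrite atan_gtNpi2 atan_ltpi2. Qed.

(** With [m / 2 = tan th] this is the addition formula for the cosine; it places the first positive
    zero at [pi / 2 + th], which is the origin of the arctangent. *)
Let slopeE t : cos t + m / 2 * sin t = cos (t - th) / cos th.
Proof.
rewrite cosB -[m / 2]atanK -/th /tan.
by have := lt0r_neq0 costh => c0; field.
Qed.

Lemma J_gt0_before t x : 0 <= t < ts -> 0 < J t x.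
Proof.
move=> /andP[t0 tts]; have [rx|] := eqVneq (rho0 x) 0; last exact: J_gt0_nonzero.
have [-> | tn0] := eqVneq t 0.
  by rewrite JE cos0 sin0 !mulr0 !addr0 expr1n expr0n mulr0 addr0 ltr01.
have {}t0 : 0 < t by rewrite lt_neqAle eq_sym tn0.
have thlt := atan_ltpi2 (m / 2); have thgt := atan_gtNpi2 (m / 2); rewrite -/th in thlt thgt.
(* As [ts < pi], the sine is positive throughout, so the expression increases with the slope and the
   smallest slope is the first to reach 0. *)
have st : 0 < sin t by apply: sin_gt0_pi; move: tts; rewrite t0 /ts /=; lra.
have ct : 0 < cos (t - th).
  by apply: cos_gt0_pihalf; apply/andP; split; move: tts; rewrite /ts; lra.
have le : m <= a x by case: m_min => _; apply; exists x.
have pos : 0 < cos t + a x / 2 * sin t.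
  apply: (@lt_le_trans _ _ (cos t + m / 2 * sin t)); first by rewrite slopeE divr_gt0.
  by rewrite lerD2l ler_wpM2r ?(ltW st)// ler_pM2r.
by rewrite JE ltr_pwDl ?exprn_gt0// rx expr0n !mul0r.
Qed.

Lemma J_blowup : exists x, J ts x = 0.
Proof.
have [[x rx ax] _] := m_min; exists x.
by rewrite JE rx ax slopeE /ts addrK cos_pihalf !mul0r !expr0n/= mul0r mul0r addr0.
Qed.

End blowup.

End maximal_solution.

Theorem theorem2p1 (R : realType) (k : nat) (hk : (3 <= k)%N)
    (u0 rho0 : R -> R) (Hu0 : Hspace k u0) (Hrho0 : Hspace k.-1 rho0)
    (u00 : u0 0 = 0)
    (energy : L2norm (derive1 u0) ^+ 2 + L2norm rho0 ^+ 2 = 4)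
    (T : \bar R) (T_gt0 : (0 < T)%E) (T_max : T = maximal_time k u0 rho0)
    (u rho : R -> R -> R) (sol : HS2_solution k u0 rho0 T u rho)
    (phi : R -> R -> R) (flow : flow_map T u phi) :
  (* (1) *)
  (forall t x : R, lifespan T t -> 0 <= x <= 1 ->
     phi t x = \int[@lebesgue_measure R]_(y in `[0, x])
       ((cos t + derive1 u0 y / 2 * sin t) ^+ 2 + rho0 y ^+ 2 / 4 * sin t ^+ 2))
  /\
  (* (2) *)
  (first_time [set t | flattened (phi_formula u0 rho0 t)] T /\
   ((exists x, rho0 x = 0) ->
      exists m, is_minimum [set derive1 u0 x | x in [set x | rho0 x = 0]] m /\
                T = (pi / 2 + atan (m / 2))%:E) /\
   ((forall x, rho0 x <> 0) -> T = +oo%E))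
  /\
  (* (3) *)
  (forall t : R, lifespan T t ->
     exists psi : R -> R,
       circle_diffeo_inverse (phi t) psi /\
       (forall y, is_tderiv T (fun s => phi s (psi y)) t (u t y)) /\
       (forall y, rho t y = rho0 (psi y) / derive1 (phi t) (psi y))).
Proof.
case: k hk Hu0 Hrho0 T_max sol => [|[|[|K]]]// _ Hu0 Hrho0 T_max sol.
have F := HS2_solution_flow Hu0 Hrho0 u00 energy sol flow.
(* Positivity of [J] before [T'] gives a solution on [[0, T')], so [T'] lies below the supremum. *)
have long T' : (0 < T')%E -> (forall t y, lifespan T' t -> 0 < J u0 rho0 t y) -> (T' <= T)%E.
  move=> T'0 Jp; rewrite T_max; apply: ereal_sup_ubound; split => //.
  exact: HS2_explicit_solution Hu0 Hrho0 u00 energy T' T'0 Jp.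
have dPhi t : derive1 (phi_formula u0 rho0 t) = J u0 rho0 t.
  by rewrite (phi_formulaE Hu0 Hrho0 u00); have [] := Phi_C1 Hu0 Hrho0 t.
have finite_T m : is_minimum [set derive1 u0 x | x in [set x | rho0 x = 0]] m ->
    T = (pi / 2 + atan (m / 2))%:E.
  move=> mm; apply/eqP; rewrite eq_le; apply/andP; split.
    (* A longer life would include a time at which [J] vanishes somewhere, against its positivity
       for the given solution. *)
    rewrite leNgt; apply/negP => tsT.
    have Tt : lifespan T (pi / 2 + atan (m / 2)) by split=> //; exact/ltW/blowup_time_gt0.
    have [x Nx] := J_blowup mm; have [_ /(_ x)] := F _ Tt.
    by rewrite Nx ltxx.
  apply: long => [|t y [t0 tT]]; first by rewrite lte_fin blowup_time_gt0.
  by apply: (J_gt0_before mm); rewrite t0.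
have infinite_T : (forall x, rho0 x <> 0) -> T = +oo%E.
  move=> rn0; apply/eqP; rewrite -leye_eq; apply: long; first by rewrite ltey.
  by move=> t y _; apply: J_gt0_nonzero; exact/eqP.
split; [|split].
- move=> t x Tt /andP[x0 _]; have [-> _ _] := F t Tt.
  rewrite -(Phi_integral Hu0 Hrho0 u00) /integral_from0 x0.
  by apply: eq_Rintegral => y _; rewrite JE.
- split; [split; [exact: ltW|split]|split] => //.
  + move=> t Tt [[x _]]; rewrite dPhi => Nx _; have [_ /(_ x)] := F t Tt.
    by rewrite Nx ltxx.
  (* A finite [T] forces a zero of [rho0]. At that time [J] vanishes somewhere, and 0 is its minimum
     because [J] is a sum of squares. *)
  + move=> t Tt; have [ex|nex] := pselect (exists x, rho0 x = 0); last first.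
      by move: Tt; rewrite infinite_T// => x rx; apply: nex; exists x.
    have [m mm] := zero_slope_minimum Hu0 Hrho0 ex.
    move: Tt; rewrite (finite_T m mm) => -[<-].
    have [x Nx] := J_blowup mm; split; first by exists x; rewrite // dPhi.
    by move=> _ [y _ <-]; rewrite dPhi J_ge0.
  + move=> ex; have [m mm] := zero_slope_minimum Hu0 Hrho0 ex.
    by exists m; split; last exact: finite_T.
- move=> t Tt; have [E Np rE] := F t Tt.
  have [psi [pI p0 _]] := Phi_diffeo Hu0 Hrho0 u00 energy Np.
  exists psi; rewrite E; split=> //; have [_ _ _ pK Kp] := pI.
  have phiK y : phi t (psi y) = y by rewrite E Kp.
  split=> y.
    by have [_ _ H] := flow; have := H t (psi y) Tt; rewrite phiK.
  have [_ ->] := Phi_C1 Hu0 Hrho0 t.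
  by rewrite -(rE (psi y)) phiK mulfK// gt_eqF.
Qed.
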